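(* Let $X_j$, $j\in\mathbb N$, be zero-mean random processes on $[0,1]$ with continuous covariance functions satisfying the Basic assumption, let $Y_d$, $d\in\mathbb N$, be the associated additive random fields, and let $n^{Y_d}(\varepsilon)$ be their average case approximation complexity. Assume: (1) the sequence $\sum_{j=1}^d\bar\lambda_0^{X_j}\big/\sum_{j=1}^d\Lambda^{X_j}$, $d\in\mathbb N$, has a limit as $d\to\infty$, which is strictly less than $1$; let $\varepsilon_0\in(0,1]$ be the number such that $1-\varepsilon_0^2$ equals this limit; (2) $\max_{j=1,\dots,d}\bar\lambda_1^{X_j}=o\bigl(\sum_{j=1}^d\bar\Lambda^{X_j}\bigr)$ as $d\to\infty$; (3) there are a distribution function $U$ and a monotonic real sequence $(\ell_j)_{j\in\mathbb N}$ such that $$\frac{1}{\bar\Lambda^{X_j}}\sum_{k=1}^\infty\bar\lambda_k^{X_j}\,\mathbf 1\bigl(-\ln\bar\lambda_k^{X_j}-\ell_j\leqslant x\bigr)\to U(x),\quad j\to\infty,\quad\text{for all } x\in\mathbf C(U).$$ Let $\mathfrak s=1$ if $(\ell_j)_{j\in\mathbb N}$ is non-decreasing, and $\mathfrak s=-1$ if $(\ell_j)_{j\in\mathbb N}$ is non-increasing. Assume further: (4) there are a distribution function $W$, a real sequence $(a_d)_{d\in\mathbb N}$ and a positive sequence $(b_d)_{d\in\mathbb N}$ with $b_d\to\infty$, $d\to\infty$, such that $$\frac{\sum_{j=1}^d\bar\Lambda^{X_j}\,\mathbf 1\bigl(\mathfrak s\cdot(\ell_j-a_d)\leqslant x\,b_d\bigr)}{\sum_{m=1}^d\bar\Lambda^{X_m}}\to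 W(x),\quad d\to\infty,\quad\text{for all } x\in\mathbf C(W).$$ Define $F(x)=W(x)$, $x\in\mathbb R$, if $\mathfrak s=1$, and $F(x)=1-W(-x-0)$, $x\in\mathbb R$, if $\mathfrak s=-1$. Then $$\ln n^{Y_d}(\varepsilon)=\ln\Bigl(\sum_{j=1}^d\bar\Lambda^{X_j}\Bigr)+a_d+F^{-1}\bigl(1-(\varepsilon/\varepsilon_0)^2\bigr)\,b_d+o(b_d),\qquad d\to\infty,$$ for every $\varepsilon\in(0,\varepsilon_0)$ such that $1-(\varepsilon/\varepsilon_0)^2\in\mathbf C(F^{-1})$.
   Context: $\mathbb N=\{1,2,\dots\}$. $\mathbf 1(A)$ equals $1$ if the proposition $A$ is true and $0$ otherwise. A distribution function is a non-decreasing right-continuous function on $\mathbb R$ with limits $0$ at $-\infty$ and $1$ at $+\infty$; $W(y-0)$ denotes the left limit of $W$ at $y$, so $W(-x-0)$ is the left limit at the point $-x$. $\mathbf C(f)$ is the set of continuity points of $f$. For a distribution function $F$, $F^{-1}(y)=\inf\{x\in\mathbb R: F(x)\geqslant y\}$, $y\in(0,1)$. Setting. $X_j(t)$, $t\in[0,1]$, $j\in\mathbb N$, are zero-mean random processes with continuous covariance functions $\mathcal K^{X_j}(t,s)$. For each $d\in\mathbb N$, $Y_d(t)$, $t\in[0,1]^d$, is a zero-mean random field (a random element of $L_2([0,1]^d)$) with covariance function $\mathcal K^{Y_d}(t,s)=\sum_{j=1}^d\mathcal K^{X_j}(t_j,s_j)$, where $t=(t_1,\dots,t_d)$, $s=(s_1,\dots,s_d)$.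 Approximation complexity. Let $(\cdot,\cdot)_{2,d}$, $\|\cdot\|_{2,d}$ be the inner product and norm of $L_2([0,1]^d)$. For $n\in\mathbb N$ let $\mathcal A_n^{Y_d}=\{\sum_{m=1}^n (Y_d,\psi_m)_{2,d}\,\psi_m:\ \psi_m\in L_2([0,1]^d)\}$ and $e^{Y_d}(n)=\inf\{(\mathbb E\|Y_d-\widetilde Y\|_{2,d}^2)^{1/2}:\ \widetilde Y\in\mathcal A_n^{Y_d}\}$; let $e^{Y_d}(0)=(\mathbb E\|Y_d\|_{2,d}^2)^{1/2}<\infty$. For $\varepsilon\in(0,1)$, $n^{Y_d}(\varepsilon)=\min\{n\in\mathbb N:\ e^{Y_d}(n)\leqslant\varepsilon\, e^{Y_d}(0)\}$. Eigenvalues. $K^{X_j}$ is the covariance operator on $L_2([0,1])$, i.e. the integral operator with kernel $\mathcal K^{X_j}$; $(\lambda_k^{X_j})_{k\in\mathbb N}$ is its non-increasing sequence of eigenvalues (counted with multiplicity) with corresponding orthonormal eigenvectors $\psi_k^{X_j}$; if $K^{X_j}$ has finite rank $p$, one sets $\lambda_k^{X_j}=0$, $\psi_k^{X_j}\equiv0$ for $k>p$. $\Lambda^{X_j}=\sum_{k=1}^\infty\lambda_k^{X_j}$ is the trace. Basic assumption: for every $j\in\mathbb N$ the function identically equal to $1$ on $[0,1]$ is one of the eigenvectors $\psi_k^{X_j}$, $k\in\mathbb N$. Let $\bar\lambda_0^{X_j}$ be the eigenvalue corresponding to this eigenvector $1$, let $(\bar\lambda_k^{X_j})_{k\in\mathbb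 N}$ be the non-increasing sequence of the remaining eigenvalues, and $\bar\Lambda^{X_j}=\sum_{k\in\mathbb N}\bar\lambda_k^{X_j}=\Lambda^{X_j}-\bar\lambda_0^{X_j}$. Terms with $\bar\lambda_k^{X_j}=0$ contribute $0$ to the sums in (3), and (3) implicitly includes that $\bar\Lambda^{X_j}>0$ for all sufficiently large $j$. *)

(* Defs.v *)
From HB Require Import structures.
From mathcomp Require Import all_boot all_order all_algebra.
From mathcomp Require Import all_classical all_reals all_analysis.
Set Implicit Arguments.
Unset Strict Implicit.
Unset Printing Implicit Defensive.
Import Order.TTheory GRing.Theory Num.Theory.
Import numFieldNormedType.Exports.
Local Open Scope classical_set_scope.
Local Open Scope ring_scope.

(* Functions on [0, 1] and [0, 1]^n are encoded as total
   functions on R and on n.-tuple R; integration is with respect to Lebesgue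
   measure restricted to the unit interval or cube, so that L_2([0, 1]^n) is
   Lfun (cube_leb n) 2 up to almost everywhere equality. *)

Section unit_cube.
Context {R : realType}.

Definition unit_leb : set (measurableTypeR R) -> \bar R :=
  mrestr (@lebesgue_measure R) (measurable_itv `[0%R, 1%R]).

HB.instance Definition _ := Measure.on unit_leb.

Lemma unit_leb_setT : unit_leb setT = 1%E.
Proof.
rewrite /unit_leb /mrestr setTI lebesgue_measure_itv/= lte_fin ltr01.
by rewrite oppr0 adde0.
Qed.

HB.instance Definition _ :=
  Measure_isProbability.Build _ _ _ unit_leb unit_leb_setT.

Definition tcons n (x : measurableTypeR R * n.-tuple (measurableTypeR R)) :
  n.+1.-tuple (measurableTypeR R) := [tuple of x.1 :: x.2].

Lemma measurable_tcons n : measurable_fun setT (@tcons n).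
Proof. exact: (measurable_cons measurable_fst measurable_snd). Qed.

HB.instance Definition _ n :=
  isMeasurableFun.Build _ _ _ _ (@tcons n) (@measurable_tcons n).

(* n-dimensional Lebesgue measure restricted to [0, 1]^n: the n-fold product
   of unit_leb, carried from R * R^n to R^(n+1) by tcons. *)
Fixpoint cube_leb n : probability (n.-tuple (measurableTypeR R)) R :=
  if n is n'.+1 then distribution (unit_leb \x cube_leb n')%E (@tcons n')
  else \d_([tuple] : 0.-tuple (measurableTypeR R)).

Definition unit_cube n : set (n.-tuple (measurableTypeR R)) :=
  [set t | forall i, tnth t i \in `[0%R, 1%R]].

Definition inner n (f g : n.-tuple (measurableTypeR R) -> R) : R :=
  \int[cube_leb n]_t (f t * g t).

End unit_cube.

Section random_functions.
Context {R : realType} {dO : measure_display} {O : measurableType dO}.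
Variable P : probability O R.

(* A zero-mean square-integrable random function with index set D. *)
Definition zero_mean_process (I : Type) (D : set I) (X : I -> O -> R) : Prop :=
  forall t, D t -> X t \in Lfun P 2%:E /\ ('E_P[X t] = 0)%E.

Definition cov_fun (I : Type) (X : I -> O -> R) (t s : I) : R :=
  fine (covariance P (X t) (X s)).

(* A measurable random field with square-integrable paths, i.e. one that is a
   random element of L_2([0, 1]^n). *)
Definition L2_random_field n
    (Y : n.-tuple (measurableTypeR R) -> O -> R) : Prop :=
  measurable_fun setT
    (fun tw : n.-tuple (measurableTypeR R) * O => Y tw.1 tw.2) /\
  {ae P, forall w, (Y ^~ w) \in Lfun (cube_leb n) 2%:E}.

Section approximation.
Variables (d : nat) (Y : d.-tuple (measurableTypeR R) -> O -> R).

(* The psi_m are arbitrary: neither orthonormal nor linearly independent. *)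
Definition approximants (n : nat) :
    set (d.-tuple (measurableTypeR R) -> O -> R) :=
  [set Z | exists psi : 'I_n -> d.-tuple (measurableTypeR R) -> R,
     (forall m, psi m \in Lfun (cube_leb d) 2%:E) /\
     Z = fun t w => \sum_(m < n) inner (Y ^~ w) (psi m) * psi m t].

Definition mean_sq_dist (Z : d.-tuple (measurableTypeR R) -> O -> R) : \bar R :=
  (\int[P]_w \int[cube_leb d]_t ((Y t w - Z t w) ^+ 2)%:E)%E.

(* For n = 0 the only approximant is 0, so approx_error 0 is the square root
   of the mean squared norm of Y. *)
Definition approx_error (n : nat) : \bar R :=
  ereal_inf [set (mean_sq_dist Z `^ 2^-1)%E | Z in approximants n].

Definition admissible_rank (eps : R) : set nat :=
  [set n | (0 < n)%N /\ (approx_error n <= eps%:E * approx_error 0)%E].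

(* The minimum of the admissible ranks (0 would stand for "none"). *)
Definition approx_complexity (eps : R) : nat :=
  xget 0%N [set n | admissible_rank eps n /\
                    forall m, admissible_rank eps m -> (n <= m)%N].

End approximation.
End random_functions.

Section eigenvalues.
Context {R : realType}.

(* f lies in the mu-eigenspace of the integral operator with kernel K on
   L_2([0, 1]) (f = 0 included). The integration domain is repeated because K
   is only meaningful, and only assumed continuous, on [0, 1]^2. *)
Definition eigenfun (K : R -> R -> R) (mu : R)
    (f : measurableTypeR R -> R) : Prop :=
  f \in Lfun unit_leb 2%:E /\
  {ae unit_leb, forall t,
     \int[unit_leb]_(s in [set` `[0%R, 1%R]]) (K t s * f s) = mu * f t}.

(* lam is the non-increasing sequence of the eigenvalues of the covariance
   operator with kernel K, with orthonormal eigenvectors psi and with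
   lam k = 0, psi k = 0 beyond the rank. The last field says that the nonzero
   eigenvalues are all listed, with their multiplicity: each eigenspace is
   spanned by the psi k listed for it. *)
Record eigen_system (K : R -> R -> R) (lam : nat -> R)
    (psi : nat -> measurableTypeR R -> R) : Prop := EigenSystem {
  eigen_ge0 : forall k, 0 <= lam k ;
  eigen_noninc : nonincreasing_seq lam ;
  eigen_fun : forall k, eigenfun K (lam k) (psi k) ;
  eigen_orthonormal : forall k l, lam k != 0 -> lam l != 0 ->
    \int[unit_leb]_t (psi k t * psi l t) = (k == l)%:R ;
  eigen_pad : forall k, lam k = 0 -> {ae unit_leb, forall t, psi k t = 0} ;
  eigen_all : forall mu f, mu != 0 -> eigenfun K mu f ->
    exists (n : nat) (c : nat -> R),
      {ae unit_leb, forall t, f t = \sum_(k < n | lam k == mu) c k * psi k t}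
}.

Definition sum_seq (u : nat -> R) : R := limn (series u).

(* With lam k0 the eigenvalue of the constant 1: index 0 gives that eigenvalue,
   and indices 1, 2, ... list the remaining ones in order. *)
Definition bar_eig (lam : nat -> R) (k0 k : nat) : R :=
  if k is k'.+1 then (if (k' < k0)%N then lam k' else lam k'.+1) else lam k0.

Definition bar_trace (lam : nat -> R) (k0 : nat) : R :=
  sum_seq (fun k => bar_eig lam k0 k.+1).

End eigenvalues.

Section distribution_functions.
Context {R : realType}.

Definition left_limit (W : R -> R) (y : R) : R := lim (W z @[z --> y^'-]).

(* W is the limit law of sgn * (l_j - a_d) / b_d, F that of (l_j - a_d) / b_d. *)
Definition oriented_cdf (sgn : R) (W : R -> R) : R -> R :=
  if sgn == 1 then W else fun x => 1 - left_limit W (- x).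

Definition quantile (F : R -> R) (y : R) : R := inf [set x | y <= F x].

End distribution_functions.

(* Main.v *)
Require Import Defs.
From HB Require Import structures.
From mathcomp Require Import all_boot all_order all_algebra.
From mathcomp Require Import all_classical all_reals all_analysis.
From mathcomp Require Import measurable_realfun.
From mathcomp Require Import ring lra zify.
Set Implicit Arguments.
Unset Strict Implicit.
Unset Printing Implicit Defensive.
Import Order.TTheory GRing.Theory Num.Theory.
Import numFieldNormedType.Exports.
Local Open Scope classical_set_scope.
Local Open Scope ring_scope.

(** The covariance operator of Y_d can be diagonalised by hand. Since the
    constant 1 is an eigenfunction of every K_j, all other eigenfunctions
    psi_{j,k} of K_j have mean zero, so on the cube the constant 1 (with
    eigenvalue the sum over j of bar lambda_{j,0}) and the functions t |->
    psi_{j,k}(t_j) (with eigenvalues bar lambda_{j,k}) are orthonormal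
    eigenfunctions of the operator with kernel sum_j K_j(t_j, s_j).

    Let L_d = sum_j bar Lambda_j, let D_d = sum_j Lambda_j be the trace and let
    G_d(tau) be the mass of the bar lambda_{j,k}, j < d, that are at least tau.
    Keeping the constant and the eigenfunctions with eigenvalue at least tau
    gives n(eps) <= 1 + L_d / tau as soon as L_d - G_d(tau) < eps^2 D_d
    (approx_complexity_le). In the other direction an approximant of rank n
    cannot capture more than the mass G_d(tau), the constant, and n tau from
    the eigenvalues below tau, so L_d <= eps^2 D_d + G_d(tau) + n(eps) tau
    (approx_complexity_ge). The lower bound must allow arbitrary psi_m; it
    rests on rank_error_ge, a finite dimensional variational principle for sums
    of eigenvalues: a projection of rank n gives the i-th eigendirection a
    weight p_i in [0, 1], and the weights add up to at most n.

    Two facts make these bounds sharp. First, E |Y_d|^2 equals D_d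
    (trace_eq_sum_eigenvalues). One inequality is Bessel's inequality for Y_d.
    The other says that the integral of K(t, t) is at most the sum of the
    eigenvalues; it is proved without Mercer's theorem
    (trace_le_sum_eigenvalues): subtracting the first n spectral terms leaves a
    kernel whose operator norm tends to 0, because a nonzero symmetric kernel
    has an eigenfunction (symmetric_kernel_eigenfunction) and the given list of
    eigenvalues is complete; and the integral over the diagonal is compared
    with a pairing against a smoothing kernel, for which convergence in
    operator norm is enough.

    Second, at tau = exp(- (a_d + x b_d)) the fraction G_d(tau) / L_d is close
    to F(x). Convergence of the rescaled spectra to U says that - ln bar
    lambda_{j,k} = l_j + O(1) for all but a small part of the mass of the j-th
    process, uniformly in large j; the error O(1) is negligible against b_d
    (concentration), and convergence to W gives the law of (l_j - a_d) / b_d,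
    up to the orientation s (mass_near).

    Put y = 1 - (eps / eps0)^2 and let q be the y-quantile of F. Since L_d /
    D_d tends to eps0^2, eps^2 D_d is asymptotic to (1 - y) L_d. At x slightly
    above q one has F(x) > y, by continuity of the quantile function at y, and
    the upper bound gives ln n(eps) <= ln L_d + a_d + x b_d + O(1); at x
    slightly below q one has F(x) < y and the lower bound gives ln n(eps) >= ln
    L_d + a_d + x b_d - O(1). All O(1) terms are o(b_d), which proves the
    theorem (ln_complexity_asymptotics). *)

(** * Integration over a probability space *)

Section integration.
Context d (T : measurableType d) (R : realType) (mu : probability T R).
Implicit Types f g : T -> R.

Definition Rintegrable f := mu.-integrable setT (EFin \o f).

(** Kernels and eigenfunctions are kept in this class because it is closed
    under products and under integration in a parameter, so that Fubini
    applies with no further integrability condition. *)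
Definition bmeas d' (T' : measurableType d') (f : T' -> R) :=
  measurable_fun setT f /\ exists M : R, forall x, `|f x| <= M.

Definition sqint f := measurable_fun setT f /\ Rintegrable (fun x => f x ^+ 2).

Lemma Rintegrable_meas f : Rintegrable f -> measurable_fun setT f.
Proof. by move/measurable_int/measurable_EFinP. Qed.

Lemma bmeas_Rintegrable f : bmeas f -> Rintegrable f.
Proof.
move=> [mf [M fM]]; apply: (@measurable_bounded_integrable _ _ _ mu _ setT) => //.
  by rewrite (le_lt_trans (probability_le1 _ _)) ?ltry.
exists M; split; first exact: num_real.
by move=> x Mx y _ /=; rewrite (le_trans (fM y)) // ltW.
Qed.

Lemma RintegrableD f g : Rintegrable f -> Rintegrable g -> Rintegrable (fun x => f x + g x).
Proof. by move=> rf rg; exact: (integrableD _ rf rg). Qed.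

Lemma RintegrableB f g : Rintegrable f -> Rintegrable g -> Rintegrable (fun x => f x - g x).
Proof. by move=> rf rg; exact: (integrableB _ rf rg). Qed.

Lemma RintegrableZ c f : Rintegrable f -> Rintegrable (fun x => c * f x).
Proof. by move=> rf; exact: (integrableZl _ c rf). Qed.

Lemma Rintegrable_cst c : Rintegrable (fun=> c).
Proof. by apply: bmeas_Rintegrable; split => //; exists `|c|. Qed.

Lemma le_Rintegrable f g : measurable_fun setT f -> Rintegrable g ->
  (forall x, `|f x| <= g x) -> Rintegrable f.
Proof.
move=> mf rg fg; apply: (le_integrable _ _ _ rg) => //.
  exact/measurable_EFinP.
by move=> x _ /=; rewrite lee_fin (le_trans (fg x))// ler_norm.
Qed.

Lemma Rintegrable_sum (I : Type) (s : seq I) (P : pred I) (F : I -> T -> R) :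
  (forall i, P i -> Rintegrable (F i)) -> Rintegrable (fun x => \sum_(i <- s | P i) F i x).
Proof.
move=> rF; elim: s => [|i s IH].
  by under eq_fun do rewrite big_nil; exact: Rintegrable_cst.
under eq_fun do rewrite big_cons.
by case Pi: (P i) => //; apply: RintegrableD => //; exact: rF.
Qed.

Lemma int_sum (I : Type) (s : seq I) (P : pred I) (F : I -> T -> R) :
  (forall i, P i -> Rintegrable (F i)) ->
  \int[mu]_x (\sum_(i <- s | P i) F i x) = \sum_(i <- s | P i) \int[mu]_x F i x.
Proof.
move=> rF; elim: s => [|i s IH].
  rewrite big_nil; under eq_Rintegral do rewrite big_nil.
  by rewrite Rintegral_cst// mul0r.
rewrite big_cons; under eq_Rintegral do rewrite big_cons.
by case Pi: (P i) => //; rewrite RintegralD// ?IH//; [exact: rF|exact: Rintegrable_sum].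
Qed.

Lemma int_cst c : \int[mu]_x c = c.
Proof. by rewrite Rintegral_cst//= [X in fine X]probability_setT mulr1. Qed.

Lemma intD f g : Rintegrable f -> Rintegrable g ->
  \int[mu]_x (f x + g x) = \int[mu]_x f x + \int[mu]_x g x.
Proof. by move=> rf rg; rewrite RintegralD. Qed.

Lemma intB f g : Rintegrable f -> Rintegrable g ->
  \int[mu]_x (f x - g x) = \int[mu]_x f x - \int[mu]_x g x.
Proof. by move=> rf rg; rewrite RintegralB. Qed.

Lemma intZ c f : Rintegrable f -> \int[mu]_x (c * f x) = c * \int[mu]_x f x.
Proof. by move=> rf; rewrite RintegralZl. Qed.

Lemma int_ge0 f : (forall x, 0 <= f x) -> 0 <= \int[mu]_x f x.
Proof. by move=> f0; exact: Rintegral_ge0. Qed.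

Lemma le_int f g : Rintegrable f -> Rintegrable g -> (forall x, f x <= g x) ->
  \int[mu]_x f x <= \int[mu]_x g x.
Proof. by move=> rf rg fg; exact: le_Rintegral. Qed.

Lemma EFin_int f : Rintegrable f -> (\int[mu]_x f x)%:E = (\int[mu]_x (f x)%:E)%E.
Proof. by move=> rf; rewrite fineK//; exact: integrable_fin_num rf. Qed.

Lemma ae_eq_int f g : measurable_fun setT f -> measurable_fun setT g ->
  {ae mu, forall x, f x = g x} -> \int[mu]_x f x = \int[mu]_x g x.
Proof.
move=> mf mg fg; congr fine; apply: ae_eq_integral => //.
- exact/measurable_EFinP.
- exact/measurable_EFinP.
by apply: filterS fg => x /= ->.
Qed.

Lemma ae_Rintegrable f g : measurable_fun setT f -> measurable_fun setT g ->
  {ae mu, forall x, f x = g x} -> Rintegrable f -> Rintegrable g.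
Proof.
move=> mf mg fg /integrableP[_ If]; apply/integrableP; split.
  exact/measurable_EFinP.
suff -> : (\int[mu]_x `|(EFin \o g) x| = \int[mu]_x `|(EFin \o f) x|)%E by [].
apply: ae_eq_integral => //.
- by apply: measurableT_comp => //; exact/measurable_EFinP.
- by apply: measurableT_comp => //; exact/measurable_EFinP.
by apply: filterS fg => x /= ->.
Qed.

Lemma int_le_norm f (M : R) : Rintegrable f -> (forall x, `|f x| <= M) ->
  `|\int[mu]_x f x| <= M.
Proof.
move=> rf fM; rewrite (le_trans (le_normr_Rintegral _ rf))// -[leRHS]int_cst.
apply: le_int => //; [|exact: Rintegrable_cst].
by apply: le_Rintegrable (Rintegrable_cst M) _ => [|x];
  [apply: measurableT_comp => //; exact: Rintegrable_meas|rewrite normr_id].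
Qed.

Lemma Lfun_sqint f : f \in Lfun mu 2%:E <-> sqint f.
Proof.
split=> [l2f|[mf rf]].
  split; last exact: Lfun2_integrable_sqr.
  by move: l2f; rewrite inE => /andP[]; rewrite inE.
rewrite inE; apply/andP; split; rewrite inE//= /finite_norm unlock.
rewrite poweR_lty//; move/integrableP : rf => [_]; apply: le_lt_trans.
rewrite le_eqVlt; apply/orP; left; apply/eqP; apply: eq_integral => x _ /=.
by rewrite powR_mulrn// -normrX.
Qed.

Lemma sqint_mul f g : sqint f -> sqint g -> Rintegrable (fun x => f x * g x).
Proof.
move=> [mf rf] [mg rg]; apply: le_Rintegrable (RintegrableD rf rg) _.
  exact: measurable_funM.
move=> x; have := sqr_ge0 (f x + g x); have := sqr_ge0 (f x - g x).
have := sqr_ge0 (f x); have := sqr_ge0 (g x).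
rewrite sqrrB sqrrD => *; rewrite ler_norml; apply/andP; split; lra.
Qed.

Lemma sqintD f g : sqint f -> sqint g -> sqint (fun x => f x + g x).
Proof.
move=> [mf rf] [mg rg]; split; first exact: measurable_funD.
apply: le_Rintegrable (RintegrableZ 2 (RintegrableD rf rg)) _.
  by apply: measurable_funX; exact: measurable_funD.
move=> x; rewrite ger0_norm ?sqr_ge0//.
by have := sqr_ge0 (f x - g x); rewrite sqrrB sqrrD => *; lra.
Qed.

Lemma sqintZ c f : sqint f -> sqint (fun x => c * f x).
Proof.
move=> [mf rf]; split; first exact: measurable_funM.
by under eq_fun do rewrite exprMn; exact: RintegrableZ.
Qed.

Lemma sqintB f g : sqint f -> sqint g -> sqint (fun x => f x - g x).
Proof.
move=> lf lg; have := sqintD lf (sqintZ (-1) lg).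
by under eq_fun do rewrite mulN1r.
Qed.

Lemma bmeas_sqint f : bmeas f -> sqint f.
Proof.
move=> [mf [M fM]]; split => //; apply: bmeas_Rintegrable; split.
  exact: measurable_funX.
by exists (M ^+ 2) => x; rewrite normrX lerXn2r// nnegrE (le_trans _ (fM x)).
Qed.

Lemma sqint_Rintegrable f : sqint f -> Rintegrable f.
Proof.
move=> lf; have l1 : sqint (fun=> 1) by apply: bmeas_sqint; split => //; exists `|1|.
by have := sqint_mul lf l1; under eq_fun do rewrite mulr1.
Qed.

Lemma sqint_sum (I : Type) (s : seq I) (P : pred I) (F : I -> T -> R) :
  (forall i, P i -> sqint (F i)) -> sqint (fun x => \sum_(i <- s | P i) F i x).
Proof.
move=> rF; elim: s => [|i s IH].
  by under eq_fun do rewrite big_nil; apply: bmeas_sqint; split => //; exists 0 => x; rewrite normr0.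
under eq_fun do rewrite big_cons.
by case Pi: (P i) => //; apply: sqintD => //; exact: rF.
Qed.

(** The discriminant form of the Cauchy-Schwarz inequality, shared by the
    L2 inner product of functions and the Hilbert-Schmidt inner product of
    kernels. *)
Lemma cauchy_schwarz_quad (a b c : R) : 0 <= a -> 0 <= c ->
  (forall x, 0 <= a * x ^+ 2 + 2 * b * x + c) -> b ^+ 2 <= a * c.
Proof.
move=> a0 c0 H; have [a0'|a0'] := eqVneq a 0.
  have [->|b0] := eqVneq b 0; first by rewrite expr0n/= mulr_ge0.
  have := H (- (c + 1) / (2 * b)); rewrite a0' mul0r add0r.
  rewrite mulrC divfK ?mulf_neq0//; lra.
have ap : 0 < a by rewrite lt_neqAle eq_sym a0'.
have := H (- b / a).
have -> : a * (- b / a) ^+ 2 + 2 * b * (- b / a) + c = (a * c - b ^+ 2) / a.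
  by field.
by rewrite pmulr_lge0 ?invr_gt0// subr_ge0.
Qed.

Lemma int_cauchy_schwarz f g : sqint f -> sqint g ->
  (\int[mu]_x (f x * g x)) ^+ 2 <=
  (\int[mu]_x (f x ^+ 2)) * (\int[mu]_x (g x ^+ 2)).
Proof.
move=> lf lg; apply: cauchy_schwarz_quad.
- by apply: int_ge0 => x; exact: sqr_ge0.
- by apply: int_ge0 => x; exact: sqr_ge0.
move=> c; have : 0 <= \int[mu]_x ((c * f x + g x) ^+ 2).
  by apply: int_ge0 => x; exact: sqr_ge0.
have -> : (fun x => (c * f x + g x) ^+ 2) =
  (fun x => (c ^+ 2 * f x ^+ 2 + 2 * c * (f x * g x)) + g x ^+ 2).
  by apply/funext => x; ring.
have rfg := sqint_mul lf lg; case: lf lg => mf rf [mg rg].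
rewrite intD//; last by apply: RintegrableD; exact: RintegrableZ.
rewrite intD; [|exact: RintegrableZ..].
by rewrite !intZ//; lra.
Qed.

Lemma int_sqr_eq0 f : sqint f -> \int[mu]_x (f x ^+ 2) = 0 ->
  {ae mu, forall x, f x = 0}.
Proof.
move=> [mf rf] f0.
have : (\int[mu]_x (`|(f x ^+ 2)%:E|) = 0)%E.
  under eq_integral => x _ do rewrite gee0_abs ?lee_fin ?sqr_ge0//.
  by rewrite -EFin_int// f0.
move/(ae_eq_integral_abs _ measurableT).
have mf2 : measurable_fun setT (fun x => (f x ^+ 2)%:E).
  by apply/measurable_EFinP; exact: measurable_funX.
move=> /(_ mf2); apply: filterS => x /(_ I) [] /eqP.
by rewrite sqrf_eq0 => /eqP.
Qed.
End integration.

Section bounded.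
Context d (T : measurableType d) (R : realType).
Implicit Types f g : T -> R.

Lemma bmeas_cst c : bmeas (fun _ : T => c : R).
Proof. by split => //; exists `|c|. Qed.

Lemma bmeasD f g : bmeas f -> bmeas g -> bmeas (fun x => f x + g x).
Proof.
move=> [mf [M fM]] [mg [N gN]]; split; first exact: measurable_funD.
by exists (M + N) => x; rewrite (le_trans (ler_normD _ _))// lerD.
Qed.

Lemma bmeasM f g : bmeas f -> bmeas g -> bmeas (fun x => f x * g x).
Proof.
move=> [mf [M fM]] [mg [N gN]]; split; first exact: measurable_funM.
by exists (M * N) => x; rewrite normrM ler_pM.
Qed.

Lemma bmeasZ c f : bmeas f -> bmeas (fun x => c * f x).
Proof. by move=> bf; apply: bmeasM => //; exact: bmeas_cst. Qed.

Lemma bmeasB f g : bmeas f -> bmeas g -> bmeas (fun x => f x - g x).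
Proof.
move=> bf bg; have := bmeasD bf (bmeasZ (-1) bg).
by under eq_fun do rewrite mulN1r.
Qed.

Lemma bmeasX n f : bmeas f -> bmeas (fun x => f x ^+ n).
Proof.
move=> bf; elim: n => [|n IH]; first by under eq_fun do rewrite expr0; exact: bmeas_cst.
by under eq_fun do rewrite exprS; exact: bmeasM.
Qed.

Lemma bmeas_sum (I : Type) (s : seq I) (P : pred I) (F : I -> T -> R) :
  (forall i, P i -> bmeas (F i)) -> bmeas (fun x => \sum_(i <- s | P i) F i x).
Proof.
move=> rF; elim: s => [|i s IH].
  by under eq_fun do rewrite big_nil; exact: bmeas_cst.
under eq_fun do rewrite big_cons.
by case Pi: (P i) => //; apply: bmeasD => //; exact: rF.
Qed.

Lemma bmeas_comp d' (T' : measurableType d') (h : T' -> T) f :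
  measurable_fun setT h -> bmeas f -> bmeas (f \o h).
Proof.
by move=> mh [mf [M fM]]; split; [exact: measurableT_comp|exists M => x; exact: fM].
Qed.
End bounded.

Section parametric.
Context d1 d2 (T1 : measurableType d1) (T2 : measurableType d2) (R : realType).
Variable (m2 : probability T2 R).
Implicit Type f : T1 * T2 -> R.

Lemma bmeas_slice1 f y : bmeas f -> bmeas (fun x => f (x, y)).
Proof. exact: (bmeas_comp (pair2_measurable y)). Qed.

Lemma bmeas_slice2 f x : bmeas f -> bmeas (fun y => f (x, y)).
Proof. exact: (bmeas_comp (pair1_measurable x)). Qed.

(** Adding a bound M makes the integrand non-negative, so that
    measurability of the parametric integral follows from Tonelli. *)
Lemma bmeas_int f : bmeas f -> bmeas (fun x => \int[m2]_y f (x, y)).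
Proof.
move=> bf; have [mf [M fM]] := bf; split; last first.
  by exists M => x; apply: int_le_norm => //; exact/bmeas_Rintegrable/bmeas_slice2.
have -> : (fun x => \int[m2]_y f (x, y)) =
    (fun x => fine (\int[m2]_y (f (x, y) + M)%:E)%E - M).
  apply/funext => x; rewrite -[X in X - M]/(\int[m2]_y (f (x, y) + M)).
  rewrite intD ?int_cst ?addrK//; last exact: Rintegrable_cst.
  exact/bmeas_Rintegrable/bmeas_slice2.
apply: measurable_funB => //.
apply: (measurableT_comp (fine_measurable measurableT)) => //.
apply: (measurable_fun_fubini_tonelli_F (fun z => (f z + M)%:E)).
  by apply/measurable_EFinP; exact: measurable_funD.
by move=> z; rewrite lee_fin -lerBlDr sub0r; have := fM z; rewrite ler_norml => /andP[].
Qed.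
End parametric.

Section fubini_real.
Context d1 d2 (T1 : measurableType d1) (T2 : measurableType d2) (R : realType).
Variables (m1 : probability T1 R) (m2 : probability T2 R).
Implicit Type f : T1 * T2 -> R.

Lemma bmeas_prod_integrable f : bmeas f -> (m1 \x m2)%E.-integrable setT (EFin \o f).
Proof.
move=> bf; have [mf [M fM]] := bf.
apply/integrable12ltyP; first exact/measurable_EFinP.
apply: (@le_lt_trans _ _ (\int[m1]_x M%:E)%E).
  apply: ge0_le_integral => //.
  - by move=> x _; exact: integral_ge0.
  - apply: (measurable_fun_fubini_tonelli_F (fun z => `|(f z)%:E|%E)) => //.
    by apply: measurableT_comp => //; exact/measurable_EFinP.
  move=> x _; apply: (@le_trans _ _ (\int[m2]_y M%:E)%E).
    apply: ge0_le_integral => //.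
    + apply: measurableT_comp => //; apply/measurable_EFinP.
      by have [] := bmeas_slice2 x bf.
    + by move=> y _; rewrite lee_fin.
  by rewrite integral_cst//= [X in (_ * X)%E]probability_setT mule1.
by rewrite integral_cst//= [X in (_ * X)%E]probability_setT mule1 ltry.
Qed.

Lemma bmeas_fubini f : bmeas f ->
  \int[m1]_x \int[m2]_y f (x, y) = \int[m2]_y \int[m1]_x f (x, y).
Proof.
move=> bf; transitivity (fine (\int[m1]_x \int[m2]_y (f (x, y))%:E)%E).
  by congr fine; apply: eq_integral => x _; exact/EFin_int/bmeas_Rintegrable/bmeas_slice2.
rewrite (Fubini (bmeas_prod_integrable bf)).
congr fine; apply: eq_integral => y _; apply/esym.
exact/EFin_int/bmeas_Rintegrable/bmeas_slice1.
Qed.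
End fubini_real.

(** * Bounded kernels and the Hilbert-Schmidt inner product *)

Section kernels.
Context d (T : measurableType d) (R : realType) (mu : probability T R).
Implicit Types k h A : T -> T -> R.

Definition bker k := bmeas (fun p : T * T => k p.1 p.2).

(** The kernel of the composition of the two integral operators. *)
Definition kmul k h : T -> T -> R := fun t s => \int[mu]_u (k t u * h u s).

Definition hsdot k h : R := \int[mu]_t \int[mu]_s (k t s * h t s).

Lemma bker_l k s : bker k -> bmeas (k ^~ s).
Proof. exact: (bmeas_slice1 s). Qed.

Lemma bker_r k t : bker k -> bmeas (k t).
Proof. exact: (bmeas_slice2 t). Qed.

Lemma bker_tr k : bker k -> bker (fun t s => k s t).
Proof. exact: (bmeas_comp (@measurable_swap _ _ T T)). Qed.

Lemma bker_int k : bker k -> bmeas (fun t => \int[mu]_s k t s).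
Proof. exact: (@bmeas_int _ _ T T R mu). Qed.

Lemma bker_fubini k : bker k ->
  \int[mu]_t \int[mu]_s k t s = \int[mu]_s \int[mu]_t k t s.
Proof. exact: (@bmeas_fubini _ _ T T R mu mu). Qed.

Lemma bkerM k h : bker k -> bker h -> bker (fun t s => k t s * h t s).
Proof. exact: bmeasM. Qed.

Lemma bkerD k h : bker k -> bker h -> bker (fun t s => k t s + h t s).
Proof. exact: bmeasD. Qed.

Lemma bkerB k h : bker k -> bker h -> bker (fun t s => k t s - h t s).
Proof. exact: bmeasB. Qed.

Lemma bkerZ c k : bker k -> bker (fun t s => c * k t s).
Proof. exact: bmeasZ. Qed.

Lemma bker_fst (f : T -> R) : bmeas f -> bker (fun t _ => f t).
Proof. exact: (bmeas_comp (@measurable_fst _ _ T T)). Qed.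

Lemma bker_snd (f : T -> R) : bmeas f -> bker (fun _ s => f s).
Proof. exact: (bmeas_comp (@measurable_snd _ _ T T)). Qed.

Lemma bker_kmul k h : bker k -> bker h -> bker (kmul k h).
Proof.
move=> bk1 bh1; apply: (@bmeas_int _ _ (T * T)%type T R mu
  (fun q => k q.1.1 q.2 * h q.2 q.1.2)).
apply: bmeasM.
  apply: (bmeas_comp (h := fun q : T * T * T => (q.1.1, q.2)) _ bk1).
  by apply: measurable_fun_pair => //; apply: measurableT_comp.
apply: (bmeas_comp (h := fun q : T * T * T => (q.2, q.1.2)) _ bh1).
by apply: measurable_fun_pair => //; apply: measurableT_comp.
Qed.

Lemma hsdotC k h : hsdot k h = hsdot h k.
Proof. by apply: eq_Rintegral => t _; apply: eq_Rintegral => s _; rewrite mulrC. Qed.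

Lemma hsdotDl k1 k2 h : bker k1 -> bker k2 -> bker h ->
  hsdot (fun t s => k1 t s + k2 t s) h = hsdot k1 h + hsdot k2 h.
Proof.
move=> b1 b2 bh; rewrite /hsdot -intD; [|exact/bmeas_Rintegrable/bker_int/bkerM..].
apply: eq_Rintegral => t _; rewrite -intD; [|exact/bmeas_Rintegrable/bmeasM/bker_r/bh/bker_r..].
by apply: eq_Rintegral => s _; rewrite mulrDl.
Qed.

Lemma hsdotZl c k h : bker k -> bker h -> hsdot (fun t s => c * k t s) h = c * hsdot k h.
Proof.
move=> b1 bh; rewrite /hsdot -intZ; last exact/bmeas_Rintegrable/bker_int/bkerM.
apply: eq_Rintegral => t _; rewrite -intZ; last exact/bmeas_Rintegrable/bmeasM/bker_r/bh/bker_r.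
by apply: eq_Rintegral => s _; rewrite mulrA.
Qed.

Lemma hsdotBl k1 k2 h : bker k1 -> bker k2 -> bker h ->
  hsdot (fun t s => k1 t s - k2 t s) h = hsdot k1 h - hsdot k2 h.
Proof.
move=> b1 b2 bh.
have -> : (fun t s => k1 t s - k2 t s) = (fun t s => k1 t s + (-1) * k2 t s).
  by apply/funext => t; apply/funext => s; rewrite mulN1r.
by rewrite hsdotDl ?hsdotZl ?mulN1r//; exact: bkerZ.
Qed.

Lemma hsdot_ge0 k : 0 <= hsdot k k.
Proof. by apply: int_ge0 => t; apply: int_ge0 => s; rewrite -expr2 sqr_ge0. Qed.

Lemma hsdot_cauchy_schwarz k h : bker k -> bker h -> (hsdot k h) ^+ 2 <= hsdot k k * hsdot h h.
Proof.
move=> b1 bh; apply: cauchy_schwarz_quad; [exact: hsdot_ge0..|] => x.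
have := hsdot_ge0 (fun t s => x * k t s + h t s).
have bx := bkerZ x b1; have bxh := bkerD bx bh.
have E l (bl : bker l) : hsdot l (fun t s => x * k t s + h t s) = x * hsdot k l + hsdot h l.
  by rewrite hsdotC hsdotDl// hsdotZl.
by rewrite hsdotDl// hsdotZl// !E// [hsdot h k]hsdotC; lra.
Qed.

(** A symmetric integral operator is self-adjoint for the Hilbert-Schmidt
    inner product. *)
Lemma hsdot_kmul_adj A k h : bker A -> bker k -> bker h -> (forall t s, A t s = A s t) ->
  hsdot (kmul A k) h = hsdot k (kmul A h).
Proof.
move=> bA b1 bh sA; rewrite /hsdot.
rewrite bker_fubini; last exact/bkerM/bh/bker_kmul.
rewrite [RHS]bker_fubini; last exact/bkerM/bker_kmul.
apply: eq_Rintegral => s _.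
transitivity (\int[mu]_t \int[mu]_u (A t u * k u s * h t s)).
  apply: eq_Rintegral => t _; rewrite /kmul mulrC -intZ.
    by apply: eq_Rintegral => u _; rewrite mulrC.
  by apply/bmeas_Rintegrable/bmeasM; [exact: bker_r|exact: bker_l].
rewrite bker_fubini; last first.
  by apply: bkerM; [apply: bkerM => //; exact/bker_snd/bker_l|exact/bker_fst/bker_l].
apply: eq_Rintegral => t _; rewrite /kmul -intZ.
  by apply: eq_Rintegral => u _; rewrite sA; ring.
by apply/bmeas_Rintegrable/bmeasM; [exact: bker_r|exact: bker_l].
Qed.

Lemma kmulA A k h : bker A -> bker k -> bker h ->
  kmul A (kmul k h) = kmul (kmul A k) h.
Proof.
move=> bA b1 bh; apply/funext => t; apply/funext => s; rewrite /kmul.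
transitivity (\int[mu]_v \int[mu]_u (A t v * k v u * h u s)).
  apply: eq_Rintegral => v _; rewrite -intZ.
    by apply: eq_Rintegral => u _; rewrite mulrA.
  by apply/bmeas_Rintegrable/bmeasM; [exact: bker_r|exact: bker_l].
rewrite bker_fubini; last first.
  by apply: bkerM; [apply: bkerM => //; exact/bker_fst/bker_r|exact/bker_snd/bker_l].
apply: eq_Rintegral => u _; rewrite mulrC -intZ.
  by apply: eq_Rintegral => v _; rewrite mulrC.
by apply/bmeas_Rintegrable/bmeasM; [exact: bker_r|exact: bker_l].
Qed.

Lemma kmulZr c k h : bker k -> bker h ->
  kmul k (fun t s => c * h t s) = (fun t s => c * kmul k h t s).
Proof.
move=> b1 bh; apply/funext => t; apply/funext => s; rewrite /kmul -intZ.
  by apply: eq_Rintegral => u _; rewrite mulrCA.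
by apply/bmeas_Rintegrable/bmeasM; [exact: bker_r|exact: bker_l].
Qed.

Lemma kmulBr k h1 h2 : bker k -> bker h1 -> bker h2 ->
  kmul k (fun t s => h1 t s - h2 t s) = (fun t s => kmul k h1 t s - kmul k h2 t s).
Proof.
move=> b1 bh1 bh2; apply/funext => t; apply/funext => s; rewrite /kmul -intB.
- by apply: eq_Rintegral => u _; rewrite mulrBr.
- by apply/bmeas_Rintegrable/bmeasM; [exact: bker_r|exact: bker_l].
- by apply/bmeas_Rintegrable/bmeasM; [exact: bker_r|exact: bker_l].
Qed.

Lemma kmul_sqr_le k h t s : bker k -> bker h ->
  (kmul k h t s) ^+ 2 <=
  (\int[mu]_u (k t u ^+ 2)) * (\int[mu]_u (h u s ^+ 2)).
Proof. by move=> b1 bh; apply: int_cauchy_schwarz; apply: bmeas_sqint; [exact: bker_r|exact: bker_l]. Qed.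

(** Pointwise Cauchy-Schwarz, then integration: the Hilbert-Schmidt norm
    is submultiplicative. *)
Lemma hsdot_kmul_le k h : bker k -> bker h ->
  hsdot (kmul k h) (kmul k h) <= hsdot k k * hsdot h h.
Proof.
move=> b1 bh.
have bkk : bker (fun t s => k t s ^+ 2) by exact: (bmeasX 2 b1).
have bhh : bker (fun t s => h t s ^+ 2) by exact: (bmeasX 2 bh).
have bK := bker_int bkk; have bH := bker_int (bker_tr bhh).
have -> : hsdot k k = \int[mu]_t \int[mu]_u (k t u ^+ 2) by [].
have -> : hsdot h h = \int[mu]_s \int[mu]_u (h u s ^+ 2) by rewrite -bker_fubini.
rewrite mulrC -intZ; last exact: bmeas_Rintegrable.
have bkh := bker_kmul b1 bh.
apply: le_int => [| |t].
- exact/bmeas_Rintegrable/bker_int/bkerM.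
- exact/bmeas_Rintegrable/bmeasZ.
rewrite mulrC -intZ; last exact: bmeas_Rintegrable.
apply: le_int => [| |s].
- exact/bmeas_Rintegrable/bmeasM/bker_r/bkh/bker_r.
- exact/bmeas_Rintegrable/bmeasZ.
exact: kmul_sqr_le.
Qed.
End kernels.

(** * Powers of a symmetric kernel *)

Section power_ratio.
Variable R : realType.

(** This will be used for the squared Hilbert-Schmidt norms y n of the
    powers A^(n+1). Log-convexity makes the ratios y (n+1) / y n increase
    to a limit m, so x n = y n / m^(n+1) decreases. If some x n were below
    1, submultiplicativity x (n+k+1) <= x n * x k would keep x decaying
    geometrically, whereas its ratios tend to 1; hence x n >= 1. *)
Lemma log_convex_submult (y : nat -> R) : (forall n, 0 < y n) ->
  (forall n, y n.+1 ^+ 2 <= y n * y n.+2) ->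
  (forall a b, y (a + b).+1 <= y a * y b) ->
  exists m : R, [/\ 0 < m, y 1%N <= m * y 0%N,
    (forall n, m ^+ n.+1 <= y n) & cvgn (fun n => y n / m ^+ n.+1)].
Proof.
move=> y0 ylog ysub.
pose r n := y n.+1 / y n.
have r0 n : 0 < r n by rewrite divr_gt0.
have rincr : nondecreasing_seq r.
  apply/nondecreasing_seqP => n; rewrite /r.
  by rewrite ler_pdivrMr// mulrAC ler_pdivlMr// -expr2 [leRHS]mulrC.
have rub n : r n <= y 0%N.
  by rewrite /r ler_pdivrMr//; have := ysub 0%N n; rewrite add0n.
have cr : cvgn r.
  apply: nondecreasing_is_cvgn => //; exists (y 0%N) => _ [n _ <-]; exact: rub.
pose m := limn r.
have rm n : r n <= m by apply: nondecreasing_cvgn_le.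
have m0 : 0 < m by rewrite (lt_le_trans (r0 0%N)).
pose x n := y n / m ^+ n.+1.
have x0 n : 0 < x n by rewrite divr_gt0// exprn_gt0.
have xS n : x n.+1 = x n * (r n / m).
  rewrite /x /r [m ^+ n.+2]exprS; field.
  by rewrite !gt_eqF// exprn_gt0.
have xdecr : nonincreasing_seq x.
  apply/nonincreasing_seqP => n; rewrite xS ler_piMr ?(ltW (x0 n))//.
  by rewrite ler_pdivrMr// mul1r.
have xsub a b : x (a + b).+1 <= x a * x b.
  rewrite /x mulf_div -exprD addSn addnS ler_pM2r ?invr_gt0 ?exprn_gt0//.
(* Log-convexity: from k on, x decays no faster than geometrically with
   ratio r k / m. *)
have xlow k j : x k * (r k / m) ^+ j <= x (k + j)%N.
  elim: j => [|j IH]; first by rewrite expr0 mulr1 addn0.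
  rewrite addnS xS exprSr mulrA ler_pM//.
  - by rewrite mulr_ge0 ?exprn_ge0// ltW// divr_gt0.
  - by rewrite ltW// divr_gt0.
  - by rewrite ler_pM2r ?invr_gt0//; apply: rincr; rewrite leq_addr.
have x1 n : 1 <= x n.
  (* Compare this lower bound at k + n + 1 with submultiplicativity and
     divide by x k. *)
  have H k : (r k / m) ^+ n.+1 <= x n.
    have := xlow k n.+1; rewrite addnC addSn => /le_trans/(_ (xsub n k)).
    by rewrite mulrC ler_pM2r.
  have c1 : (r k / m) ^+ n.+1 @[k --> \oo] --> (1 : R).
    have -> : (1 : R) = (m / m) ^+ n.+1 by rewrite divff ?expr1n// gt_eqF.
    apply: (@cvg_comp _ _ _ (fun k => r k / m) (fun z => z ^+ n.+1)).
      by apply: cvgMr_tmp; exact: cr.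
    exact: exprn_continuous.
  by apply: (cvgr_to_le c1); exact: nearW.
exists m; split => //.
- by rewrite -ler_pdivrMr//; exact: rm.
- by move=> n; have := x1 n; rewrite /x ler_pdivlMr ?exprn_gt0// mul1r.
- apply: nonincreasing_is_cvgn => //; exists 0 => _ [n _ <-]; exact: ltW (x0 n).
Qed.
End power_ratio.

Section eigenfunction.
Context d (T : measurableType d) (R : realType) (mu : probability T R).
Variable A : T -> T -> R.
Hypotheses (bA : bker A) (sA : forall t s, A t s = A s t).

(** kpow n is the kernel of the (n+1)-st power, since the identity
    operator has no kernel. *)
Definition kpow n : T -> T -> R := iter n (kmul mu A) A.

Lemma bker_kpow n : bker (kpow n).
Proof. by elim: n => [|n IH] //=; exact: bker_kmul. Qed.

Lemma kpow_add a b : kpow (a + b).+1 = kmul mu (kpow a) (kpow b).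
Proof.
elim: a => [//|a IH]; rewrite addSn -[LHS]/(kmul mu A (kpow (a + b).+1)) IH.
by rewrite kmulA//; exact: bker_kpow.
Qed.

Lemma hsdot_kpow_shift a b : hsdot mu (kpow a.+1) (kpow b) = hsdot mu (kpow a) (kpow b.+1).
Proof. by apply: hsdot_kmul_adj => //; exact: bker_kpow. Qed.

(** Self-adjointness moves factors from one side to the other: the inner
    product depends only on the total number of factors. *)
Lemma hsdot_kpow_even a b : hsdot mu (kpow (2 * a)) (kpow (2 * b)) =
  hsdot mu (kpow (a + b)) (kpow (a + b)).
Proof.
have H k i j : hsdot mu (kpow (i + k)) (kpow j) = hsdot mu (kpow i) (kpow (j + k)).
  by elim: k i j => [|k IH] i j; rewrite ?addn0// !addnS hsdot_kpow_shift IH addSn.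
have [ab|/ltnW ba] := leqP a b.
  have -> : (a + b = 2 * a + (b - a))%N by lia.
  by rewrite H; congr (hsdot _ _ (kpow _)); lia.
rewrite hsdotC.
have -> : (a + b = 2 * b + (a - b))%N by lia.
by rewrite H; congr (hsdot _ _ (kpow _)); lia.
Qed.

(** If A A f = m f and sg^2 = m then A f + sg f is an eigenfunction of A
    for sg. For the two signs of the square root these cannot both vanish,
    since their difference is a nonzero multiple of f. *)
Lemma eigen_of_square (m : R) (f : T -> R) : 0 < m -> bmeas f ->
  \int[mu]_t (f t ^+ 2) != 0 ->
  (forall t, \int[mu]_u (A t u * \int[mu]_v (A u v * f v)) = m * f t) ->
  exists rho (g : T -> R), [/\ rho ^+ 2 = m, bmeas g,
    \int[mu]_t (g t ^+ 2) != 0 & forall t, \int[mu]_u (A t u * g u) = rho * g t].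
Proof.
move=> m0 bf f0 ff.
pose q := Num.sqrt m; have q2 : q ^+ 2 = m by rewrite sqr_sqrtr// ltW.
pose Af t := \int[mu]_v (A t v * f v).
have bAf : bmeas Af.
  by apply: (bker_int mu (k := fun t v => A t v * f v)); apply: bkerM => //; exact: bker_snd.
have Hg (sg : R) : sg ^+ 2 = m ->
    forall t, \int[mu]_u (A t u * (Af u + sg * f u)) = sg * (Af t + sg * f t).
  move=> sg2 t; transitivity (\int[mu]_u (A t u * Af u + sg * (A t u * f u))).
    by apply: eq_Rintegral => u _; ring.
  rewrite intD ?intZ; last 3 first.
  - by apply/bmeas_Rintegrable/bmeasM => //; exact: bker_r.
  - by apply/bmeas_Rintegrable/bmeasM => //; exact: bker_r.
  - by apply/bmeas_Rintegrable/bmeasZ/bmeasM => //; exact: bker_r.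
  by rewrite ff -sg2 -/(Af t); ring.
have [g0|g0] := eqVneq (\int[mu]_t ((Af t + q * f t) ^+ 2)) 0; last first.
  exists q, (fun t => Af t + q * f t); split => //; last exact: Hg.
  by apply: bmeasD => //; exact: bmeasZ.
have [h0|h0] := eqVneq (\int[mu]_t ((Af t + (- q) * f t) ^+ 2)) 0; last first.
  exists (- q), (fun t => Af t + (- q) * f t); split => //.
  - by rewrite sqrrN.
  - by apply: bmeasD => //; exact: bmeasZ.
  - by apply: Hg; rewrite sqrrN.
have bg : bmeas (fun t => Af t + q * f t) by apply: bmeasD => //; exact: bmeasZ.
have bh : bmeas (fun t => Af t + (- q) * f t) by apply: bmeasD => //; exact: bmeasZ.
(* Both candidates vanish; (Af + q f)^2 and (Af - q f)^2 together dominate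
   a multiple of f^2. *)
have ub : \int[mu]_t (4 * m * (f t) ^+ 2) <=
    \int[mu]_t (2 * (Af t + q * f t) ^+ 2 + 2 * (Af t + (- q) * f t) ^+ 2).
  apply: le_int.
  - exact/bmeas_Rintegrable/bmeasZ/bmeasX.
  - by apply: bmeas_Rintegrable; apply: bmeasD; apply: bmeasZ; exact: bmeasX.
  by move=> t; rewrite -q2; have := sqr_ge0 (Af t); lra.
have f1 : 0 <= \int[mu]_t (f t ^+ 2) by apply: int_ge0 => t; exact: sqr_ge0.
move: ub; rewrite intD; [|exact/bmeas_Rintegrable/bmeasZ/bmeasX..].
rewrite !intZ; [|exact/bmeas_Rintegrable/bmeasX..].
rewrite g0 h0 !mulr0 addr0 => ub; exfalso.
have : 0 < \int[mu]_t (f t ^+ 2) by rewrite lt_neqAle eq_sym f0.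
by move=> /(mulr_gt0 (mulr_gt0 (ltr0n _ 4) m0)); rewrite ltNge ub.
Qed.
End eigenfunction.

(** * Existence of an eigenfunction *)

Section spectral.
Context d (T : measurableType d) (R : realType) (mu : probability T R).
Variable A : T -> T -> R.
Hypotheses (bA : bker A) (sA : forall t s, A t s = A s t).

Notation kpow := (kpow mu A).
Let y n := hsdot mu (kpow n) (kpow n).

Lemma kpow_norm_gt0 : 0 < y 1%N -> forall n, 0 < y n.
Proof.
move=> y1; have y0 : 0 < y 0%N.
  have ge0 : 0 <= y 0%N by exact: hsdot_ge0.
  have le1 : y 1%N <= y 0%N * y 0%N by exact: hsdot_kmul_le.
  rewrite lt_neqAle ge0 andbT eq_sym; apply: contraTneq (lt_le_trans y1 le1) => ->.
  by rewrite mulr0 ltxx.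
suff H n : 0 < y n /\ 0 < y n.+1 by move=> n; exact: (H n).1.
elim: n => [|n [yn yn1]]; split; [exact: y0|exact: y1|exact: yn1|].
have H : y n.+1 ^+ 2 <= y n * y n.+2.
  rewrite {1}/y (hsdot_kpow_shift mu bA sA n n.+1).
  exact: (hsdot_cauchy_schwarz mu (bker_kpow mu bA n) (bker_kpow mu bA n.+2)).
by rewrite -(pmulr_rgt0 _ yn); exact: lt_le_trans (exprn_gt0 2 yn1) H.
Qed.

(** Composition with the bounded kernel A on both sides turns smallness in
    Hilbert-Schmidt norm into uniform smallness. *)
Lemma sandwich_bound (D : T -> T -> R) (M : R) : bker D -> (forall t s, `|A t s| <= M) ->
  forall t s, `|kmul mu A (kmul mu D A) t s| <= M ^+ 2 * Num.sqrt (hsdot mu D D).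
Proof.
move=> bD AM t s; have M0 : 0 <= M by rewrite (le_trans _ (AM t s)).
have A2 t' : \int[mu]_u (A t' u ^+ 2) <= M ^+ 2.
  rewrite -[leRHS](int_cst mu); apply: le_int => [| |u].
  - exact/bmeas_Rintegrable/bmeasX/bker_r.
  - exact: Rintegrable_cst.
  - by rewrite -real_normK ?num_real// lerXn2r// nnegrE.
have bDA := bker_kmul mu bD bA.
have DA : \int[mu]_u (kmul mu D A u s ^+ 2) <= hsdot mu D D * M ^+ 2.
  rewrite mulrC -intZ; last by apply/bmeas_Rintegrable/bker_int/bkerM.
  apply: le_int => [| |u].
  - exact/bmeas_Rintegrable/bmeasX/bker_l.
  - by apply/bmeas_Rintegrable/bmeasZ/bker_int/bkerM.
  have := kmul_sqr_le mu u s bD bA => /le_trans; apply.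
  rewrite mulrC ler_pM ?int_ge0// => [v|v|]; rewrite ?sqr_ge0//.
  by under eq_Rintegral do rewrite sA.
rewrite -(@ler_pXn2r _ 2)// ?nnegrE ?mulr_ge0 ?sqr_ge0 ?sqrtr_ge0//.
rewrite real_normK ?num_real// exprMn sqr_sqrtr ?hsdot_ge0//.
apply: (le_trans (kmul_sqr_le mu t s bA bDA)).
rewrite expr2 -mulrA [M ^+ 2 * hsdot _ _ _]mulrC.
by apply: ler_pM; rewrite ?int_ge0// => u; exact: sqr_ge0.
Qed.

Lemma uniform_cauchy_limit (p : nat -> T -> T -> R) : (forall n, bker (p n)) ->
  (forall e, 0 < e -> exists N, forall a b, (N <= a)%N -> (N <= b)%N ->
     forall t s, `|p a t s - p b t s| <= e) ->
  exists q, bker q /\ (forall e, 0 < e -> exists N, forall a, (N <= a)%N ->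
     forall t s, `|p a t s - q t s| <= e).
Proof.
move=> bp cp.
have cv t s : cvgn (fun n => p n t s).
  apply: cauchy_cvg; apply: cauchy_exP => e e0.
  have [N HN] := cp (e / 2) (divr_gt0 e0 (ltr0n _ 2)).
  exists (p N t s); exists N => // a /= Na.
  rewrite /ball/= (le_lt_trans (HN N a (leqnn _) Na t s))//; lra.
pose q t s := limn (fun n => p n t s).
have Hq e : 0 < e -> exists N, forall a, (N <= a)%N ->
     forall t s, `|p a t s - q t s| <= e.
  move=> e0; have [N HN] := cp e e0; exists N => a Na t s.
  have c1 : `|p a t s - p n t s| @[n --> \oo] --> `|p a t s - q t s|.
    by apply: cvg_norm; apply: cvgB; [exact: cvg_cst|exact: cv].
  by apply: (cvgr_to_le c1); exists N => // n /= Nn; exact: HN.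
exists q; split => //; split.
  apply: (@measurable_fun_cvg _ _ _ _ (fun n (z : T * T) => p n z.1 z.2)) => //.
    by move=> n; case: (bp n).
have [N HN] := Hq 1 ltr01; have [_ [M HM]] := bp N.
exists (M + 1) => -[t s] /=.
have -> : q t s = p N t s - (p N t s - q t s) by ring.
by rewrite (le_trans (ler_normB _ _))// lerD//; [exact: (HM (t, s))|exact: HN].
Qed.

(** Power iteration, after H. A. Schwarz. With m the limit ratio of
    log_convex_submult, the normalised powers h n = A^(2n+1) / m^n satisfy
    <h a, h b> = m x (a + b), so |h a - h b|^2 = m (x (2a) + x (2b) - 2 x
    (a+b)) tends to 0 because x converges. The kernels A (h n) A then
    converge uniformly; the limit q satisfies A A q = m q and is nonzero
    because x n >= 1. A nonzero column of q is an eigenfunction of A^2.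
    The inequality y 1 <= rho^2 y 0 records that the eigenvalue found is
    not too small. *)
Theorem symmetric_kernel_eigenfunction : 0 < y 1%N ->
  exists rho (g : T -> R), [/\ y 1%N <= rho ^+ 2 * y 0%N, rho != 0, bmeas g,
    \int[mu]_t (g t ^+ 2) != 0 & forall t, \int[mu]_u (A t u * g u) = rho * g t].
Proof.
move=> y1; have yp := kpow_norm_gt0 y1.
have [m [m0 y1m mlow mcv]] : exists m : R, [/\ 0 < m, y 1%N <= m * y 0%N,
    (forall n, m ^+ n.+1 <= y n) & cvgn (fun n => y n / m ^+ n.+1)].
  apply: log_convex_submult; first exact: yp.
    move=> n; rewrite {1}/y (hsdot_kpow_shift mu bA sA n n.+1).
    exact: (hsdot_cauchy_schwarz mu (bker_kpow mu bA n) (bker_kpow mu bA n.+2)).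
  move=> a b; rewrite {1}/y (kpow_add mu bA).
  exact: (hsdot_kmul_le mu (bker_kpow mu bA a) (bker_kpow mu bA b)).
have [_ [M AM']] := bA; have AM t s : `|A t s| <= M by exact: (AM' (t, s)).
pose x n := y n / m ^+ n.+1.
pose h n t s := (m ^+ n)^-1 * kpow (2 * n) t s.
have bh n : bker (h n) by apply: bkerZ; exact: bker_kpow.
pose p n t s := (m ^+ n)^-1 * kpow (2 * n).+2 t s.
have bp n : bker (p n) by apply: bkerZ; exact: bker_kpow.
have mn n : m ^+ n != 0 by rewrite gt_eqF// exprn_gt0.
have pE n : p n = kmul mu A (kmul mu (h n) A).
  apply/funext => t; apply/funext => s; rewrite /p /h.
  have -> : kmul mu (fun t s => (m ^+ n)^-1 * kpow (2 * n) t s) A =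
      (fun t s => (m ^+ n)^-1 * kpow (2 * n).+1 t s).
    have -> : (2 * n).+1 = (2 * n + 0).+1 by rewrite addn0.
    rewrite kpow_add//; apply/funext => t'; apply/funext => s'.
    rewrite /kmul -intZ; last first.
      by apply/bmeas_Rintegrable/bmeasM; [exact/bker_r/bker_kpow|exact: bker_l].
    by apply: eq_Rintegral => u _; rewrite mulrA.
  by rewrite kmulZr//; exact: bker_kpow.
have hsh a b : hsdot mu (h a) (h b) = m * x (a + b)%N.
  rewrite hsdotZl; [|exact: bker_kpow|exact: bh].
  rewrite hsdotC hsdotZl; [|exact: bker_kpow..].
  rewrite (hsdot_kpow_even mu bA sA) [(b + a)%N]addnC -/(y (a + b)) /x exprS exprD.
  by field; rewrite !mn gt_eqF.
have pB a b t s : `|p a t s - p b t s| <=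
    M ^+ 2 * Num.sqrt (m * (x (a + a)%N + x (b + b)%N - 2 * x (a + b)%N)).
  pose D t s := h a t s - h b t s; have bD : bker D by exact: bkerB.
  have -> : p a t s - p b t s = kmul mu A (kmul mu D A) t s.
    have -> : kmul mu D A = fun t s => kmul mu (h a) A t s - kmul mu (h b) A t s.
      apply/funext => t'; apply/funext => s'; rewrite /kmul -intB.
      - by apply: eq_Rintegral => u _; rewrite -mulrBl.
      - by apply/bmeas_Rintegrable/bmeasM; [exact: bker_r|exact: bker_l].
      - by apply/bmeas_Rintegrable/bmeasM; [exact: bker_r|exact: bker_l].
    by rewrite kmulBr//; [rewrite !pE|exact: bker_kmul..].
  apply: (le_trans (sandwich_bound bD AM t s)).
  rewrite le_eqVlt; apply/orP; left; apply/eqP; congr (_ * Num.sqrt _).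
  rewrite hsdotBl//; rewrite hsdotC hsdotBl// [hsdot _ (h b) D]hsdotC hsdotBl//.
  by rewrite !hsh [(b + a)%N]addnC; ring.
have xc : x n @[n --> \oo] --> limn x by exact: mcv.
have M20 : 0 <= M ^+ 2 by exact: sqr_ge0.
have [q [bq pq]] : exists q, bker q /\ (forall e, 0 < e -> exists N, forall a, (N <= a)%N ->
     forall t s, `|p a t s - q t s| <= e).
  apply: uniform_cauchy_limit => // e e0.
  pose e1 := (e / (M ^+ 2 + 1)) ^+ 2 / (4 * m).
  have M21 : 0 < M ^+ 2 + 1 by rewrite ltr_wpDl.
  have e10 : 0 < e1 by apply: divr_gt0; [exact/exprn_gt0/divr_gt0|exact: mulr_gt0].
  move/cvgrPdist_le : (xc) => /(_ _ e10) [N _ HN].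
  exists N => a b Na Nb t s; apply: (le_trans (pB a b t s)).
  have -> : e = (M ^+ 2 + 1) * (e / (M ^+ 2 + 1)).
    by rewrite mulrC divfK// gt_eqF.
  apply: ler_pM; rewrite ?sqrtr_ge0 ?lerDl//.
  have e20 : 0 <= e / (M ^+ 2 + 1) by rewrite ltW// divr_gt0.
  rewrite -[leRHS]ger0_norm// -sqrtr_sqr ler_wsqrtr//.
  have -> : (e / (M ^+ 2 + 1)) ^+ 2 = m * (4 * e1).
    by rewrite /e1; field; rewrite !gt_eqF.
  rewrite ler_pM2l//.
  have /ler_normlP[u1 u2] := HN (a + a)%N (leq_trans Na (leq_addr _ _)).
  have /ler_normlP[u3 u4] := HN (b + b)%N (leq_trans Nb (leq_addr _ _)).
  have /ler_normlP[u5 u6] := HN (a + b)%N (leq_trans Na (leq_addr _ _)).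
  lra.
(* The norm of p N stays bounded away from 0, so q is nonzero and has a
   nonzero column. *)
have [s fs] : exists s, \int[mu]_t (q t s ^+ 2) != 0.
  apply: contrapT => /forallNP H.
  have q0 : hsdot mu q q = 0.
    rewrite /hsdot bker_fubini; last exact: bkerM.
    transitivity (\int[mu]_s (0 : R)); last by rewrite int_cst.
    apply: eq_Rintegral => s _; have /negP := H s; rewrite negbK => /eqP <-.
    by apply: eq_Rintegral.
  have m3 : 0 < m ^+ 3 by exact: exprn_gt0.
  pose e := Num.sqrt (m ^+ 3 / 4).
  have e2 : e ^+ 2 = m ^+ 3 / 4 by rewrite sqr_sqrtr// divr_ge0// ltW.
  have e0 : 0 < e by rewrite sqrtr_gt0 divr_gt0.
  have [N /(_ N (leqnn _)) HN] := pq e e0.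
  have : hsdot mu (p N) (p N) <= 2 * hsdot mu q q + 2 * e ^+ 2.
    rewrite /hsdot -intZ; last by apply/bmeas_Rintegrable/bker_int/bkerM.
    rewrite -[X in _ + X](int_cst mu) -intD; last 2 first.
    - by apply/bmeas_Rintegrable/bmeasZ/bker_int/bkerM.
    - exact: Rintegrable_cst.
    apply: le_int => [| |t].
    - by apply/bmeas_Rintegrable/bker_int/bkerM.
    - by apply: bmeas_Rintegrable; apply: bmeasD; [apply/bmeasZ/bker_int/bkerM|exact: bmeas_cst].
    rewrite -intZ; last by apply/bmeas_Rintegrable/bmeasM; exact: bker_r.
    rewrite -[X in _ + X](int_cst mu) -intD; last 2 first.
    - by apply/bmeas_Rintegrable/bmeasZ/bmeasM; exact: bker_r.
    - exact: Rintegrable_cst.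
    apply: le_int => [| |s].
    - by apply/bmeas_Rintegrable/bmeasM; exact: bker_r.
    - by apply: bmeas_Rintegrable; apply: bmeasD; [apply/bmeasZ/bmeasM; exact: bker_r|exact: bmeas_cst].
    have : (p N t s - q t s) ^+ 2 <= e ^+ 2.
      by rewrite -real_normK ?num_real// lerXn2r// ?nnegrE// ltW.
    have := sqr_ge0 (p N t s - q t s - q t s).
    rewrite !expr2; lra.
  rewrite q0 mulr0 add0r e2.
  have -> : hsdot mu (p N) (p N) = y (2 * N).+2 / m ^+ (2 * N).
    rewrite hsdotZl; [|exact: bker_kpow|exact: bp].
    rewrite hsdotC hsdotZl; [|exact: bker_kpow..].
    have -> : m ^+ (2 * N) = m ^+ N * m ^+ N by rewrite -exprD addnn mul2n.
    by rewrite invfM mulrA mulrC.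
  rewrite ler_pdivrMr ?exprn_gt0// => H1.
  have := le_trans (mlow _) H1; rewrite -addn3 exprD.
  have Z (z w : R) : 0 < z -> 0 < w -> z * w <= 2 * (w / 4) * z -> False.
    move=> z0 w0; apply/negP; rewrite -ltNge [ltLHS](_ : _ = z * w / 2); last by field.
    by rewrite ltr_pdivrMr// ltr_pMr ?mulr_gt0// ltr1n.
  exact: Z (exprn_gt0 _ m0) m3.
suff ffs : forall t, \int[mu]_u (A t u * \int[mu]_v (A u v * q v s)) = m * q t s.
  have [rho [g [r1 r2 r3 r4]]] := eigen_of_square bA m0 (bker_l s bq) fs ffs.
  exists rho, g; split => //; first by rewrite r1.
  by apply: contra_eq_neq (esym r1) => ->; rewrite expr0n/= gt_eqF.
move=> t.
have -> : \int[mu]_u (A t u * \int[mu]_v (A u v * q v s)) = kmul mu A (kmul mu A q) t s.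
  by [].
apply/eqP; rewrite -subr_eq0 -normr_eq0 eq_le normr_ge0 andbT.
apply/ler_addgt0Pr => e e0; rewrite add0r.
have c0 : 0 < M ^+ 2 + m + 1 by rewrite ltr_wpDl// addr_ge0// ltW.
have [N HN] := pq _ (divr_gt0 e0 c0).
(* The recurrence A A (p N) = m (p (N+1)), to be passed to the limit. *)
have E1 : kmul mu A (kmul mu A (p N)) t s = m * p N.+1 t s.
  rewrite /p kmulZr//; last exact: bker_kpow.
  rewrite kmulZr//; last by apply: bker_kmul => //; exact: bker_kpow.
  have -> : (2 * N.+1).+2 = (2 * N).+4 by lia.
  rewrite -[kmul mu A (kmul mu A _)]/(kpow (2 * N).+4) exprS.
  by field; rewrite mn gt_eqF.
pose D t s := p N t s - q t s; have bD : bker D by exact: bkerB.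
have E2 : kmul mu A (kmul mu A D) t s =
    kmul mu A (kmul mu A (p N)) t s - kmul mu A (kmul mu A q) t s.
  by rewrite kmulBr// kmulBr//; exact: bker_kmul.
have M0 : 0 <= M by rewrite (le_trans _ (AM t s)).
have kb (k : T -> T -> R) (c : R) : bker k -> (forall t s, `|k t s| <= c) ->
    forall t s, `|kmul mu A k t s| <= M * c.
  move=> bk0 kc t' s'; apply: int_le_norm.
    by apply/bmeas_Rintegrable/bmeasM; [exact: bker_r|exact: bker_l].
  by move=> u; rewrite normrM ler_pM.
have B1 : `|kmul mu A (kmul mu A D) t s| <= M * (M * (e / (M ^+ 2 + m + 1))).
  apply: (kb); first exact: bker_kmul.
  by apply: (kb) => // t' s'; apply: HN.
have B2 : `|m * p N.+1 t s - m * q t s| <= m * (e / (M ^+ 2 + m + 1)).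
  by rewrite -mulrBr normrM gtr0_norm// ler_pM2l//; exact: HN.
have -> : kmul mu A (kmul mu A q) t s - m * q t s =
   (m * p N.+1 t s - m * q t s) - kmul mu A (kmul mu A D) t s.
  by rewrite E2 E1; ring.
apply: (le_trans (ler_normB _ _)); apply: (le_trans (lerD B2 B1)).
set z := e / _; have -> : e = (M ^+ 2 + m + 1) * z by rewrite mulrC divfK// gt_eqF.
have z0 : 0 <= z by rewrite ltW// divr_gt0.
rewrite -subr_ge0; have -> : (M ^+ 2 + m + 1) * z - (m * z + M * (M * z)) = z by ring.
by [].
Qed.
End spectral.

(** * Deflation and the trace inequality *)

Lemma cvg_bigsum (R : realType) (I : Type) (s : seq I) (f : I -> nat -> R) (l : I -> R) :
  (forall i, f i n @[n --> \oo] --> l i) ->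
  \sum_(i <- s) f i n @[n --> \oo] --> \sum_(i <- s) l i.
Proof.
move=> fl; elim: s => [|i s IH].
  by under eq_fun do rewrite big_nil; rewrite big_nil; exact: cvg_cst.
under eq_fun do rewrite big_cons; rewrite big_cons.
by apply: cvgD; [exact: fl|exact: IH].
Qed.

(** Combines the two applications of Cauchy-Schwarz in quadratic_form_le. *)
Lemma iterated_sqr_le (R : realFieldType) (x z y c : R) : 0 <= c ->
  x ^+ 2 <= z * c -> z ^+ 2 <= y * c * c -> x ^+ 4 <= y * c ^+ 4.
Proof.
move=> c0 h1 h2; rewrite (exprM _ 2 2).
have h3 : (x ^+ 2) ^+ 2 <= (z * c) ^+ 2.
  by rewrite lerXn2r// nnegrE ?sqr_ge0// (le_trans (sqr_ge0 x)).
apply: (le_trans h3); rewrite exprMn.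
have -> : y * c ^+ 4 = y * c * c * c ^+ 2 by ring.
by rewrite ler_wpM2r ?sqr_ge0.
Qed.

Section hsdot_sum.
Context d (T : measurableType d) (R : realType) (mu : probability T R).

Lemma hsdotDr (h k1 k2 : T -> T -> R) : bker h -> bker k1 -> bker k2 ->
  hsdot mu h (fun t s => k1 t s + k2 t s) = hsdot mu h k1 + hsdot mu h k2.
Proof. by move=> bh b1 b2; rewrite hsdotC (hsdotDl mu b1 b2 bh) (hsdotC mu h k1) (hsdotC mu h k2). Qed.

Lemma hsdotZr (c : R) (h k : T -> T -> R) : bker h -> bker k ->
  hsdot mu h (fun t s => c * k t s) = c * hsdot mu h k.
Proof. by move=> bh b1; rewrite hsdotC (hsdotZl mu c b1 bh) (hsdotC mu h k). Qed.

Lemma bker_sum m (E : 'I_m -> T -> T -> R) : (forall i, bker (E i)) ->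
  bker (fun t s => \sum_(i < m) E i t s).
Proof.
by move=> bE; apply: (@bmeas_sum _ (T * T)%type R _ _ _ (fun i z => E i z.1 z.2)) => i _; exact: bE.
Qed.

Lemma hsdot_sumr (h : T -> T -> R) m (E : 'I_m -> T -> T -> R) : bker h ->
  (forall i, bker (E i)) ->
  hsdot mu h (fun t s => \sum_(i < m) E i t s) = \sum_(i < m) hsdot mu h (E i).
Proof.
move=> bh bE.
have bhE i : bker (fun t s => h t s * E i t s) by exact: bkerM.
rewrite -int_sum => [|i _]; last exact/bmeas_Rintegrable/(bker_int mu (bhE i)).
apply: eq_Rintegral => t _; rewrite -int_sum => [|i _]; last exact/bmeas_Rintegrable/(bker_r t (bhE i)).
by apply: eq_Rintegral => s _; rewrite mulr_sumr.
Qed.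
End hsdot_sum.

Section quadratic_form.
Context d (T : measurableType d) (R : realType) (mu : probability T R).
Variable A : T -> T -> R.
Hypotheses (bA : bker A) (sA : forall t s, A t s = A s t).

Lemma hsdot_rank1 (f g : T -> R) (k : T -> T -> R) : bker k -> bmeas f -> bmeas g ->
  hsdot mu k (fun t s => f t * g s) = \int[mu]_t (f t * \int[mu]_s (k t s * g s)).
Proof.
move=> b1 bf bg; apply: eq_Rintegral => t _; rewrite -intZ.
  by apply: eq_Rintegral => s _; ring.
by apply/bmeas_Rintegrable/bmeasM => //; exact: bker_r.
Qed.

(** Two applications of Cauchy-Schwarz bound the quadratic form by the
    Hilbert-Schmidt norm of A A, which for a deflated kernel is bounded in
    terms of an eigenvalue (deflate_square_le). *)
Lemma quadratic_form_le (f : T -> R) : bmeas f ->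
  (hsdot mu A (fun t s => f t * f s)) ^+ 4 <=
  hsdot mu (kmul mu A A) (kmul mu A A) * (\int[mu]_t (f t ^+ 2)) ^+ 4.
Proof.
(* f is viewed as a kernel constant in its second variable, so that the
   inequalities for kernels apply to it. *)
move=> bf; pose G : T -> T -> R := fun t _ => f t; have bG : bker G by exact: bker_fst.
have GG : hsdot mu G G = \int[mu]_t (f t ^+ 2).
  by apply: eq_Rintegral => t _; rewrite /G int_cst expr2.
have bAG := bker_kmul mu bA bG.
have -> : hsdot mu A (fun t s => f t * f s) = hsdot mu (kmul mu A G) G.
  rewrite hsdot_rank1//; apply: eq_Rintegral => t _.
  by rewrite /kmul /G int_cst mulrC.
have h1 : hsdot mu (kmul mu A G) G ^+ 2 <= hsdot mu (kmul mu (kmul mu A A) G) G * hsdot mu G G.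
  apply: (le_trans (hsdot_cauchy_schwarz mu bAG bG)).
  by rewrite -(kmulA mu bA bA bG) (hsdot_kmul_adj mu bA bAG bG sA).
have bAA := bker_kmul mu bA bA.
have h2 : hsdot mu (kmul mu (kmul mu A A) G) G ^+ 2 <=
    hsdot mu (kmul mu A A) (kmul mu A A) * hsdot mu G G * hsdot mu G G.
  apply: (le_trans (hsdot_cauchy_schwarz mu (bker_kmul mu bAA bG) bG)).
  by apply: ler_wpM2r; [exact: hsdot_ge0|exact: hsdot_kmul_le].
by rewrite -GG; exact: iterated_sqr_le (hsdot_ge0 _ _) h1 h2.
Qed.
End quadratic_form.

Section deflation.
Context d (T : measurableType d) (R : realType) (mu : probability T R).
Variables (K : T -> T -> R) (lam : nat -> R) (phi : nat -> T -> R).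
Hypotheses (bK : bker K) (sK : forall t s, K t s = K s t).
Hypotheses (lam0 : forall k, 0 <= lam k) (lamS : nonincreasing_seq lam).
Hypothesis bphi : forall k, bmeas (phi k).
Hypothesis ophi : forall k l, lam k != 0 -> lam l != 0 ->
  \int[mu]_t (phi k t * phi l t) = (k == l)%:R.
Hypothesis zphi : forall k, lam k = 0 -> phi k = cst 0.
Hypothesis ephi : forall k t, \int[mu]_u (K t u * phi k u) = lam k * phi k t.

(** What is left of K after removing its first n spectral terms. *)
Definition deflate n t s := K t s - \sum_(k < n) lam k * (phi k t * phi k s).

Lemma bker_rank1 f g : bmeas f -> bmeas g -> bker (fun t s : T => f t * g s : R).
Proof. by move=> bf bg; apply: bkerM; [exact: bker_fst|exact: bker_snd]. Qed.

Lemma bker_deflate n : bker (deflate n).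
Proof.
apply: bkerB => //.
apply: (@bmeas_sum _ (T * T)%type R _ _ _
  (fun (k : 'I_n) z => lam k * (phi k z.1 * phi k z.2))) => k _.
by apply: bmeasZ; exact: bker_rank1.
Qed.

Lemma deflate_sym n t s : deflate n t s = deflate n s t.
Proof.
rewrite /deflate sK; congr (_ - _); apply: eq_bigr => k _.
by rewrite [phi k t * _]mulrC.
Qed.

Lemma deflate_apply n g t : bmeas g -> \int[mu]_u (deflate n t u * g u) =
  \int[mu]_u (K t u * g u) -
  \sum_(k < n) lam k * (phi k t * \int[mu]_u (phi k u * g u)).
Proof.
move=> bg.
have rphi k : Rintegrable mu (fun u => phi k u * g u) by exact/bmeas_Rintegrable/bmeasM.
have -> : \sum_(k < n) lam k * (phi k t * \int[mu]_u (phi k u * g u)) =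
    \int[mu]_u (\sum_(k < n) (lam k * phi k t) * (phi k u * g u)).
  rewrite int_sum => [|k _]; last exact: RintegrableZ.
  by apply: eq_bigr => k _; rewrite intZ// mulrA.
rewrite -intB; last 2 first.
- by apply/bmeas_Rintegrable/bmeasM => //; exact: bker_r.
- by apply: Rintegrable_sum => k _; exact: RintegrableZ.
apply: eq_Rintegral => u _; rewrite /deflate mulrBl mulr_suml; congr (_ - _).
by apply: eq_bigr => k _; rewrite !mulrA.
Qed.

Lemma deflate_phi n k t :
  \int[mu]_u (deflate n t u * phi k u) = if (k < n)%N then 0 else lam k * phi k t.
Proof.
rewrite deflate_apply// ephi.
have [lk0|lk0] := eqVneq (lam k) 0.
  rewrite lk0 mul0r zphi// big1 ?subrr ?if_same// => i _.
  by under eq_Rintegral do rewrite mulr0; rewrite int_cst !mulr0.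
have E (i : 'I_n) : lam i * (phi i t * \int[mu]_u (phi i u * phi k u)) =
    if i == k :> nat then lam k * phi k t else 0.
  have [li0|li0] := eqVneq (lam i) 0.
    by rewrite li0 mul0r; case: eqP => // ik; move: lk0; rewrite -ik li0 eqxx.
  by rewrite ophi//; case: eqP => [->|_]; rewrite ?mulr1 ?mulr0.
rewrite (eq_bigr _ (fun i _ => E i)); case: ifPn => kn.
  rewrite (bigD1 (Ordinal kn))//= eqxx big1 ?addr0 ?subrr// => i.
  by rewrite -val_eqE/= => /negPf ->.
rewrite big1 ?subr0// => i _; case: eqP => // ik.
by move: kn; rewrite -ik ltn_ord.
Qed.

Lemma hsdot_deflate n : hsdot mu (deflate n) (deflate n) + \sum_(k < n) lam k ^+ 2 = hsdot mu K K.
Proof.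
elim: n => [|n IH].
  have -> : deflate 0 = K.
    by apply/funext => t; apply/funext => s; rewrite /deflate big_ord0 subr0.
  by rewrite big_ord0 addr0.
pose r t s := lam n * (phi n t * phi n s).
have br : bker r by exact/bkerZ/bker_rank1.
have bD := bker_deflate n.
have -> : deflate n.+1 = (fun t s => deflate n t s - r t s).
  apply/funext => t; apply/funext => s.
  by rewrite /deflate big_ord_recr/= opprD addrA.
have Dr : hsdot mu (deflate n) r = lam n ^+ 2.
  rewrite hsdotC hsdotZl//; last exact: bker_rank1.
  rewrite hsdotC hsdot_rank1//.
  have [l0|l0] := eqVneq (lam n) 0; first by rewrite l0 mul0r expr0n.
  transitivity (lam n * \int[mu]_t (lam n * (phi n t * phi n t))).
    by congr (_ * _); apply: eq_Rintegral => t _; rewrite deflate_phi ltnn mulrCA.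
  by rewrite intZ ?ophi ?eqxx ?mulr1//; exact/bmeas_Rintegrable/bmeasM.
have rr : hsdot mu r r = lam n ^+ 2.
  rewrite [LHS]hsdotZl//; last exact: bker_rank1.
  rewrite hsdotC hsdotZl; [|exact: bker_rank1..].
  have [l0|l0] := eqVneq (lam n) 0; first by rewrite l0 mul0r expr0n.
  rewrite hsdot_rank1//; last exact: bker_rank1.
  suff -> : \int[mu]_t (phi n t * \int[mu]_s (phi n t * phi n s * phi n s)) = 1.
    by rewrite mulr1.
  have <- : \int[mu]_t (phi n t * phi n t) = 1 by rewrite ophi ?eqxx.
  apply: eq_Rintegral => t _; congr (_ * _); under eq_Rintegral do rewrite -mulrA.
  by rewrite intZ ?ophi ?eqxx ?mulr1//; exact/bmeas_Rintegrable/bmeasM.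
have bDr : bker (fun t s => deflate n t s - r t s) by exact: bkerB.
rewrite (hsdotBl mu bD br bDr) (hsdotC mu (deflate n)) (hsdotC mu r).
rewrite (hsdotBl mu bD br bD) (hsdotBl mu bD br br) (hsdotC mu r (deflate n)) Dr rr subrr subr0.
by rewrite big_ord_recr/= [X in _ + X]addrC addrA subrK.
Qed.

(** The squares of the eigenvalues add up to at most the squared
    Hilbert-Schmidt norm, and lam is non-increasing. *)
Lemma lam_sqr_le n : lam n ^+ 2 <= hsdot mu K K / n.+1%:R.
Proof.
rewrite ler_pdivlMr// -(hsdot_deflate n.+1) ler_wpDl ?hsdot_ge0//.
rewrite mulr_natr -[n.+1 in X in X <= _]card_ord -sumr_const ler_sum// => k _.
by rewrite lerXn2r ?nnegrE//; apply: lamS; rewrite -ltnS.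
Qed.

Hypothesis complete : forall rho g, rho != 0 -> bmeas g ->
  (forall t, \int[mu]_u (K t u * g u) = rho * g t) ->
  exists (n : nat) (c : nat -> R),
    {ae mu, forall t, g t = \sum_(k < n | lam k == rho) c k * phi k t}.

(** An eigenfunction g of the deflated kernel for rho <> 0 is orthogonal
    to phi 0, ..., phi (n-1), hence is an eigenfunction of K for the same
    rho. By completeness rho is one of the lam k, and k >= n since
    otherwise g would vanish. *)
Lemma deflate_square_le n :
  hsdot mu (kmul mu (deflate n) (deflate n)) (kmul mu (deflate n) (deflate n)) <=
  lam n ^+ 2 * hsdot mu K K.
Proof.
set y := hsdot mu _ _; have bD := bker_deflate n.
have [y0|y0] := leP y 0.
  by rewrite (le_trans y0)// mulr_ge0 ?sqr_ge0 ?hsdot_ge0.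
have [rho [g [yrho rho0 bg g0 eg]]] :=
  symmetric_kernel_eigenfunction bD (deflate_sym n) y0.
have perp k : (k < n)%N -> \int[mu]_u (phi k u * g u) = 0.
  move=> kn; apply: (mulfI rho0); rewrite mulr0 -intZ; last exact/bmeas_Rintegrable/bmeasM.
  transitivity (\int[mu]_t \int[mu]_u (phi k t * deflate n t u * g u)).
    apply: eq_Rintegral => t _; rewrite mulrCA -eg -intZ.
      by apply: eq_Rintegral => u _; rewrite mulrA.
    by apply/bmeas_Rintegrable/bmeasM => //; exact: bker_r.
  rewrite bker_fubini; last first.
    by apply: bkerM; [apply: bkerM => //; exact: bker_fst|exact: bker_snd].
  transitivity (\int[mu]_u (0 : R)); last by rewrite int_cst.
  apply: eq_Rintegral => u _.
  have -> : \int[mu]_t (phi k t * deflate n t u * g u) =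
      g u * \int[mu]_t (deflate n u t * phi k t).
    rewrite -intZ; last by apply/bmeas_Rintegrable/bmeasM => //; exact: bker_r.
    by apply: eq_Rintegral => t _; rewrite (deflate_sym n t u); ring.
  by rewrite deflate_phi kn mulr0.
have eKg t : \int[mu]_u (K t u * g u) = rho * g t.
  rewrite -eg deflate_apply// big1 ?subr0// => k _.
  by rewrite perp ?mulr0.
have [m [c gc]] := complete rho0 bg eKg.
have [k [kn lk]] : exists k, (n <= k)%N /\ lam k = rho.
  apply: contrapT => /forallNP H; move/negP: g0; apply; apply/eqP.
  transitivity (\int[mu]_t (\sum_(k < m | lam k == rho) c k * (phi k t * g t))).
    apply: ae_eq_int.
    - by have [] := bmeasX 2 bg.
    - have [] // : bmeas (fun t => \sum_(k < m | lam k == rho) c k * (phi k t * g t)).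
      by apply: bmeas_sum => k _; exact/bmeasZ/bmeasM.
    apply: filterS gc => t gt; rewrite expr2 {1}gt mulr_suml.
    by apply: eq_bigr => k _; rewrite mulrA.
  rewrite int_sum => [|k _]; last exact/bmeas_Rintegrable/bmeasZ/bmeasM.
  apply: big1 => k /eqP lk; rewrite intZ; last exact/bmeas_Rintegrable/bmeasM.
  rewrite perp ?mulr0// ltnNge; apply/negP => nk; exact: (H k).
apply: (le_trans yrho); rewrite -lk.
apply: ler_pM; [exact: sqr_ge0|exact: hsdot_ge0| |].
  by rewrite lerXn2r ?nnegrE//; exact: lamS.
by rewrite -(hsdot_deflate n) lerDl sumr_ge0// => i _; exact: sqr_ge0.
Qed.

(** Convergence of the spectral sums to K in the weak sense, which is all
    that the comparison of traces needs. *)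
Lemma quadratic_deflate_cvg0 (f : T -> R) : bmeas f ->
  hsdot mu (deflate n) (fun t s => f t * f s) @[n --> \oo] --> (0 : R).
Proof.
move=> bf; pose C := (hsdot mu K K) ^+ 2 * (\int[mu]_t (f t ^+ 2)) ^+ 4.
have C0 : 0 <= C by rewrite mulr_ge0 ?sqr_ge0// exprn_even_ge0.
have xC n : (hsdot mu (deflate n) (fun t s => f t * f s)) ^+ 4 <= C / n.+1%:R.
  apply: (le_trans (quadratic_form_le mu (bker_deflate n) (deflate_sym n) bf)).
  rewrite /C mulrAC ler_wpM2r ?exprn_even_ge0//.
  apply: (le_trans (deflate_square_le n)).
  by have := ler_wpM2r (hsdot_ge0 mu K) (lam_sqr_le n); rewrite [leRHS]mulrAC -expr2.
apply/cvgrPdist_le => e e0.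
have [N CN] : exists N, C / e ^+ 4 < N%:R.
  by exists (Num.truncn (C / e ^+ 4)).+1; exact: truncnS_gt.
exists N => // n /= Nn; rewrite sub0r normrN.
rewrite -(@ler_pXn2r _ 4)// ?nnegrE ?(ltW e0)//.
have -> : `|hsdot mu (deflate n) (fun t s => f t * f s)| ^+ 4 =
    (hsdot mu (deflate n) (fun t s => f t * f s)) ^+ 4.
  by rewrite -normrX ger0_norm// exprn_even_ge0.
apply: (le_trans (xC n)); rewrite ler_pdivrMr// mulrC -ler_pdivrMr ?exprn_gt0//.
by rewrite (le_trans (ltW CN))// ler_nat (leq_trans Nn).
Qed.

Variables (N : nat) (g : 'I_N -> T -> R).
Hypotheses (bg : forall i, bmeas (g i)) (g0 : forall i t, 0 <= g i t).
Let Q t s := \sum_(i < N) g i t * g i s.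
Hypothesis Q1 : {ae mu, forall t, \int[mu]_s Q t s = 1}.

Let bQ : bker Q.
Proof.
apply: (@bmeas_sum _ (T * T)%type R _ _ _ (fun (i : 'I_N) z => g i z.1 * g i z.2)) => i _.
exact: bker_rank1.
Qed.

Lemma smoothing_int (h : T -> R) : bmeas h ->
  \int[mu]_t (h t * \int[mu]_s Q t s) = \int[mu]_t h t.
Proof.
move=> bh; apply: ae_eq_int.
- by have [] := bmeasM bh (bker_int mu bQ).
- by case: bh.
by apply: filterS Q1 => t ->; rewrite mulr1.
Qed.

(** A symmetric Markov kernel Q is a contraction of L2: integrate 2 h(t)
    h(s) <= h(t)^2 + h(s)^2 against Q. *)
Lemma smoothing_rank1_le (h : T -> R) : bmeas h ->
  hsdot mu Q (fun t s => h t * h s) <= \int[mu]_t (h t ^+ 2).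
Proof.
move=> bh; have bh2 := bmeasX 2 bh.
have B1 : bker (fun t s => h t ^+ 2 * Q t s) by apply: bkerM => //; exact: bker_fst.
have B2 : bker (fun t s => h s ^+ 2 * Q t s) by apply: bkerM => //; exact: bker_snd.
have E1 : \int[mu]_t \int[mu]_s (h t ^+ 2 * Q t s) = \int[mu]_t (h t ^+ 2).
  rewrite -[RHS]smoothing_int//; apply: eq_Rintegral => t _.
  by rewrite intZ//; exact/bmeas_Rintegrable/bker_r.
have E2 : \int[mu]_t \int[mu]_s (h s ^+ 2 * Q t s) = \int[mu]_t (h t ^+ 2).
  rewrite (bker_fubini mu B2) -E1; apply: eq_Rintegral => t _; apply: eq_Rintegral => s _.
  by congr (_ * _); apply: eq_bigr => i _; rewrite mulrC.
have -> : \int[mu]_t (h t ^+ 2) =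
    \int[mu]_t \int[mu]_s (2^-1 * (h t ^+ 2 * Q t s + h s ^+ 2 * Q t s)).
  transitivity (2^-1 * (\int[mu]_t (h t ^+ 2) + \int[mu]_t (h t ^+ 2))); first by field.
  rewrite -{1}E1 -{1}E2 -intD; [|exact/bmeas_Rintegrable/(bker_int mu B1)|exact/bmeas_Rintegrable/(bker_int mu B2)].
  rewrite -intZ; last first.
    by apply: bmeas_Rintegrable; apply: bmeasD; [exact: (bker_int mu B1)|exact: (bker_int mu B2)].
  apply: eq_Rintegral => t _.
  rewrite -intD; [|exact/bmeas_Rintegrable/(bker_r t B1)|exact/bmeas_Rintegrable/(bker_r t B2)].
  rewrite -intZ//; apply: bmeas_Rintegrable.
  by apply: bmeasD; [exact: (bker_r t B1)|exact: (bker_r t B2)].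
have B3 : bker (fun t s => 2^-1 * (h t ^+ 2 * Q t s + h s ^+ 2 * Q t s)).
  exact/bkerZ/bkerD.
have B4 : bker (fun t s => Q t s * (h t * h s)) by apply: bkerM => //; exact: bker_rank1.
apply: le_int => [| |t]; [exact/bmeas_Rintegrable/(bker_int mu B4)|exact/bmeas_Rintegrable/(bker_int mu B3)|].
apply: le_int => [| |s]; [exact/bmeas_Rintegrable/(bker_r t B4)|exact/bmeas_Rintegrable/(bker_r t B3)|].
have Q0 : 0 <= Q t s by apply: sumr_ge0 => i _; exact: mulr_ge0.
rewrite -subr_ge0.
have -> : 2^-1 * (h t ^+ 2 * Q t s + h s ^+ 2 * Q t s) - Q t s * (h t * h s) =
  2^-1 * Q t s * (h t - h s) ^+ 2 by field.
by rewrite mulr_ge0 ?sqr_ge0// mulr_ge0// invr_ge0.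
Qed.

(** Q has total mass one in each variable and is supported near the
    diagonal, where K(t, s) is close to K(t, t). *)
Lemma trace_le_smoothing (delta : R) :
  (forall i t s, g i t * g i s != 0 -> `|K t t - K t s| <= delta) ->
  \int[mu]_t K t t <= hsdot mu Q K + delta.
Proof.
move=> Hd; have bd : bmeas (fun t => K t t).
  apply: (bmeas_comp (h := fun t : T => (t, t)) _ bK).
  exact: measurable_fun_pair.
rewrite -lerBlDl -(smoothing_int bd) /hsdot -intB; last 2 first.
- by apply/bmeas_Rintegrable/bmeasM => //; exact: bker_int.
- by apply/bmeas_Rintegrable/bker_int/bkerM.
rewrite -[leRHS](int_cst mu) -(smoothing_int (bmeas_cst _ delta)).
have B1 : bker (fun t s => K t t * Q t s) by apply: bkerM => //; exact: bker_fst.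
have B2 : bker (fun t s => Q t s * K t s) by exact: bkerM.
apply: le_int => [| |t].
- apply: bmeas_Rintegrable; apply: bmeasB; last exact: bker_int.
  by apply: bmeasM => //; exact: bker_int.
- by apply: bmeas_Rintegrable; apply: bmeasZ; exact: bker_int.
rewrite -!intZ; [|exact/bmeas_Rintegrable/(bker_r t bQ)..].
rewrite -intB; [|exact/bmeas_Rintegrable/(bker_r t B1)|exact/bmeas_Rintegrable/(bker_r t B2)].
apply: le_int => [| |s].
- by apply: bmeas_Rintegrable; apply: bmeasB; [exact: (bker_r t B1)|exact: (bker_r t B2)].
- by apply: bmeas_Rintegrable; apply: bmeasZ; exact: (bker_r t bQ).
rewrite [Q t s * _]mulrC -mulrBl /Q !mulr_sumr ler_sum// => i _.
have [->|gi] := eqVneq (g i t * g i s) 0; first by rewrite !mulr0.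
rewrite ler_wpM2r ?mulr_ge0//.
by rewrite (le_trans (ler_norm _)) ?(Hd i).
Qed.

(** The diagonal has measure zero, so the trace is not determined by the
    class of K in L2 and is replaced by <Q, K>. Split K into its first n
    spectral terms, each contributing at most lam k to <Q, K>, and the
    deflated kernel, whose pairing with Q tends to 0 since Q is a finite
    sum of products. *)
Lemma trace_le_eigenvalues (delta : R) :
  (forall i t s, g i t * g i s != 0 -> `|K t t - K t s| <= delta) ->
  forall e, 0 < e -> exists n,
    \int[mu]_t K t t <= \sum_(k < n) lam k + delta + e.
Proof.
move=> Hd e e0.
have cQ : hsdot mu Q (deflate n) @[n --> \oo] --> (0 : R).
  have -> : (0 : R) = \sum_(i < N) 0 by rewrite big1.
  have -> : (fun n => hsdot mu Q (deflate n)) =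
      (fun n => \sum_(i < N) hsdot mu (deflate n) (fun t s => g i t * g i s)).
    apply/funext => n; rewrite hsdotC (hsdot_sumr mu (bker_deflate n))// => i.
    exact: bker_rank1.
  by apply: cvg_bigsum => i; exact: quadratic_deflate_cvg0.
have [n _ /(_ n (leqnn _)) Hn] := cvgr_lt _ cQ e e0.
exists n; apply: (le_trans (trace_le_smoothing Hd)).
rewrite addrAC lerD2r.
have -> : hsdot mu Q K = \sum_(k < n) lam k * hsdot mu Q (fun t s => phi k t * phi k s)
    + hsdot mu Q (deflate n).
  have bR (k : 'I_n) : bker (fun t s => phi k t * phi k s) by exact: bker_rank1.
  have {1}-> : K = fun t s =>
      \sum_(k < n) lam k * (phi k t * phi k s) + deflate n t s.
    by apply/funext => t; apply/funext => s; rewrite /deflate addrC subrK.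
  have bS (k : 'I_n) : bker (fun t s => lam k * (phi k t * phi k s)) by exact/bkerZ/bR.
  rewrite (hsdotDr mu bQ (bker_sum bS) (bker_deflate n)) (hsdot_sumr mu bQ bS).
  by congr (_ + _); apply: eq_bigr => k _; rewrite (hsdotZr mu _ bQ (bR k)).
apply: lerD; last exact: ltW.
apply: ler_sum => k _; rewrite -[leRHS]mulr1.
have [->|lk] := eqVneq (lam k) 0; first by rewrite !mul0r.
rewrite ler_wpM2l//; apply: (le_trans (smoothing_rank1_le (bphi k))).
have -> : 1 = \int[mu]_t (phi k t * phi k t) by rewrite ophi// eqxx.
by rewrite le_eqVlt; apply/orP; left; apply/eqP; apply: eq_Rintegral => t _; rewrite expr2.
Qed.
End deflation.

(** * Continuous kernels on the unit square *)

Section clamp.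
Variable R : realType.

Definition clamp (x : R) : R := Num.max 0 (Num.min x 1).

Lemma clamp_in x : 0 <= clamp x <= 1.
Proof. by rewrite /clamp le_max lexx/= ge_max ler01 ge_min lexx orbT. Qed.

Lemma clamp_id x : 0 <= x <= 1 -> clamp x = x.
Proof. by move=> /andP[x0 x1]; rewrite /clamp min_l// max_r. Qed.

Lemma clampK x : clamp (clamp x) = clamp x.
Proof. by rewrite clamp_id// clamp_in. Qed.

Lemma clamp_continuous : continuous clamp.
Proof.
move=> x; apply: (@continuous_max R R (cst 0) (fun x => Num.min x 1)).
  exact: cst_continuous.
by apply: (@continuous_min R R id (cst 1)) => //; exact: cst_continuous.
Qed.

Lemma measurable_clamp : measurable_fun setT (clamp : measurableTypeR R -> measurableTypeR R).
Proof. exact: continuous_measurable_fun clamp_continuous. Qed.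

Variable K : R -> R -> R.
Hypothesis cK : {within [set` `[0%R, 1%R]] `*` [set` `[0%R, 1%R]],
     continuous (fun ts : R * R => K ts.1 ts.2)}.

(** K is continuous on the unit square only. Precomposition with the
    retraction clamp gives a kernel that is continuous and bounded
    everywhere and agrees with K on the square. *)
Definition Kclamp (t s : measurableTypeR R) : R := K (clamp t) (clamp s).

Lemma Kclamp_continuous : continuous (fun p : R * R => Kclamp p.1 p.2).
Proof.
move=> p; pose h := fun p : R * R => (clamp p.1, clamp p.2).
have Ah q : ([set` `[0%R, 1%R]] `*` [set` `[0%R, 1%R]]) (h q).
  by split => /=; rewrite in_itv/= clamp_in.
move/subspace_continuousP : cK => /(_ (h p) (Ah p)) /= H.
apply: (@cvg_comp _ _ _ h (fun ts : R * R => K ts.1 ts.2) _ _ _ _ H).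
have c1 : clamp q.1 @[q --> p] --> clamp p.1.
  apply: (@continuous_comp _ _ _ (fst : R * R -> R) clamp).
    exact: cvg_fst.
  exact: clamp_continuous.
have c2 : clamp q.2 @[q --> p] --> clamp p.2.
  apply: (@continuous_comp _ _ _ (snd : R * R -> R) clamp).
    exact: cvg_snd.
  exact: clamp_continuous.
have hc : h @ p --> h p by exact: (cvg_pair c1 c2).
move=> U; rewrite /within/= => /hc; rewrite /nbhs/= => HU.
by apply: filterS HU => q /=; apply; exact: Ah.
Qed.

Lemma Kclamp_bounded : exists M : R, forall t s, `|Kclamp t s| <= M.
Proof.
have /compact_near_coveringP H : compact ([set` `[0%R, 1%R]] `*` [set` `[0%R, 1%R]] : set (R * R)).
  by apply: compact_setX; exact: segment_compact.
have [|n _ /(_ n (leqnn _)) Hn] := H nat \oo (fun n (p : R * R) => `|Kclamp p.1 p.2| <= n%:R) _.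
  move=> p _.
  pose m := (Num.truncn (`|Kclamp p.1 p.2| + 1)).+1.
  have Hm : `|Kclamp p.1 p.2| + 1 < m%:R by exact: truncnS_gt.
  have : \forall x' \near p, `|Kclamp x'.1 x'.2| < m%:R.
    apply: (@cvgr_lt _ _ (nbhs p) _ (fun q => `|Kclamp q.1 q.2|) `|Kclamp p.1 p.2|).
      by apply: cvg_norm; exact: Kclamp_continuous.
    by apply: lt_trans Hm; rewrite ltrDl.
  move=> H1; exists ([set x' | `|Kclamp x'.1 x'.2| < m%:R], [set n | (m <= n)%N]) => /=.
    by split; [exact: H1|exact: nbhs_infty_ge].
  by move=> [x' n] [/= H2 H3]; rewrite (le_trans (ltW H2))// ler_nat; exact: H3.
by exists n%:R => t s; rewrite /Kclamp -(clampK t) -(clampK s);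
  apply: (Hn (clamp t, clamp s)); split; rewrite /= in_itv/= clamp_in.
Qed.

Lemma Kclamp_near (t0 s0 e : R) : 0 < e -> exists r, 0 < r /\
  forall t s : R, `|t - t0| < r -> `|s - s0| < r -> `|Kclamp t s - Kclamp t0 s0| <= e.
Proof.
move=> e0; move/cvgrPdist_le : (@Kclamp_continuous (t0, s0)) => /(_ _ e0).
move/nbhs_ballP => [r /= r0 Hr]; exists r; split => // t s tr sr.
by rewrite distrC; apply: (Hr (t, s)); split; rewrite /ball/= distrC.
Qed.

(** Uniform continuity along the diagonal, from compactness of the unit
    interval. *)
Lemma Kclamp_diag_uniform (e : R) : 0 < e -> exists N : nat,
  forall t s : R, 0 <= t <= 1 -> `|t - s| <= N.+1%:R^-1 -> `|Kclamp t t - Kclamp t s| <= e.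
Proof.
move=> e0; have /compact_near_coveringP H := @segment_compact R 0 1.
have [|N _ /(_ N (leqnn _)) HN] := H nat \oo (fun n (t : R) =>
    forall s : R, `|t - s| <= n.+1%:R^-1 -> `|Kclamp t t - Kclamp t s| <= e) _.
  move=> t0 _; have [r [r0 Hr]] := Kclamp_near t0 t0 (divr_gt0 e0 (ltr0n _ 2)).
  pose m := (Num.truncn (2 / r)).+1.
  have Hm : 2 / r < m%:R by exact: truncnS_gt.
  exists ([set t | `|t - t0| < r / 2], [set n | (m <= n)%N]) => /=.
    split; last exact: nbhs_infty_ge.
    apply/nbhs_ballP; exists (r / 2); first by rewrite /= divr_gt0.
    by move=> t; rewrite /ball/= distrC.
  move=> [t n] [/= tr mn] s ts.
  have n2 : n.+1%:R^-1 < r / 2.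
    have -> : r / 2 = (2 / r)^-1 by rewrite invf_div.
    by rewrite ltf_pV2 ?posrE ?divr_gt0// (lt_le_trans Hm)// ler_nat ltnW.
  have h1 : `|Kclamp t t - Kclamp t0 t0| <= e / 2.
    by apply: Hr; rewrite (lt_trans tr)// ltr_pdivrMr// ltr_pMr// ltr1n.
  have h2 : `|Kclamp t s - Kclamp t0 t0| <= e / 2.
    apply: Hr; first by rewrite (lt_trans tr)// ltr_pdivrMr// ltr_pMr// ltr1n.
    have -> : s - t0 = (t - t0) - (t - s) by ring.
    rewrite (le_lt_trans (ler_normB _ _))// [r]splitr ltrD//.
    exact: le_lt_trans ts n2.
  have -> : Kclamp t t - Kclamp t s = (Kclamp t t - Kclamp t0 t0) - (Kclamp t s - Kclamp t0 t0) by ring.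
  by rewrite (le_trans (ler_normB _ _))// [e]splitr lerD.
by exists N => t s t01 ts; apply: HN => //=; rewrite in_itv.
Qed.

(** Pointwise limit of step functions in the second variable. Continuity
    alone gives measurability for the Borel sets of the product topology,
    whereas the claim is about the product of the two Borel
    sigma-algebras. *)
Lemma Kclamp_measurable : measurable_fun setT
  (fun p : measurableTypeR R * measurableTypeR R => Kclamp p.1 p.2).
Proof.
pose h n (p : measurableTypeR R * measurableTypeR R) := \sum_(i < n.+2)
  Kclamp p.1 (i%:R / n.+1%:R) * \1_[set` `[i%:R, i.+1%:R[] (n.+1%:R * clamp p.2).
apply: (@measurable_fun_cvg _ _ _ _ h).
  move=> n; apply: measurable_sum => i; apply: measurable_funM.
    apply: (measurableT_comp (f := fun t => Kclamp t (i%:R / n.+1%:R))).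
      apply: continuous_measurable_fun => t.
      apply: (@continuous_comp _ _ _ (fun t : R => (t, i%:R / n.+1%:R : R))
        (fun p : R * R => Kclamp p.1 p.2)); last exact: Kclamp_continuous.
      have c1 : u @[u --> t] --> t by exact: cvg_id.
      have c2 : (i%:R / n.+1%:R : R) @[_ --> t] --> (i%:R / n.+1%:R : R) by exact: cvg_cst.
      exact: (cvg_pair c1 c2).
    exact: measurable_fst.
  pose u := fun p : measurableTypeR R * measurableTypeR R =>
    n.+1%:R * clamp p.2 : measurableTypeR R.
  apply: (measurableT_comp (f := (\1_[set` `[i%:R, i.+1%:R[] : measurableTypeR R -> R)) (g := u)).
    exact: measurable_indic.
  rewrite /u.
  apply: measurable_funM => //.
  by apply: measurableT_comp measurable_snd; exact: measurable_clamp.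
move=> [t s] _.
(* At each point exactly one indicator is nonzero, namely that of the cell
   containing the clamped second coordinate. *)
have hE n : h n (t, s) = Kclamp t ((Num.truncn (n.+1%:R * clamp s))%:R / n.+1%:R).
  have /andP[c0 c1] := clamp_in s.
  have nc0 : 0 <= n.+1%:R * clamp s by rewrite mulr_ge0.
  have it : (Num.truncn (n.+1%:R * clamp s) < n.+2)%N.
    rewrite truncn_lt_nat// (@le_lt_trans _ _ n.+1%:R) ?ltr_nat//.
    by rewrite ger_pMr.
  rewrite /h (bigD1 (Ordinal it))//= big1 ?addr0.
    by rewrite indicE mem_set ?mulr1//= in_itv/= truncn_itv.
  move=> i /eqP ni; rewrite indicE memNset ?mulr0//= in_itv/= -truncn_eq//.
  by move=> /eqP ti; apply: ni; apply: val_inj.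
apply/cvgrPdist_le => e e0; have [r [r0 Hr]] := Kclamp_near t (clamp s) e0.
pose m := (Num.truncn r^-1).+1.
have Hm : r^-1 < m%:R by exact: truncnS_gt.
exists m => // n /= mn; rewrite hE.
have -> : Kclamp (t, s).1 (t, s).2 = Kclamp t (clamp s) by rewrite /Kclamp/= clampK.
rewrite distrC; apply: Hr; first by rewrite subrr normr0.
have /andP[c0 c1] := clamp_in s.
have nc0 : 0 <= n.+1%:R * clamp s by rewrite mulr_ge0.
have /andP[t1 t2] := truncn_itv nc0.
set j := Num.truncn _ in t1 t2 *.
have n0 : 0 < n.+1%:R :> R by [].
have -> : j%:R / n.+1%:R - clamp s = (j%:R - n.+1%:R * clamp s) / n.+1%:R.
  by field; rewrite gt_eqF.
rewrite normrM [X in _ * X]ger0_norm ?invr_ge0// ltr_pdivrMr//.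
rewrite distrC ger0_norm ?subr_ge0//.
apply: (@lt_le_trans _ _ 1).
  by rewrite ltrBlDl natr1.
by rewrite -ler_pdivrMl// mulr1 (le_trans (ltW Hm))// ler_nat ltnW.
Qed.

Lemma Kclamp_bker : bker Kclamp.
Proof.
split; first exact: Kclamp_measurable.
by have [M HM] := Kclamp_bounded; exists M => p; exact: HM.
Qed.
End clamp.

(** * Eigenfunctions and trace on the unit interval *)

Section product_dom.
Context d1 d2 (T1 : measurableType d1) (T2 : measurableType d2) (R : realType).
Variables (m1 : probability T1 R) (m2 : probability T2 R).

Lemma prod_integrable_dom (f : T1 * T2 -> R) (h : T2 -> R) :
  measurable_fun setT f -> Rintegrable m2 h -> (forall x y, `|f (x, y)| <= h y) ->
  (m1 \x m2)%E.-integrable setT (EFin \o f).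
Proof.
move=> mf rh fh.
apply/integrable12ltyP; first exact/measurable_EFinP.
apply: (@le_lt_trans _ _ (\int[m1]_x (\int[m2]_y h y)%:E)%E).
  apply: ge0_le_integral => //.
  - by move=> x _; exact: integral_ge0.
  - apply: (measurable_fun_fubini_tonelli_F (fun z => `|(f z)%:E|%E)) => //.
    by apply: measurableT_comp => //; exact/measurable_EFinP.
  move=> x _; rewrite EFin_int//.
  apply: ge0_le_integral => //.
  + apply: measurableT_comp => //; apply/measurable_EFinP.
    exact: measurableT_comp mf (pair1_measurable x).
  + exact/measurable_EFinP/Rintegrable_meas/rh.
  + by move=> y _; rewrite lee_fin.
by rewrite integral_cst//= [X in (_ * X)%E]probability_setT mule1 ltry.
Qed.

(** Unlike bmeas_int, this allows integrands that are unbounded in the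
    integration variable, such as a kernel times an arbitrary L2
    eigenfunction. *)
Lemma measurable_int_dom (f : T1 * T2 -> R) (h : T2 -> R) :
  measurable_fun setT f -> Rintegrable m2 h -> (forall x y, `|f (x, y)| <= h y) ->
  measurable_fun setT (fun x => \int[m2]_y f (x, y)).
Proof.
move=> mf rh fh.
apply: (measurableT_comp (fine_measurable measurableT)) => //.
apply: (@measurable_fubini_F _ _ _ _ _ m1 m2 (EFin \o f)).
exact: prod_integrable_dom rh fh.
Qed.
End product_dom.

Section unit_interval.
Variable R : realType.
Notation mu := (@unit_leb R).

Lemma unit_leb_itv (a b : R) : 0 <= a -> b <= 1 -> a <= b ->
  mu [set` `[a, b[] = (b - a)%:E.
Proof.
move=> a0 b1 ab; rewrite /unit_leb /mrestr setIidl; last first.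
  move=> x /=; rewrite !in_itv/= => /andP[ax xb].
  by rewrite (le_trans a0 ax) (le_trans (ltW xb) b1).
rewrite lebesgue_measure_itv/= lte_fin; case: ifPn => //.
by rewrite -leNgt => ba; rewrite (@le_anti _ _ a b) ?ab ?ba// subrr.
Qed.

Lemma unit_leb_ae : {ae mu, forall t : measurableTypeR R, 0 <= t < 1}.
Proof.
exists (~` [set` `[0%R, 1%R[]); split.
- by apply: measurableC; exact: measurable_itv.
- rewrite probability_setC; last exact: measurable_itv.
  by rewrite [X in (1 - X)%E]unit_leb_itv// subr0 subee.
- by move=> x /= H /=; rewrite in_itv/=.
Qed.

Variable K : R -> R -> R.
Hypothesis cK : {within [set` `[0%R, 1%R]] `*` [set` `[0%R, 1%R]],
     continuous (fun ts : R * R => K ts.1 ts.2)}.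
Hypothesis sK : forall t s, K t s = K s t.

Lemma Kclamp_sym t s : Kclamp K t s = Kclamp K s t.
Proof. exact: sK. Qed.

Lemma int_K_Kclamp (t : R) (f : measurableTypeR R -> R) : 0 <= t <= 1 ->
  measurable_fun setT f ->
  \int[mu]_(s in [set` `[0%R, 1%R]]) (K t s * f s) = \int[mu]_s (Kclamp K t s * f s).
Proof.
move=> t01 mf; rewrite Rintegral_mkcond.
have -> : (fun s => K t s * f s) \_ [set` `[0%R, 1%R]] =
    (fun s => Kclamp K t s * f s) \_ [set` `[0%R, 1%R]].
  apply/funext => s; rewrite !patchE; case: ifPn => //; rewrite inE/= in_itv/= => s01.
  by rewrite /Kclamp !clamp_id.
have mKf : measurable_fun setT (fun s => Kclamp K t s * f s).
  by apply: measurable_funM => //; have [] := bker_r t (Kclamp_bker cK).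
apply: ae_eq_int => //.
  apply/(measurable_restrictT _ _).1; first exact: measurable_itv.
  exact: measurable_funS mKf.
apply: filterS (unit_leb_ae) => s /andP[s0 s1]; rewrite patchE mem_set//=.
by rewrite in_itv/= s0 ltW.
Qed.

Variables (lam : nat -> R) (psi : nat -> measurableTypeR R -> R).
Hypothesis eK : eigen_system K lam psi.

(** The version of the k-th eigenfunction that is read off from the
    eigenvalue equation. It is defined everywhere, is bounded, and
    satisfies that equation at every point, while psi k is only determined
    almost everywhere. *)
Definition eigfun k (t : measurableTypeR R) : R :=
  if lam k == 0 then 0 else (lam k)^-1 * \int[mu]_s (Kclamp K t s * psi k s).

Let psi_sqint k : sqint mu (psi k).
Proof. by apply/Lfun_sqint; have [] := eigen_fun eK k. Qed.

Lemma eigfun_bmeas k : bmeas (eigfun k).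
Proof.
rewrite /eigfun; case: eqP => [_|_]; first exact: bmeas_cst.
have [M KM] := Kclamp_bounded cK; have bK := Kclamp_bker cK.
have M0 : 0 <= M by rewrite (le_trans _ (KM 0 0)).
have [mpsi _] := psi_sqint k.
have mp : measurable_fun setT (fun p : measurableTypeR R * measurableTypeR R =>
    Kclamp K p.1 p.2 * psi k p.2).
  apply: measurable_funM; first by case: bK.
  exact: measurableT_comp mpsi measurable_snd.
(* |psi| <= 1 + psi^2, so psi is integrable. *)
have rh : Rintegrable mu (fun y => M * `|psi k y|).
  apply/RintegrableZ; apply: (le_Rintegrable (measurableT_comp _ mpsi) (RintegrableD (Rintegrable_cst mu 1) (psi_sqint k).2)) => // x.
  rewrite normr_id; have := sqr_ge0 (`|psi k x| - 1).
  rewrite sqrrB real_normK ?num_real// expr1n mulr1; have := sqr_ge0 (psi k x); lra.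
have dom (x y : measurableTypeR R) : `|Kclamp K x y * psi k y| <= M * `|psi k y|.
  by rewrite normrM ler_wpM2r.
split.
  apply: measurable_funM => //.
  exact: (measurable_int_dom mu mp rh dom).
exists (`|(lam k)^-1| * \int[mu]_y (M * `|psi k y|)) => x.
rewrite normrM ler_wpM2l//.
have rf : Rintegrable mu (fun s => Kclamp K x s * psi k s).
  apply: le_Rintegrable rh _ => [|y]; last exact: dom.
  by apply: measurable_funM => //; have [] := bker_r x bK.
apply: (le_trans (le_normr_Rintegral _ rf)) => //.
apply: le_int => //; apply: le_Rintegrable rh _ => [|y]; last by rewrite normr_id; exact: dom.
by apply: measurableT_comp => //; exact: Rintegrable_meas rf.
Qed.

Lemma eigfun_psi k : {ae mu, forall t, eigfun k t = psi k t}.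
Proof.
rewrite /eigfun; case: eqP => [l0|/eqP l0].
  by apply: filterS (eigen_pad eK l0) => t ->.
have [_ He] := eigen_fun eK k.
near=> t; have t01 : 0 <= t < 1 by near: t; exact: unit_leb_ae.
have e : \int[mu]_(s in [set` `[0%R, 1%R]]) (K t s * psi k s) = lam k * psi k t.
  by near: t; exact: He.
rewrite -int_K_Kclamp ?e ?mulKf//; last by case: (psi_sqint k).
by case/andP: t01 => -> /ltW ->.
Unshelve. all: by end_near. Qed.

Lemma eigfun_eigen k t : \int[mu]_u (Kclamp K t u * eigfun k u) = lam k * eigfun k t.
Proof.
have [l0|l0] := eqVneq (lam k) 0.
  by under eq_Rintegral do rewrite /eigfun l0 eqxx mulr0; rewrite int_cst l0 mul0r.
rewrite {2}/eigfun (negPf l0) mulVKf//.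
have bt := bker_r t (Kclamp_bker cK).
apply: ae_eq_int.
- by have [] := bmeasM bt (eigfun_bmeas k).
- by apply: measurable_funM; [case: bt|case: (psi_sqint k)].
by apply: filterS (eigfun_psi k) => u ->.
Qed.

Lemma eigfun_orthonormal k l : lam k != 0 -> lam l != 0 ->
  \int[mu]_t (eigfun k t * eigfun l t) = (k == l)%:R.
Proof.
move=> k0 l0; rewrite -(eigen_orthonormal eK k0 l0).
apply: ae_eq_int.
- by have [] := bmeasM (eigfun_bmeas k) (eigfun_bmeas l).
- by apply: measurable_funM; [case: (psi_sqint k)|case: (psi_sqint l)].
by apply: filterS2 (eigfun_psi k) (eigfun_psi l) => u -> ->.
Qed.

Lemma eigfun_zero k : lam k = 0 -> eigfun k = cst 0.
Proof. by move=> l0; apply/funext => t; rewrite /eigfun l0 eqxx. Qed.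

Lemma eigfun_complete rho g : rho != 0 -> bmeas g ->
  (forall t, \int[mu]_u (Kclamp K t u * g u) = rho * g t) ->
  exists (n : nat) (c : nat -> R),
    {ae mu, forall t, g t = \sum_(k < n | lam k == rho) c k * eigfun k t}.
Proof.
move=> rho0 bg eg; have [|n [c Hc]] := eigen_all eK rho0 (f := g).
  split; first by apply/Lfun_sqint/bmeas_sqint.
  apply: filterS (unit_leb_ae) => t /andP[t0 t1].
  by rewrite int_K_Kclamp ?eg// ?t0 ?ltW//; case: bg.
exists n, c.
have /ae_foralln H := eigfun_psi.
by apply: filterS2 H Hc => t Ht ->; apply: eq_bigr => k _; rewrite Ht.
Qed.

(** The part of Mercer's theorem that is needed. The smoothing kernel is
    N+1 times the indicator of the union of the squares I_i * I_i over N+1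
    equal subintervals I_i, whose mesh is fine enough for the uniform
    continuity of K along the diagonal. *)
Theorem trace_le_sum_eigenvalues (e : R) : 0 < e ->
  exists n, \int[mu]_t Kclamp K t t <= \sum_(k < n) lam k + e.
Proof.
move=> e0; have e20 : 0 < e / 2 by rewrite divr_gt0.
have [N HN] := Kclamp_diag_uniform cK e20.
pose N1 : R := N.+1%:R; have N10 : 0 < N1 by [].
pose I (i : 'I_N.+1) : set (measurableTypeR R) := [set` `[i%:R / N1, i.+1%:R / N1[].
pose g (i : 'I_N.+1) (t : measurableTypeR R) := Num.sqrt N1 * \1_(I i) t.
have mI i : measurable (I i) by exact: measurable_itv.
have muI i : mu (I i) = (N1^-1)%:E.
  rewrite unit_leb_itv.
  - by rewrite -mulrBl -natr1 addrC addKr mul1r.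
  - by rewrite divr_ge0.
  - by rewrite ler_pdivrMr// mul1r ler_nat.
  - by rewrite ler_pM2r ?invr_gt0// ler_nat.
have bI i : bmeas (\1_(I i) : measurableTypeR R -> R).
  split; first exact: measurable_indic.
  by exists 1 => x; rewrite indicE ger0_norm// lern1 leq_b1.
have bg i : bmeas (g i) by exact/bmeasZ/bI.
have g0 i t : 0 <= g i t by rewrite mulr_ge0 ?sqrtr_ge0.
have intI i : \int[mu]_t \1_(I i) t = N1^-1.
  rewrite /Rintegral integral_indic// setIT.
  by rewrite [X in fine X]muI.
have Q1 : {ae mu, forall t, \int[mu]_s (\sum_(i < N.+1) g i t * g i s) = 1}.
  apply: filterS (unit_leb_ae) => t /andP[t0 t1].
  rewrite int_sum => [|i _]; last exact/bmeas_Rintegrable/bmeasZ/bg.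
  transitivity (\sum_(i < N.+1) (\1_(I i) t : R)).
    apply: eq_bigr => i _; rewrite intZ; last exact/bmeas_Rintegrable/bg.
    rewrite /g intZ ?intI; last exact/bmeas_Rintegrable/bI.
    have s2 : Num.sqrt N1 * Num.sqrt N1 = N1 by rewrite -expr2 sqr_sqrtr// ltW.
    by rewrite mulrACA s2 mulrCA mulfV ?mulr1// gt_eqF.
  have nt0 : 0 <= N1 * t by rewrite mulr_ge0// ltW.
  have it : (Num.truncn (N1 * t) < N.+1)%N.
    by rewrite truncn_lt_nat// gtr_pMr.
  have Iin (i : 'I_N.+1) : (t \in I i) = (Num.truncn (N1 * t) == i).
    rewrite truncn_eq// [N1 * t]mulrC -ler_pdivrMr// -ltr_pdivlMr//.
    by rewrite /I mem_setE in_itv.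
  rewrite (bigD1 (Ordinal it))//= big1 ?addr0 => [|i ni].
    by rewrite indicE Iin eqxx.
  rewrite indicE Iin; case: eqP => // ti; case/eqP: ni; exact: val_inj.
have Hd i t s : g i t * g i s != 0 -> `|Kclamp K t t - Kclamp K t s| <= e / 2.
  have [tI|nt] := boolP (t \in I i); last first.
    by rewrite {1}/g indicE (negPf nt) mulr0 mul0r eqxx.
  have [sI|ns] := boolP (s \in I i); last first.
    by rewrite {2}/g indicE (negPf ns) !mulr0 eqxx.
  move: tI sI; rewrite /I !mem_setE !in_itv/= => /andP[t1 t2] /andP[s1 s2] _.
  have i0 : 0 <= i%:R / N1 :> R by rewrite divr_ge0.
  have i1 : i.+1%:R / N1 <= 1 :> R by rewrite ler_pdivrMr// mul1r ler_nat.
  have i2 : i.+1%:R / N1 = i%:R / N1 + N1^-1 :> R by rewrite -natr1 mulrDl mul1r.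
  apply: HN; first by rewrite (le_trans i0 t1) (ltW (lt_le_trans t2 i1)).
  move: t2 s2; rewrite -/N1 i2 ler_norml => t2 s2.
  by rewrite lerBlDr lerBrDr; move: t1 t2 s1 s2; set x := _ / N1; set z := N1^-1;
    clearbody x z => *; apply/andP; split; lra.
have [n Hn] := trace_le_eigenvalues (Kclamp_bker cK) Kclamp_sym (eigen_ge0 eK) (eigen_noninc eK)
  eigfun_bmeas eigfun_orthonormal eigfun_zero eigfun_eigen eigfun_complete bg g0 Q1 Hd e20.
by exists n; rewrite (le_trans Hn)// -addrA -splitr.
Qed.
End unit_interval.

(** * Orthogonal projections of row vectors *)

Section projection.
Variable R : realFieldType.

Lemma rv_sqr_ge0 N (v : 'rV[R]_N) : 0 <= (v *m v^T) 0 0.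
Proof. by rewrite mxE; apply: sumr_ge0 => i _; rewrite mxE -expr2 sqr_ge0. Qed.

Lemma rv_sqr_eq0 N (v : 'rV[R]_N) : (v *m v^T) 0 0 = 0 -> v = 0.
Proof.
rewrite mxE => /eqP; rewrite psumr_eq0 => [/allP H|i _]; last first.
  by rewrite mxE -expr2 sqr_ge0.
apply/rowP => i; have := H i; rewrite mem_index_enum mxE -expr2 sqrf_eq0 mxE.
by move=> /(_ isT)/eqP.
Qed.

(** A vector v in the kernel of the Gram matrix satisfies |v B|^2 = v B
    B^T v^T = 0. *)
Lemma gram_unit m N (B : 'M[R]_(m, N)) : row_free B -> B *m B^T \in unitmx.
Proof.
move=> fB; rewrite -row_free_unit -kermx_eq0; apply/eqP/row_matrixP => i.
set v := row i _; rewrite row0.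
have vG : v *m (B *m B^T) = 0.
  by apply/sub_kermxP; rewrite row_sub.
have vB : v *m B = 0.
  apply: rv_sqr_eq0; rewrite trmx_mul mulmxA -(mulmxA v) vG mul0mx mxE//.
by apply/eqP; rewrite -(mulmx_free_eq0 v fB) vB.
Qed.

(** The projection onto the row space of a is B^T G^-1 B for a row basis B
    with Gram matrix G; its trace is the rank, by cyclicity. *)
Lemma orthogonal_projection n N (a : 'M[R]_(n, N)) : exists Pi : 'M[R]_N,
  [/\ Pi^T = Pi, Pi *m Pi = Pi, a *m Pi = a & \tr Pi <= n%:R].
Proof.
have [B fB aB] : exists2 B : 'M[R]_(mxrank a, N), row_free B & (a <= B)%MS.
  by exists (row_base a); rewrite ?row_base_free// eq_row_base.
have uG := gram_unit fB; set G := B *m B^T in uG.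
have sG : G^T = G by rewrite /G trmx_mul trmxK.
exists (B^T *m invmx G *m B); split.
- by rewrite !trmx_mul trmxK trmx_inv sG mulmxA.
- rewrite -!mulmxA (mulmxA B) -/G (mulmxA G) mulmxV// mul1mx//.
- have /submxP[X aX] := aB.
  by rewrite {1}aX -!mulmxA (mulmxA B) -/G (mulmxA G) mulmxV// mul1mx -aX.
- rewrite mxtrace_mulC mulmxA -/G mulmxV// mxtrace1 ler_nat; exact: rank_leq_row.
Qed.

(** A diagonal entry of a symmetric idempotent is the sum of squares of
    its row, so it dominates its own square. *)
Lemma projection_diag N (Pi : 'M[R]_N) : Pi^T = Pi -> Pi *m Pi = Pi ->
  forall i, 0 <= Pi i i <= 1.
Proof.
move=> sP pP i; have E : Pi i i = \sum_k Pi i k ^+ 2.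
  rewrite -[in LHS]pP mxE; apply: eq_bigr => k _.
  by rewrite -[in X in _ * X]sP mxE expr2.
have P0 : 0 <= Pi i i by rewrite E sumr_ge0// => k _; exact: sqr_ge0.
have : Pi i i ^+ 2 <= Pi i i.
  rewrite [leRHS]E (bigD1 i)//= lerDl sumr_ge0// => k _; exact: sqr_ge0.
move=> P2; rewrite P0 /= leNgt; apply/negP => P1.
by move: P2; rewrite expr2 ger_pMr ?(lt_trans ltr01)// leNgt P1.
Qed.

Lemma complement_form_ge0 N (Pi : 'M[R]_N) (y : 'rV[R]_N) :
  Pi^T = Pi -> Pi *m Pi = Pi ->
  0 <= \sum_i \sum_j (1%:M - Pi) i j * (y 0 i * y 0 j).
Proof.
move=> sP pP; pose B : 'M[R]_N := 1%:M - Pi.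
have sB : B^T = B by rewrite /B linearB/= trmx1 sP.
have pB : B *m B = B by rewrite /B mulmxBl mul1mx mulmxBr mulmx1 pP subrr subr0.
have -> : \sum_i \sum_j B i j * (y 0 i * y 0 j) = ((y *m B) *m (y *m B)^T) 0 0.
  rewrite trmx_mul sB mulmxA -(mulmxA y) pB mxE exchange_big/=.
  apply: eq_bigr => j _; rewrite !mxE big_distrl/=; apply: eq_bigr => i _.
  by rewrite mulrA [B i j * _]mulrC.
exact: rv_sqr_ge0.
Qed.

(** The left-hand side is the squared distance of y to the range of Pi,
    which contains the row space of a. *)
Lemma dist_rowspace_ge n N (a : 'M[R]_(n, N)) (Pi : 'M[R]_N) (y : 'rV[R]_N) (c : 'rV[R]_n) :
  Pi^T = Pi -> Pi *m Pi = Pi -> a *m Pi = a ->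
  \sum_i \sum_j (1%:M - Pi) i j * (y 0 i * y 0 j) <=
  \sum_i (y 0 i - \sum_m c 0 m * a m i) ^+ 2.
Proof.
move=> sP pP aP; pose B : 'M[R]_N := 1%:M - Pi; pose v := y - c *m a.
have sB : B^T = B by rewrite /B linearB/= trmx1 sP.
have pB : B *m B = B.
  by rewrite /B mulmxBl mul1mx mulmxBr mulmx1 pP subrr subr0.
have vB : v *m B = y *m B.
  have aB : a *m B = 0 by rewrite /B mulmxBr mulmx1 aP subrr.
  by rewrite /v mulmxBl -mulmxA aB mulmx0 subr0.
have -> : \sum_i (y 0 i - \sum_m c 0 m * a m i) ^+ 2 = (v *m v^T) 0 0.
  rewrite mxE; apply: eq_bigr => i _; rewrite !mxE expr2.
  by rewrite (_ : \sum_m c 0 m * a m i = (c *m a) 0 i) // mxE.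
have -> : \sum_i \sum_j B i j * (y 0 i * y 0 j) = ((v *m B) *m (v *m B)^T) 0 0.
  rewrite vB trmx_mul sB mulmxA -(mulmxA y) pB mxE exchange_big/=.
  apply: eq_bigr => j _; rewrite !mxE big_distrl/=; apply: eq_bigr => i _.
  by rewrite mulrA [B i j * _]mulrC.
clearbody v; rewrite -subr_ge0.
have -> : (v *m v^T) 0 0 - ((v *m B) *m (v *m B)^T) 0 0 =
    ((v *m Pi) *m (v *m Pi)^T) 0 0.
  have -> : (v *m B) *m (v *m B)^T = v *m B *m v^T.
    by rewrite trmx_mul sB mulmxA -(mulmxA v B) pB.
  have -> : (v *m Pi) *m (v *m Pi)^T = v *m Pi *m v^T.
    by rewrite trmx_mul sP mulmxA -(mulmxA v Pi) pP.
  have sub (A C : 'M[R]_1) : (A - C) 0 0 = A 0 0 - C 0 0 by rewrite !mxE.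
  by rewrite /B mulmxBr mulmx1 mulmxBl sub subKr.
exact: rv_sqr_ge0.
Qed.
End projection.

(** * Square integrable functions on product spaces *)

Section Rintegrable_extra.
Context d (T : measurableType d) (R : realType) (mu : probability T R).

Lemma ae_le_Rintegrable (f g : T -> R) : measurable_fun setT f -> Rintegrable mu g ->
  {ae mu, forall x, `|f x| <= g x} -> Rintegrable mu f.
Proof.
move=> mf rg fg.
(* Truncating f between - g and g changes it on a null set only. *)
pose f1 x := Num.max (- g x) (Num.min (f x) (g x)).
have mg := Rintegrable_meas rg.
have mN : measurable_fun setT (fun x => - g x) by exact: measurableT_comp.
have mf1 : measurable_fun setT f1.
  by apply: measurable_maxr => //; exact: measurable_minr.
have rg1 : Rintegrable mu (fun x => `|g x|) by exact: integrable_norm.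
apply: (@ae_Rintegrable _ _ _ mu f1) => //.
  apply: filterS fg => x; rewrite ler_norml => /andP[h1 h2].
  by rewrite /f1 min_l// max_r.
apply: le_Rintegrable rg1 _ => // x; rewrite /f1.
rewrite ler_norml; case: (leP (f x) (g x)) => h1; case: (leP (- g x)) => h2;
  have := ler_norm (g x); have := ler_norm (- g x); rewrite normrN => *; lra.
Qed.
End Rintegrable_extra.

Section Rintegrable_fubini.
Context d1 d2 (T1 : measurableType d1) (T2 : measurableType d2) (R : realType).
Variables (m1 : probability T1 R) (m2 : probability T2 R).

Lemma fine_integrable d (T : measurableType d) (mu : probability T R) (F : T -> \bar R) :
  mu.-integrable setT F -> Rintegrable mu (fine \o F) /\
  fine (\int[mu]_x F x)%E = \int[mu]_x fine (F x).
Proof.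
move=> iF; have mF := measurable_int _ iF.
have mfF : measurable_fun setT (fine \o F).
  exact: (measurableT_comp (fine_measurable measurableT)).
split.
  apply: (le_integrable _ _ _ iF) => //; first exact/measurable_EFinP.
  by move=> x _ /=; case: (F x) => [r| |] /=; rewrite ?lexx ?normr0 ?leey.
congr fine; apply: ae_eq_integral => //; first exact/measurable_EFinP.
by apply: filterS (integrable_ae measurableT iF) => x /= /[apply] /fineK.
Qed.

(** The inner integrals of an integrable function are finite only almost
    everywhere; elsewhere the real-valued integrals below take a
    conventional value. *)
Lemma Rintegrable_fubini (f : T1 * T2 -> R) : (m1 \x m2)%E.-integrable setT (EFin \o f) ->
  [/\ Rintegrable m1 (fun x => \int[m2]_y f (x, y)),
      Rintegrable m2 (fun y => \int[m1]_x f (x, y)) &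
      \int[m1]_x \int[m2]_y f (x, y) = \int[m2]_y \int[m1]_x f (x, y)].
Proof.
move=> iF.
have [r1 e1] := fine_integrable (integrable_fubini_F iF).
have iG : m2.-integrable setT (fun y => \int[m1]_x (EFin \o f) (x, y))%E.
  have mf : measurable_fun setT (EFin \o f) by exact: measurable_int iF.
  have mG := measurable_fubini_G iF; apply/integrableP; split => //.
  apply: le_lt_trans ((integrable21ltyP m1 m2 mf).1 iF).
  apply: ge0_le_integral => //.
  - exact: measurableT_comp.
  - apply: (measurable_fun_fubini_tonelli_G (abse \o (EFin \o f))) => //=.
    exact: measurableT_comp.
  move=> y _; apply: le_abse_integral => //.
  exact: measurableT_comp mf (pair2_measurable y).
have [r2 e2] := fine_integrable iG.
split => //; rewrite -[LHS]e1 -[RHS]e2.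
by congr fine; exact: Fubini.
Qed.

(** For a random field this says that a bounded variance function already
    makes the field square integrable on the product space. *)
Lemma prod_sqr_integrable (f : T1 * T2 -> R) (M : R) : measurable_fun setT f ->
  {ae m1, forall x, (\int[m2]_y (f (x, y) ^+ 2)%:E <= M%:E)%E} ->
  (m1 \x m2)%E.-integrable setT (fun z => (f z ^+ 2)%:E).
Proof.
move=> mf fM; have mf2 : measurable_fun setT (fun z => (f z ^+ 2)%:E).
  by apply/measurable_EFinP; exact: measurable_funX.
apply/integrable12ltyP => //.
apply: (@le_lt_trans _ _ (\int[m1]_x `|M|%:E)%E); last first.
  by rewrite integral_cst//= [X in (_ * X)%E]probability_setT mule1 ltry.
apply: ae_ge0_le_integral => //.
- by move=> x _; exact: integral_ge0.
- apply: (measurable_fun_fubini_tonelli_F (fun z => `|(f z ^+ 2)%:E|%E)) => //.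
  exact: measurableT_comp.
apply: filterS fM => x Hx _.
under eq_integral => y _ do rewrite gee0_abs ?lee_fin ?sqr_ge0//.
by rewrite (le_trans Hx)// lee_fin ler_norm.
Qed.

Lemma prod_le_integrable (f g : T1 * T2 -> R) : measurable_fun setT f ->
  (m1 \x m2)%E.-integrable setT (EFin \o g) -> (forall z, `|f z| <= g z) ->
  (m1 \x m2)%E.-integrable setT (EFin \o f).
Proof.
move=> mf ig fg; apply: (le_integrable _ _ _ ig) => //; first exact/measurable_EFinP.
by move=> x _ /=; rewrite lee_fin (le_trans (fg x))// ler_norm.
Qed.

Lemma prod_integrable_fst (f : T1 -> R) : Rintegrable m1 f ->
  (m1 \x m2)%E.-integrable setT (fun z => (f z.1)%:E).
Proof.
move=> rf; have mf := Rintegrable_meas rf; apply/integrable12ltyP => /=.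
  by apply/measurable_EFinP; exact: measurableT_comp.
have [_ H] := integrableP _ _ _ rf; apply: le_lt_trans H.
rewrite le_eqVlt; apply/orP; left; apply/eqP; apply: eq_integral => x _ /=.
by rewrite integral_cst//= [X in (_ * X)%E]probability_setT mule1.
Qed.

Lemma prod_integrable_snd (f : T2 -> R) : Rintegrable m2 f ->
  (m1 \x m2)%E.-integrable setT (fun z => (f z.2)%:E).
Proof.
move=> rf; have mf := Rintegrable_meas rf.
apply: (prod_le_integrable (g := fun z => `|f z.2|)).
- exact: measurableT_comp.
- apply: (@prod_integrable_dom _ _ _ _ _ m1 m2 _ (fun y => `|f y|)).
  + by apply: measurableT_comp => //; exact: measurableT_comp.
  + exact: integrable_norm.
  + by move=> x y; rewrite normr_id.
- by move=> z.
Qed.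
End Rintegrable_fubini.

(** * Finite rank approximation of a random field *)

Lemma measurable_bigsum d (T : measurableType d) (R : realType) (I : Type) (s : seq I)
  (Q : pred I) (F : I -> T -> R) : (forall i, measurable_fun setT (F i)) ->
  measurable_fun setT (fun x => \sum_(i <- s | Q i) F i x).
Proof.
move=> mF; elim: s => [|i s IH]; first by under eq_fun do rewrite big_nil; exact: measurable_cst.
under eq_fun do rewrite big_cons.
by case Qi: (Q i) => //; exact: measurable_funD.
Qed.

Section field.
Context d (T : measurableType d) (R : realType) (mu : probability T R).
Context dO (O : measurableType dO) (P : probability O R).
Variables (Y : T -> O -> R) (D : set T) (C : T -> T -> R).
Hypothesis mY : measurable_fun setT (fun z : T * O => Y z.1 z.2).
Hypothesis aeD : {ae mu, forall t, D t}.
Hypothesis field_sqint : forall t, D t -> sqint P (Y t).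
Hypothesis bC : bker C.
Hypothesis covY : forall t u, D t -> D u -> \int[P]_w (Y t w * Y u w) = C t u.
Hypothesis field_path_sqint : {ae P, forall w, sqint mu (Y ^~ w)}.

Let norm2 w := \int[mu]_t (Y t w ^+ 2).

Lemma bmeas_diag : bmeas (fun t => C t t).
Proof.
apply: (bmeas_comp (h := fun t : T => (t, t)) _ bC).
exact: measurable_fun_pair.
Qed.

Lemma field_sqr_integrable :
  (mu \x P)%E.-integrable setT (fun z => (Y z.1 z.2 ^+ 2)%:E).
Proof.
have [_ [M CM]] := bC.
apply: (prod_sqr_integrable (f := fun z => Y z.1 z.2) (M := M) mY).
apply: filterS aeD => t Dt /=; have [_ rt] := field_sqint Dt.
rewrite -(EFin_int rt) lee_fin.
have -> : \int[P]_w (Y t w ^+ 2) = C t t.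
  by rewrite -covY//; under eq_Rintegral do rewrite expr2.
by rewrite (le_trans (ler_norm _))//; exact: (CM (t, t)).
Qed.

Lemma mean_norm2 : Rintegrable P norm2 /\ \int[P]_w norm2 w = \int[mu]_t C t t.
Proof.
have [r1 r2 e] := Rintegrable_fubini (f := fun z => Y z.1 z.2 ^+ 2) field_sqr_integrable.
split; first exact: r2.
rewrite /norm2 -e; apply: ae_eq_int; first exact: Rintegrable_meas r1.
  by have [] := bmeas_diag.
by apply: filterS aeD => t Dt /=; rewrite -covY//; under eq_Rintegral do rewrite expr2.
Qed.

Definition coef (e : T -> R) w := \int[mu]_t (Y t w * e t).

Lemma measurable_coef e : sqint mu e -> measurable_fun setT (coef e).
Proof.
move=> [me re].
have iF : (mu \x P)%E.-integrable setT (fun z => (Y z.1 z.2 * e z.1)%:E).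
  apply: (prod_le_integrable (f := fun z => Y z.1 z.2 * e z.1)
    (g := fun z => Y z.1 z.2 ^+ 2 + e z.1 ^+ 2)).
  - by apply: measurable_funM => //; exact: measurableT_comp me measurable_fst.
  - exact: (integrableD _ field_sqr_integrable (prod_integrable_fst P re)).
  - move=> z; have := sqr_ge0 (Y z.1 z.2 - e z.1); have := sqr_ge0 (Y z.1 z.2 + e z.1).
    have := sqr_ge0 (Y z.1 z.2); have := sqr_ge0 (e z.1).
    by rewrite sqrrB sqrrD => *; rewrite ler_norml; apply/andP; split; lra.
have [_ r2 _] := Rintegrable_fubini (f := fun z => Y z.1 z.2 * e z.1) iF.
exact: Rintegrable_meas r2.
Qed.

(** The coefficient is at most |e| |Y| by Cauchy-Schwarz along almost
    every path. *)
Lemma coef_sqint e : bmeas e -> sqint P (coef e).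
Proof.
move=> be; have le := bmeas_sqint mu be; have mc := measurable_coef le.
split => //; apply: (ae_le_Rintegrable (g := fun w => (\int[mu]_t (e t ^+ 2)) * norm2 w)).
- exact: measurable_funX.
- exact/RintegrableZ/mean_norm2.1.
apply: filterS field_path_sqint => w lw.
by rewrite ger0_norm ?sqr_ge0// mulrC; exact: int_cauchy_schwarz.
Qed.

Lemma measurable_corr Z : sqint P Z ->
  measurable_fun setT (fun t => \int[P]_w (Y t w * Z w)).
Proof.
move=> [mZ rZ].
have iG : (mu \x P)%E.-integrable setT (fun z => (Y z.1 z.2 * Z z.2)%:E).
  apply: (prod_le_integrable (f := fun z => Y z.1 z.2 * Z z.2)
    (g := fun z => Y z.1 z.2 ^+ 2 + Z z.2 ^+ 2)).
  - by apply: measurable_funM => //; exact: measurableT_comp mZ measurable_snd.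
  - exact: (integrableD _ field_sqr_integrable (prod_integrable_snd mu rZ)).
  - move=> z; have := sqr_ge0 (Y z.1 z.2 - Z z.2); have := sqr_ge0 (Y z.1 z.2 + Z z.2).
    have := sqr_ge0 (Y z.1 z.2); have := sqr_ge0 (Z z.2).
    by rewrite sqrrB sqrrD => *; rewrite ler_norml; apply/andP; split; lra.
have [r3 _ _] := Rintegrable_fubini (f := fun z => Y z.1 z.2 * Z z.2) iG.
exact: Rintegrable_meas r3.
Qed.

(** Fubini for Y(t, w) e(t) Z(w). With Z another coefficient and then with
    Z = Y t, this gives coef_cov. *)
Lemma coef_pair e Z : bmeas e -> sqint P Z ->
  \int[P]_w (Z w * coef e w) = \int[mu]_t (e t * \int[P]_w (Y t w * Z w)).
Proof.
move=> be [mZ rZ]; have [me [M eM]] := be.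
have iF : (mu \x P)%E.-integrable setT (fun z => (Y z.1 z.2 * e z.1 * Z z.2)%:E).
  apply: (prod_le_integrable (f := fun z => Y z.1 z.2 * e z.1 * Z z.2)
    (g := fun z => M * (Y z.1 z.2 ^+ 2 + Z z.2 ^+ 2))).
  - apply: measurable_funM; last exact: measurableT_comp mZ measurable_snd.
    by apply: measurable_funM => //; exact: measurableT_comp me measurable_fst.
  - exact: (integrableZl _ M (integrableD _ field_sqr_integrable (prod_integrable_snd mu rZ))).
  - move=> z; rewrite mulrAC mulrC normrM ler_pM//.
    have := sqr_ge0 (Y z.1 z.2 - Z z.2); have := sqr_ge0 (Y z.1 z.2 + Z z.2).
    have := sqr_ge0 (Y z.1 z.2); have := sqr_ge0 (Z z.2).
    by rewrite sqrrB sqrrD => *; rewrite ler_norml; apply/andP; split; lra.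
have [r1 r2 E] := Rintegrable_fubini (f := fun z => Y z.1 z.2 * e z.1 * Z z.2) iF.
have l2e := bmeas_sqint mu be.
transitivity (\int[P]_w \int[mu]_t (Y t w * e t * Z w)).
  apply: ae_eq_int.
  - by apply: measurable_funM => //; exact: measurable_coef.
  - exact: Rintegrable_meas r2.
  apply: filterS field_path_sqint => w lw /=; rewrite /coef -intZ; last exact: sqint_mul.
  by apply: eq_Rintegral => t _; rewrite mulrC.
rewrite -E; apply/esym.
have HE : {ae mu, forall t, e t * \int[P]_w (Y t w * Z w) =
    \int[P]_w (Y t w * e t * Z w)}.
  apply: filterS aeD => t Dt /=; rewrite -intZ; last exact: sqint_mul (field_sqint Dt) (conj mZ rZ).
  by apply: eq_Rintegral => w _; rewrite mulrA [e t * _]mulrC.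
apply: ae_eq_int; [|exact: Rintegrable_meas r1|exact: HE].
apply: measurable_funM => //.
exact: measurable_corr (conj mZ rZ).
Qed.

Lemma coef_cov e e' : bmeas e -> bmeas e' ->
  \int[P]_w (coef e w * coef e' w) =
  \int[mu]_t (e' t * \int[mu]_u (C t u * e u)).
Proof.
move=> be be'; rewrite (coef_pair be' (coef_sqint be)).
have bCe : bmeas (fun t => \int[mu]_u (C t u * e u)).
  by apply: (bker_int mu (k := fun t u => C t u * e u)); apply: bkerM => //; exact: bker_snd.
have HE : {ae mu, forall t, \int[P]_w (Y t w * coef e w) = \int[mu]_u (C t u * e u)}.
  apply: filterS aeD => t Dt.
  rewrite (coef_pair be (field_sqint Dt)).
  have bt := bker_r t bC.
  have HEt : {ae mu, forall u, e u * \int[P]_w (Y u w * Y t w) = C t u * e u}.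
    apply: filterS aeD => u Du; rewrite mulrC -covY//; congr (_ * _).
    by apply: eq_Rintegral => w _; rewrite mulrC.
  apply: ae_eq_int; [|by case: (bmeasM bt be)|exact: HEt].
  have [me _] := be; apply: measurable_funM => //.
  exact: measurable_corr (field_sqint Dt).
apply: ae_eq_int.
- by have [me' _] := be'; apply: measurable_funM => //; exact: measurable_corr (coef_sqint be).
- by case: (bmeasM be' bCe).
by apply: filterS HE => t ->.
Qed.

Variables (N : nat) (e : 'I_N -> T -> R) (lam : 'I_N -> R).
Hypothesis be : forall i, bmeas (e i).
Hypothesis oe : forall i j, lam i != 0 -> lam j != 0 ->
  \int[mu]_t (e i t * e j t) = (i == j)%:R.
Hypothesis ze : forall i, lam i = 0 -> e i = cst 0.
Hypothesis ee : forall i, {ae mu, forall t, \int[mu]_u (C t u * e i u) = lam i * e i t}.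

(** Orthonormality in a form that also covers the zero functions listed
    with eigenvalue 0. *)
Lemma eigen_ip i j : lam j * \int[mu]_t (e i t * e j t) = if i == j then lam i else 0.
Proof.
have [lj|lj] := eqVneq (lam j) 0.
  by rewrite lj mul0r; case: eqP => // ->; rewrite lj.
have [li|li] := eqVneq (lam i) 0.
  rewrite ze//; under eq_Rintegral do rewrite mul0r.
  by rewrite int_cst mulr0 li if_same.
by rewrite oe//; case: eqP => [->|_]; rewrite ?mulr1 ?mulr0.
Qed.

Lemma eigen_ip_coef g i j : \int[mu]_t (g t * e i t) * \int[mu]_t (e j t * e i t) =
  if j == i then \int[mu]_t (g t * e i t) else 0.
Proof.
have [li|li] := eqVneq (lam i) 0.
  rewrite ze//; under eq_Rintegral do rewrite mulr0.
  by rewrite int_cst mul0r if_same.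
have [lj|lj] := eqVneq (lam j) 0.
  rewrite (ze lj); under [X in _ * X]eq_Rintegral do rewrite mul0r.
  by rewrite int_cst mulr0; case: eqP => // ji; rewrite -ji lj eqxx in li.
by rewrite oe//; case: eqP => _; rewrite ?mulr1 ?mulr0.
Qed.

(** The coefficients along eigenfunctions of the covariance operator are
    uncorrelated, with the eigenvalues as variances (Karhunen-Loeve). *)
Lemma eigen_coef_cov i j :
  \int[P]_w (coef (e i) w * coef (e j) w) = if i == j then lam i else 0.
Proof.
rewrite coef_cov//; transitivity (\int[mu]_t (lam i * (e j t * e i t))).
  apply: ae_eq_int.
  - have [//] : bmeas (fun t => e j t * \int[mu]_u (C t u * e i u)).
    apply: bmeasM => //; apply: (bker_int mu (k := fun t u => C t u * e i u)).
    by apply: bkerM => //; exact: bker_snd.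
  - by have [] := bmeasZ (lam i) (bmeasM (be j) (be i)).
  by apply: filterS (ee i) => t ->; rewrite mulrCA.
rewrite intZ; last exact/bmeas_Rintegrable/bmeasM.
by rewrite eigen_ip eq_sym; case: eqP => [->|].
Qed.

Lemma bessel_identity (S : pred 'I_N) (g : T -> R) : sqint mu g ->
  \int[mu]_t ((g t - \sum_(i | S i) (\int[mu]_u (g u * e i u)) * e i t) ^+ 2) =
  \int[mu]_t (g t ^+ 2) - \sum_(i | S i) (\int[mu]_u (g u * e i u)) ^+ 2.
Proof.
move=> lg; pose c i := \int[mu]_u (g u * e i u); pose h t := \sum_(i | S i) c i * e i t.
have lh : sqint mu h by apply: sqint_sum => i _; exact/sqintZ/bmeas_sqint.
have gh : \int[mu]_t (g t * h t) = \sum_(i | S i) c i ^+ 2.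
  transitivity (\int[mu]_t (\sum_(i | S i) c i * (g t * e i t))).
    by apply: eq_Rintegral => t _; rewrite /h mulr_sumr; apply: eq_bigr => i _; ring.
  rewrite int_sum => [|i _]; last exact/RintegrableZ/sqint_mul/bmeas_sqint.
  by apply: eq_bigr => i _; rewrite intZ ?expr2//; exact/sqint_mul/bmeas_sqint.
have hh : \int[mu]_t (h t ^+ 2) = \sum_(i | S i) c i ^+ 2.
  transitivity (\int[mu]_t (\sum_(j | S j) c j * (e j t * h t))).
    by apply: eq_Rintegral => t _; rewrite {2}/h -/(h t) expr2 {1}/h mulr_suml;
      apply: eq_bigr => i _; rewrite mulrA.
  rewrite int_sum => [|i _]; last exact/RintegrableZ/sqint_mul/lh/bmeas_sqint.
  apply: eq_bigr => j Sj; rewrite intZ; last exact/sqint_mul/lh/bmeas_sqint.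
  rewrite expr2; congr (_ * _).
  transitivity (\int[mu]_t (\sum_(i | S i) c i * (e j t * e i t))).
    by apply: eq_Rintegral => t _; rewrite /h mulr_sumr; apply: eq_bigr => i _; ring.
  rewrite int_sum => [|i _]; last exact/bmeas_Rintegrable/bmeasZ/bmeasM.
  transitivity (\sum_(i | S i) (if j == i then c i else 0)).
    apply: eq_bigr => i _; rewrite intZ; last exact/bmeas_Rintegrable/bmeasM.
    exact: eigen_ip_coef.
  rewrite (bigD1 j)//= eqxx big1 ?addr0// => i /andP[_ ij].
  by rewrite eq_sym (negPf ij).
have r1 : Rintegrable mu (fun t => g t ^+ 2) by case: lg.
have r2 : Rintegrable mu (fun t => g t * h t) by exact: sqint_mul.
have r3 : Rintegrable mu (fun t => h t ^+ 2) by case: lh.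
transitivity (\int[mu]_t (g t ^+ 2 - 2 * (g t * h t) + h t ^+ 2)).
  by apply: eq_Rintegral => t _; rewrite -/(h t); ring.
rewrite intD//; last by apply: RintegrableB => //; exact: RintegrableZ.
by rewrite intB ?intZ//; [rewrite gh hh; ring|exact: RintegrableZ].
Qed.

Lemma coef_sqr_Rintegrable i : Rintegrable P (fun w => coef (e i) w ^+ 2).
Proof. by case: (coef_sqint (be i)). Qed.

Lemma mean_coef_sqr i : \int[P]_w (coef (e i) w ^+ 2) = lam i.
Proof. by have := eigen_coef_cov i i; rewrite eqxx => <-; under eq_Rintegral do rewrite expr2. Qed.

Lemma sqr_dist_measurable (Z : T -> O -> R) :
  measurable_fun setT (fun z : T * O => Z z.1 z.2) ->
  measurable_fun setT (fun w => \int[mu]_t ((Y t w - Z t w) ^+ 2)%:E)%E.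
Proof.
move=> mZ.
apply: (measurable_fun_fubini_tonelli_G (fun z => ((Y z.1 z.2 - Z z.1 z.2) ^+ 2)%:E)).
  by apply/measurable_EFinP; apply: measurable_funX; exact: measurable_funB.
by move=> z; rewrite lee_fin sqr_ge0.
Qed.

Lemma eigen_projection_error (S : pred 'I_N) :
  (\int[P]_w \int[mu]_t
    ((Y t w - \sum_(i | S i) coef (e i) w * e i t) ^+ 2)%:E)%E =
  (\int[mu]_t C t t - \sum_(i | S i) lam i)%:E.
Proof.
have [rn en] := mean_norm2.
have rs : Rintegrable P (fun w => \sum_(i | S i) coef (e i) w ^+ 2).
  by apply: Rintegrable_sum => i _; exact: coef_sqr_Rintegrable.
transitivity (\int[P]_w (norm2 w - \sum_(i | S i) coef (e i) w ^+ 2)%:E)%E.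
  apply: ae_eq_integral => //.
  - apply: (sqr_dist_measurable (Z := fun t w => \sum_(i | S i) coef (e i) w * e i t)).
    apply: measurable_bigsum => i; apply: measurable_funM.
      exact: (measurableT_comp (measurable_coef (bmeas_sqint mu (be i))) measurable_snd).
    by apply: measurableT_comp measurable_fst; case: (be i).
  - by apply/measurable_EFinP; exact: Rintegrable_meas (RintegrableB rn rs).
  apply: filterS field_path_sqint => w lw _.
  have lZ : sqint mu (fun t => \sum_(i | S i) coef (e i) w * e i t).
    by apply: sqint_sum => i _; exact/sqintZ/bmeas_sqint.
  rewrite -(EFin_int (sqintB lw lZ).2); congr (_%:E).
  exact: (bessel_identity S lw).
rewrite -(EFin_int (RintegrableB rn rs)) intB// en int_sum => [|i _]; last exact: coef_sqr_Rintegrable.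
by congr ((_ - _)%:E); apply: eq_bigr => i _; exact: mean_coef_sqr.
Qed.

(** For a single path, Bessel's inequality bounds the squared error below
    by the squared distance, in the N eigencoordinates, from the
    coordinate vector c of Y to the row space of the coordinates of the ps
    m. This distance is the quadratic form of 1 - Pi at c, with Pi an
    orthogonal projection of rank at most n. Since the c i are
    uncorrelated, only the diagonal of Pi survives in the mean, whence p i
    = Pi i i. *)
Lemma rank_error_ge n (ps : 'I_n -> T -> R) : (forall m, sqint mu (ps m)) ->
  exists p : 'I_N -> R, [/\ forall i, 0 <= p i <= 1, \sum_i p i <= n%:R &
    ((\sum_i lam i * (1 - p i))%:E <= \int[P]_w \int[mu]_t
      ((Y t w - \sum_(m < n) coef (ps m) w * ps m t) ^+ 2)%:E)%E].
Proof.
(* Row m of a lists the eigencoordinates of ps m. *)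
move=> lps; pose a := \matrix_(m < n, i < N) \int[mu]_t (ps m t * e i t).
have [Pi [sP pP aP trP]] := orthogonal_projection a.
exists (fun i => Pi i i); split => //; first exact: projection_diag.
pose c i := coef (e i).
pose h w := \sum_i \sum_j (1%:M - Pi) i j * (c i w * c j w).
have rh i j : Rintegrable P (fun w => (1%:M - Pi) i j * (c i w * c j w)).
  by apply/RintegrableZ/sqint_mul; exact: coef_sqint.
have Rintegrable_h : Rintegrable P h by apply: Rintegrable_sum => i _; exact: Rintegrable_sum.
have -> : \sum_i lam i * (1 - Pi i i) = \int[P]_w h w.
  rewrite int_sum => [|i _]; last exact: Rintegrable_sum.
  apply: eq_bigr => i _; rewrite int_sum => [|j _]; last exact: rh.
  transitivity (\sum_j (if i == j then lam i * (1 - Pi i i) else 0)).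
    by rewrite (bigD1 i)//= eqxx big1 ?addr0// => j; rewrite eq_sym => /negPf ->.
  apply: eq_bigr => j _; rewrite intZ; last by apply: sqint_mul; exact: coef_sqint.
  rewrite eigen_coef_cov; case: eqP => [<-|_]; last by rewrite mulr0.
  by rewrite !mxE eqxx mulr1n mulrC.
rewrite (EFin_int Rintegrable_h).
pose Z t w := \sum_(m < n) coef (ps m) w * ps m t.
have hE w : h w = \sum_i \sum_j (1%:M - Pi) i j *
    ((\row_i c i w) 0 i * (\row_i c i w) 0 j).
  by apply: eq_bigr => i _; apply: eq_bigr => j _; rewrite !mxE.
apply: ae_ge0_le_integral => //.
- by move=> w _; rewrite lee_fin hE; exact: complement_form_ge0.
- exact/measurable_EFinP/Rintegrable_meas/Rintegrable_h.
- by move=> w _; apply: integral_ge0 => t _; rewrite lee_fin sqr_ge0.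
- apply: (sqr_dist_measurable (Z := Z)).
  apply: measurable_bigsum => m; apply: measurable_funM.
    exact: (measurableT_comp (measurable_coef (lps m)) measurable_snd).
  by apply: measurableT_comp measurable_fst; case: (lps m).
apply: filterS field_path_sqint => w lw _.
have lZ : sqint mu (Z ^~ w) by apply: sqint_sum => m _; exact: sqintZ.
have lYZ := sqintB lw lZ.
rewrite -(EFin_int lYZ.2) lee_fin.
(* Bessel's inequality for the residual Y - Z. *)
have := bessel_identity xpredT lYZ.
set X := \int[mu]_t _ => E.
have X0 : 0 <= X by apply: int_ge0 => t; exact: sqr_ge0.
have X1 : \sum_i (\int[mu]_u ((Y u w - Z u w) * e i u)) ^+ 2 <=
    \int[mu]_t ((Y t w - Z t w) ^+ 2) by rewrite -subr_ge0 -E.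
apply: le_trans X1.
rewrite hE.
apply: (le_trans (dist_rowspace_ge (\row_i c i w) (\row_m coef (ps m) w) sP pP aP)).
rewrite le_eqVlt; apply/orP; left; apply/eqP; apply: eq_bigr => i _; congr (_ ^+ 2).
have li := bmeas_sqint mu (be i).
under [RHS]eq_Rintegral do rewrite mulrBl.
rewrite intB; [|exact: sqint_mul..].
rewrite !mxE; congr (_ - _).
transitivity (\int[mu]_t \sum_(m < n) coef (ps m) w * (ps m t * e i t)).
  rewrite int_sum => [|m _]; last exact/RintegrableZ/sqint_mul.
  by apply: eq_bigr => m _; rewrite intZ ?mxE//; exact: sqint_mul.
by apply: eq_Rintegral => t _; rewrite /Z mulr_suml; apply: eq_bigr => m _; rewrite mulrA.
Qed.
End field.

(** * Integration over the unit cube *)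

Section cube.
Variable R : realType.
Notation U := (measurableTypeR R).
Notation mu := (@unit_leb R).
Notation cube := (@cube_leb R).

(** The change of variables that makes induction on the dimension
    possible. *)
Lemma cube_int_cons n (f : n.+1.-tuple U -> R) : bmeas f ->
  \int[cube n.+1]_t f t = \int[mu]_x \int[cube n]_t f (tcons (x, t)).
Proof.
move=> bf; have bfc : bmeas (fun z : U * n.-tuple U => f (tcons z)).
  exact: (bmeas_comp (@measurable_tcons R n)).
have iF := bmeas_prod_integrable mu (cube n) bfc.
rewrite /Rintegral.
rewrite (@integral_distribution _ _ _ _ _ (mu \x cube n)%E (@tcons R n) (EFin \o f)) //; last first.
  by apply/measurable_EFinP; case: bf.
have [r1 e1] := fine_integrable (integrable_fubini_F iF).
by apply: etrans e1; congr fine; apply/esym; exact: integral12_prod_meas1.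
Qed.

Lemma bmeas_tnth n (g : U -> R) (i : 'I_n) : bmeas g -> bmeas (fun t : n.-tuple U => g (tnth t i)).
Proof. exact: (bmeas_comp (measurable_tnth i)). Qed.

Lemma cube_marginal n (g : U -> R) (i : 'I_n) : bmeas g ->
  \int[cube n]_t g (tnth t i) = \int[mu]_x g x.
Proof.
move=> bg; elim: n i => [[]//|n IH] i.
rewrite cube_int_cons; last exact: bmeas_tnth.
have [j ->|->] := unliftP ord0 i.
  transitivity (\int[mu]_x \int[cube n]_t g (tnth t j)); last by rewrite int_cst IH.
  by apply: eq_Rintegral => x _; apply: eq_Rintegral => t _; rewrite /tcons tnthS.
apply: eq_Rintegral => x _; rewrite -[RHS](int_cst (cube n)).
by apply: eq_Rintegral => t _; rewrite /tcons tnth0.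
Qed.

(** Distinct coordinates are independent under the uniform measure on the
    cube. *)
Lemma cube_marginal2 n (g h : U -> R) (i j : 'I_n) : i != j -> bmeas g -> bmeas h ->
  \int[cube n]_t (g (tnth t i) * h (tnth t j)) = \int[mu]_x g x * \int[mu]_x h x.
Proof.
elim: n i j g h => [[]//|n IH] i j g h ij bg bh.
rewrite (cube_int_cons (f := fun t => g (tnth t i) * h (tnth t j))); last first.
  by apply: bmeasM; exact: bmeas_tnth.
case: (unliftP ord0 i) ij => [i' ->|->]; case: (unliftP ord0 j) => [j' ->|->] ij.
- transitivity (\int[mu]_x \int[cube n]_t (g (tnth t i') * h (tnth t j'))).
    by apply: eq_Rintegral => x _; apply: eq_Rintegral => t _; rewrite /tcons !tnthS.
  by rewrite int_cst IH//; apply: contra_neq ij => ->.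
- transitivity (\int[mu]_x (\int[mu]_y g y * h x)).
    apply: eq_Rintegral => x _.
    transitivity (\int[cube n]_t (h x * g (tnth t i'))).
      by apply: eq_Rintegral => t _; rewrite /tcons tnthS tnth0 mulrC.
    rewrite intZ ?cube_marginal 1?mulrC//.
    exact/bmeas_Rintegrable/bmeas_tnth.
  by rewrite intZ//; exact: bmeas_Rintegrable.
- transitivity (\int[mu]_x (\int[mu]_y h y * g x)).
    apply: eq_Rintegral => x _.
    transitivity (\int[cube n]_t (g x * h (tnth t j'))).
      by apply: eq_Rintegral => t _; rewrite /tcons tnthS tnth0.
    rewrite intZ ?cube_marginal 1?mulrC//.
    exact/bmeas_Rintegrable/bmeas_tnth.
  by rewrite intZ 1?mulrC//; exact: bmeas_Rintegrable.
- by rewrite eqxx in ij.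
Qed.

(** The exceptional set is a null set in one coordinate: integrate its
    indicator with cube_marginal. *)
Lemma cube_ae_tnth n (i : 'I_n) (Q : U -> Prop) :
  {ae (mu : probability U R), forall x, Q x} -> {ae cube n, forall t, Q (tnth t i)}.
Proof.
move=> [A [mA A0 QA]].
pose f := (\1_A : U -> R).
have bf : bmeas f.
  split; first exact: measurable_indic.
  by exists 1 => x; rewrite /f indicE ger0_norm// lern1 leq_b1.
have bft := bmeas_tnth i bf.
have /(int_sqr_eq0 (bmeas_sqint (cube n) bft)) : \int[cube n]_t (f (tnth t i) ^+ 2) = 0.
  rewrite (cube_marginal i (bmeasX 2 bf)).
  transitivity (\int[mu]_x f x).
    by apply: eq_Rintegral => x _; rewrite /f indicE; case: (_ \in _); rewrite ?expr1n ?expr0n.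
  by rewrite /Rintegral integral_indic// setIT [X in fine X]A0.
apply: filterS => t; rewrite /f indicE.
have [|nA _] := boolP (tnth t i \in A); first by move=> _ /eqP; rewrite oner_eq0.
by apply: contrapT => nQ; move/negP: nA; apply; rewrite inE; apply: QA.
Qed.

Lemma cube_ae_forall n (Q : 'I_n -> n.-tuple U -> Prop) :
  (forall i, {ae cube n, forall t, Q i t}) -> {ae cube n, forall t, forall i, Q i t}.
Proof.
move=> H; have /ae_foralln : forall m, {ae cube n, forall t, forall Hm : (m < n)%N, Q (Ordinal Hm) t}.
  move=> m; have [mn|nm] := pselect (m < n)%N; last by apply: nearW => t Hm.
  apply: filterS (H (Ordinal mn)) => t Ht Hm.
  by have -> : Ordinal Hm = Ordinal mn by exact: val_inj.
by apply: filterS => t Ht [m Hm]; exact: Ht.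
Qed.

Lemma ae_unit_cube n : {ae cube n, forall t, unit_cube t}.
Proof.
apply: cube_ae_forall => i; apply: (cube_ae_tnth i (Q := fun x => x \in `[0%R, 1%R])).
have [A [mA A0 QA]] := @unit_leb_ae R; exists A; split => // x nx; apply: QA.
by move=> /andP[x0 x1]; apply: nx; rewrite /= in_itv/= x0 ltW.
Qed.
End cube.

(** * Spectrum of the additive covariance *)

(** Enumerates the natural numbers other than k0 in increasing order, that
    is, the indices of the eigenvalues that remain once that of the
    constant is set aside. *)
Definition skip (k0 k : nat) : nat := if (k < k0)%N then k else k.+1.

Lemma skip_inj k0 : injective (skip k0).
Proof. by move=> k l; rewrite /skip; case: (ltnP k k0) => h1; case: (ltnP l k0) => h2 => e; lia. Qed.

Lemma skip_neq k0 k : skip k0 k != k0.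
Proof. by rewrite /skip; case: ltnP => kk; apply/eqP; lia. Qed.

Lemma bar_eig_skip (R : realType) (lam : nat -> R) k0 k : bar_eig lam k0 k.+1 = lam (skip k0 k).
Proof. by rewrite /bar_eig /skip; case: ifP. Qed.

Section constant_eigenfunction.
Variable R : realType.
Notation mu := (@unit_leb R).
Variable K : R -> R -> R.
Hypothesis cK : {within [set` `[0%R, 1%R]] `*` [set` `[0%R, 1%R]],
     continuous (fun ts : R * R => K ts.1 ts.2)}.
Variables (lam : nat -> R) (psi : nat -> measurableTypeR R -> R) (k0 : nat).
Hypothesis eK : eigen_system K lam psi.
Hypothesis basic : {ae unit_leb, forall t, psi k0 t = 1}.

Lemma lam_k0_neq0 : lam k0 != 0.
Proof.
apply/eqP => l0; have := eigen_pad eK l0 => z.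
have : \int[mu]_x (1 : R) = \int[mu]_x (0 : R).
  apply: ae_eq_int => //; apply: filterS2 basic z => t -> /eqP.
  by rewrite oner_eq0.
by rewrite !int_cst => /eqP; rewrite oner_eq0.
Qed.

Notation eigfun := (eigfun K lam psi).

Lemma eigfun_k0 : {ae mu, forall t, eigfun k0 t = 1}.
Proof. by apply: filterS2 basic (eigfun_psi cK eK k0) => t -> ->. Qed.

(** The remaining eigenfunctions are orthogonal to the constant 1. *)
Lemma int_eigfun_skip k : \int[mu]_t eigfun (skip k0 k) t = 0.
Proof.
have [l0|l0] := eqVneq (lam (skip k0 k)) 0.
  by rewrite eigfun_zero// int_cst.
transitivity (\int[mu]_t (eigfun (skip k0 k) t * eigfun k0 t)).
  apply: ae_eq_int.
  - by have [] := eigfun_bmeas cK eK (skip k0 k).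
  - by have [] := bmeasM (eigfun_bmeas cK eK (skip k0 k)) (eigfun_bmeas cK eK k0).
  by apply: filterS eigfun_k0 => t ->; rewrite mulr1.
by rewrite eigfun_orthonormal// ?lam_k0_neq0// (negPf (skip_neq _ _)).
Qed.

Lemma int_kernel_k0 t : \int[mu]_u Kclamp K t u = lam k0 * eigfun k0 t.
Proof.
have bt := bker_r t (Kclamp_bker cK).
rewrite -(eigfun_eigen cK eK k0 t); apply: ae_eq_int.
- by case: bt.
- by have [] := bmeasM bt (eigfun_bmeas cK eK k0).
by apply: filterS eigfun_k0 => u ->; rewrite mulr1.
Qed.
End constant_eigenfunction.

Section cube_family.
Variable R : realType.
Notation U := (measurableTypeR R).
Notation mu := (@unit_leb R).
Notation cube := (@cube_leb R).
Variables (d M : nat).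
Variables (K : nat -> R -> R -> R) (lam : nat -> nat -> R)
  (psi : nat -> nat -> U -> R) (k0 : nat -> nat).
Hypothesis cK : forall j, {within [set` `[0%R, 1%R]] `*` [set` `[0%R, 1%R]],
     continuous (fun ts : R * R => K j ts.1 ts.2)}.
Hypothesis eK : forall j, eigen_system (K j) (lam j) (psi j).
Hypothesis basic : forall j, {ae unit_leb, forall t, psi j (k0 j) t = 1}.
Hypothesis d0 : (0 < d)%N.

(** The covariance kernel of the additive random field. *)
Definition Ksum (t u : d.-tuple U) : R := \sum_(j < d) Kclamp (K j) (tnth t j) (tnth u j).

Notation idx := (option ('I_d * 'I_M)).

(** None stands for the constant function 1, whose eigenvalues in the
    individual coordinates merge into a single eigenvalue on the cube. *)
Definition cube_eigfun (i : idx) (t : d.-tuple U) : R :=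
  if i is Some (j, k) then eigfun (K j) (lam j) (psi j) (skip (k0 j) k) (tnth t j) else 1.

Definition cube_eigval (i : idx) : R :=
  if i is Some (j, k) then lam j (skip (k0 j) k) else \sum_(j < d) lam j (k0 j).

Lemma bker_coord j (k : U -> U -> R) : bker k ->
  bker (fun t u : d.-tuple U => k (tnth t j) (tnth u j)).
Proof.
move=> bk1; apply: (bmeas_comp (h := fun z : d.-tuple U * d.-tuple U =>
  (tnth z.1 j, tnth z.2 j)) _ bk1).
apply: measurable_fun_pair.
- exact: measurableT_comp (measurable_tnth j) measurable_fst.
- exact: measurableT_comp (measurable_tnth j) measurable_snd.
Qed.

Lemma Ksum_bker : bker Ksum.
Proof. by apply: bker_sum => j; exact/bker_coord/Kclamp_bker. Qed.

Lemma cube_eigfun_bmeas i : bmeas (cube_eigfun i).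
Proof.
case: i => [[j k]|]; last exact: bmeas_cst.
by apply: (bmeas_tnth (g := eigfun (K j) (lam j) (psi j) (skip (k0 j) k))); exact: eigfun_bmeas.
Qed.

Lemma cube_eigfun_mean j k : \int[cube d]_t cube_eigfun (Some (j, k)) t = 0.
Proof.
rewrite -[RHS](int_eigfun_skip (@cK j) (eK j) (@basic j) k).
by rewrite -(cube_marginal j)//; exact: eigfun_bmeas.
Qed.

Lemma cube_eigfun_orthonormal i i' : cube_eigval i != 0 -> cube_eigval i' != 0 ->
  \int[cube d]_t (cube_eigfun i t * cube_eigfun i' t) = (i == i')%:R.
Proof.
case: i => [[j k]|]; case: i' => [[j' k']|] /= v v'.
- have [jj|jj] := eqVneq j j'; last first.
    rewrite (cube_marginal2 (g := eigfun (K j) (lam j) (psi j) (skip (k0 j) k))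
      (h := eigfun (K j') (lam j') (psi j') (skip (k0 j') k')) jj); [|exact: eigfun_bmeas..].
    rewrite (int_eigfun_skip (@cK j) (eK j) (@basic j)) mul0r.
    by case: eqP => // -[] jj'; rewrite jj' eqxx in jj.
  subst j'; rewrite (cube_marginal (g := fun x => eigfun (K j) (lam j) (psi j) (skip (k0 j) k) x
    * eigfun (K j) (lam j) (psi j) (skip (k0 j) k') x) j); last by apply: bmeasM; exact: eigfun_bmeas.
  rewrite eigfun_orthonormal// (inj_eq (@skip_inj _)); congr (nat_of_bool _)%:R.
  by apply/eqP/eqP => [/val_inj->|[->]].
- by under eq_Rintegral do rewrite mulr1; exact: (cube_eigfun_mean j k).
- by under eq_Rintegral do rewrite mul1r; exact: (cube_eigfun_mean j' k').
- by under eq_Rintegral do rewrite mulr1; rewrite int_cst.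
Qed.

Lemma cube_eigfun_zero i : cube_eigval i = 0 -> cube_eigfun i = cst 0.
Proof.
case: i => [[j k]|] /= v.
  by apply/funext => t /=; rewrite eigfun_zero.
exfalso; have : 0 < \sum_(j < d) lam j (k0 j).
  rewrite (bigD1 (Ordinal d0))//= ltr_wpDr//.
    by apply: sumr_ge0 => j _; exact: eigen_ge0 (eK j) _.
  by rewrite lt_neqAle eq_sym (lam_k0_neq0 (eK 0%N) (@basic 0%N)) (eigen_ge0 (eK 0%N)).
by rewrite v ltxx.
Qed.

(** For the function psi_{j,k}(u_j) the summands of the kernel with l <> j
    integrate to a multiple of the mean of psi_{j,k}, which is zero; for
    the constant every summand contributes its own eigenvalue. *)
Lemma cube_eigfun_eigen i :
  {ae cube d, forall t, \int[cube d]_u (Ksum t u * cube_eigfun i u) = cube_eigval i * cube_eigfun i t}.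
Proof.
have bc (t : d.-tuple U) (l : 'I_d) : bmeas (fun u : d.-tuple U => Kclamp (K l) (tnth t l) (tnth u l)).
  by apply: (bmeas_tnth (g := Kclamp (K l) (tnth t l))); exact/bker_r/Kclamp_bker.
have E t : \int[cube d]_u (Ksum t u * cube_eigfun i u) =
    \sum_(l < d) \int[cube d]_u (Kclamp (K l) (tnth t l) (tnth u l) * cube_eigfun i u).
  rewrite -int_sum => [|l _]; last by apply/bmeas_Rintegrable/bmeasM; [exact: bc|exact: cube_eigfun_bmeas].
  by apply: eq_Rintegral => u _; rewrite /Ksum mulr_suml.
case: i E => [[j k]|] E.
  apply: nearW => t; rewrite E (bigD1 j)//= big1 ?addr0 => [|l lj].
    rewrite (cube_marginal (g := fun x => Kclamp (K j) (tnth t j) x *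
      eigfun (K j) (lam j) (psi j) (skip (k0 j) k) x) j) ?eigfun_eigen//.
    by apply: bmeasM; [exact/bker_r/Kclamp_bker|exact: eigfun_bmeas].
  rewrite (cube_marginal2 (g := Kclamp (K l) (tnth t l))
    (h := eigfun (K j) (lam j) (psi j) (skip (k0 j) k)) lj).
  - by rewrite (int_eigfun_skip (@cK j) (eK j) (@basic j)) mulr0.
  - exact/bker_r/Kclamp_bker.
  - exact: eigfun_bmeas.
have ae1 : {ae cube d, forall t, forall l : 'I_d,
    eigfun (K l) (lam l) (psi l) (k0 l) (tnth t l) = 1}.
  apply: cube_ae_forall => l.
  apply: (cube_ae_tnth l (Q := fun x => eigfun (K l) (lam l) (psi l) (k0 l) x = 1)).
  exact: eigfun_k0.
apply: filterS ae1 => t Ht; rewrite E/= mulr1; apply: eq_bigr => l _.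
under eq_Rintegral do rewrite mulr1.
rewrite (cube_marginal (g := Kclamp (K l) (tnth t l)) l); last exact/bker_r/Kclamp_bker.
by rewrite (int_kernel_k0 (@cK l) (eK l) (@basic l)) Ht mulr1.
Qed.

Lemma trace_Ksum : \int[cube d]_t Ksum t t = \sum_(j < d) \int[mu]_x Kclamp (K j) x x.
Proof.
have bdg j : bmeas (fun x => Kclamp (K j) x x).
  apply: (bmeas_comp (h := fun t : U => (t, t)) _ (Kclamp_bker (@cK j))).
  exact: measurable_fun_pair.
rewrite int_sum => [|j _].
  by apply: eq_bigr => j _; rewrite (cube_marginal j (bdg j)).
by apply: bmeas_Rintegrable; exact: (bmeas_tnth j (bdg j)).
Qed.
End cube_family.

(** * Complexity and spectral mass *)

Section bar_series.
Variables (R : realType) (lam : nat -> R) (k0 : nat).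
Hypothesis lam0 : forall k, 0 <= lam k.

Lemma sum_bar_eig n : (k0 <= n)%N ->
  \sum_(k < n.+1) lam k = lam k0 + \sum_(k < n) lam (skip k0 k).
Proof.
move=> kn; have k1 : (k0 < n.+1)%N by [].
rewrite (bigD1_ord (Ordinal k1))//=; congr (_ + _); apply: eq_bigr => k _.
by rewrite /skip /bump leqNgt; case: ltnP.
Qed.

Lemma sum_le_bar_eig n : \sum_(k < n) lam k <= lam k0 + \sum_(k < n) lam (skip k0 k).
Proof.
case: n => [|n]; first by rewrite !big_ord0 addr0.
have [kn|nk] := leqP k0 n.
  by rewrite sum_bar_eig// lerD2l big_ord_recr/= lerDl.
rewrite ler_wpDl// ler_sum// => k _; rewrite /skip.
by rewrite (leq_trans (ltn_ord k) nk).
Qed.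

Lemma seriesE (u : nat -> R) n : series u n = \sum_(k < n) u k.
Proof. by rewrite /series/= big_mkord. Qed.

Lemma series_bound_cvg (u : nat -> R) (B : R) : (forall k, 0 <= u k) ->
  (forall n, \sum_(k < n) u k <= B) -> cvgn (series u).
Proof.
move=> u0 uB; apply: nondecreasing_is_cvgn.
  by apply/nondecreasing_seqP => n; rewrite !seriesE big_ord_recr/= lerDl.
by exists B => _ [n _ <-]; rewrite seriesE.
Qed.

Lemma sum_le_sum_seq (u : nat -> R) n : (forall k, 0 <= u k) -> cvgn (series u) ->
  \sum_(k < n) u k <= sum_seq u.
Proof.
move=> u0 cu; have := @nondecreasing_cvgn_le _ (series u) _ cu n.
rewrite seriesE; apply; apply/nondecreasing_seqP => m.
by rewrite !seriesE big_ord_recr/= lerDl.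
Qed.

Lemma sum_seq_bar : cvgn (series lam) ->
  cvgn (series (fun k => lam (skip k0 k))) /\
  sum_seq lam = lam k0 + sum_seq (fun k => lam (skip k0 k)).
Proof.
move=> cl; set b := fun k => lam (skip k0 k).
have E n : (k0 <= n)%N -> series b n = series lam n.+1 - lam k0.
  by move=> kn; rewrite !seriesE sum_bar_eig// addrC addKr.
have cb : series b n @[n --> \oo] --> sum_seq lam - lam k0.
  have c1 : (series lam n.+1 - lam k0) @[n --> \oo] --> sum_seq lam - lam k0.
    apply: cvgB; last exact: cvg_cst.
    by rewrite (cvg_shiftS (series lam)).
  apply: cvg_trans c1; apply: near_eq_cvg; exists k0 => // n /= kn.
  by rewrite E.
split; first by apply/cvg_ex; eexists; exact: cb.
by rewrite /sum_seq (cvg_lim _ cb)//; rewrite addrC subrK.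
Qed.
End bar_series.

Lemma reindex_enum_val (R : nmodType) (I : finType) (S : pred I) (F : I -> R) :
  \sum_(i < #|I| | S (enum_val i)) F (enum_val i) = \sum_(x | S x) F x.
Proof.
by rewrite [RHS](reindex_onto (fun i : 'I_#|I| => enum_val i) enum_rank)//=;
  [apply: eq_bigl => i; rewrite enum_valK eqxx andbT|move=> x _; exact: enum_rankK].
Qed.

Section rank_n_error.
Variable R : realType.
Notation U := (measurableTypeR R).
Notation cube := (@cube_leb R).
Variables (d : nat).
Variables (K : nat -> R -> R -> R) (lam : nat -> nat -> R)
  (psi : nat -> nat -> U -> R) (k0 : nat -> nat).
Hypothesis cK : forall j, {within [set` `[0%R, 1%R]] `*` [set` `[0%R, 1%R]],
     continuous (fun ts : R * R => K j ts.1 ts.2)}.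
Hypothesis sK : forall j t s, K j t s = K j s t.
Hypothesis eK : forall j, eigen_system (K j) (lam j) (psi j).
Hypothesis basic : forall j, {ae unit_leb, forall t, psi j (k0 j) t = 1}.
Hypothesis d0 : (0 < d)%N.
Context dO (O : measurableType dO) (P : probability O R).
Variable Y : d.-tuple U -> O -> R.
Hypothesis fY : L2_random_field P Y.
Hypothesis zY : zero_mean_process P (@unit_cube R d) Y.
Hypothesis covY : forall t u, unit_cube t -> unit_cube u ->
  cov_fun P Y t u = \sum_(j < d) K j (tnth t j) (tnth u j).

Let C := Ksum K (d := d).

Lemma field_sqint t : unit_cube t -> sqint P (Y t).
Proof. by move=> ct; apply/Lfun_sqint; have [] := zY ct. Qed.

Lemma field_cov t u : unit_cube t -> unit_cube u -> \int[P]_w (Y t w * Y u w) = C t u.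
Proof.
move=> ct cu; have := covY ct cu.
have [Lt Et] := zY ct; have [Lu Eu] := zY cu.
have L1 t' : unit_cube t' -> Y t' \in Lfun P 1.
  by move=> ct'; apply/Lfun1_integrable/sqint_Rintegrable/field_sqint.
rewrite /cov_fun covarianceE; [|exact: L1..|]; last exact: Lfun2_mul_Lfun1.
rewrite Et Eu mul0e sube0 unlock => E.
transitivity (\sum_(j < d) K j (tnth t j) (tnth u j)); first exact: E.
apply: eq_bigr => j _; rewrite /Kclamp !clamp_id//.
- by have := cu j; rewrite in_itv.
- by have := ct j; rewrite in_itv.
Qed.

Lemma field_path_sqint : {ae P, forall w, sqint (cube d) (Y ^~ w)}.
Proof. by have [_ H] := fY; apply: filterS H => w /Lfun_sqint. Qed.

Let mY : measurable_fun setT (fun z : d.-tuple U * O => Y z.1 z.2) := fY.1.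

Section fixed_M.
Variable M : nat.
Notation idx := (option ('I_d * 'I_M)).
Notation cube_eigval := (cube_eigval (d := d) (M := M) lam k0).
Notation cube_eigfun := (cube_eigfun (d := d) (M := M) K lam psi k0).

Lemma cube_eigval_ge0 i : 0 <= cube_eigval i.
Proof.
case: i => [[j k]|] /=; first exact: eigen_ge0 (eK j) _.
by apply: sumr_ge0 => j _; exact: eigen_ge0 (eK j) _.
Qed.

Let e (i : 'I_#|{: idx}|) := cube_eigfun (enum_val i).
Let v (i : 'I_#|{: idx}|) := cube_eigval (enum_val i).
Let be i : bmeas (e i). Proof. exact: cube_eigfun_bmeas. Qed.
Let oe i j : v i != 0 -> v j != 0 -> \int[cube d]_t (e i t * e j t) = (i == j)%:R.
Proof. by move=> vi vj; rewrite cube_eigfun_orthonormal// (inj_eq enum_val_inj). Qed.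
Let ze i : v i = 0 -> e i = cst 0. Proof. exact: cube_eigfun_zero. Qed.
Let ee i : {ae cube d, forall t, \int[cube d]_u (C t u * e i u) = v i * e i t}.
Proof. exact: cube_eigfun_eigen. Qed.

Lemma eigen_truncation_error (S : pred idx) :
  mean_sq_dist P Y (fun t w => \sum_(i | S i) inner (Y ^~ w) (cube_eigfun i) * cube_eigfun i t) =
  (\int[cube d]_t C t t - \sum_(i | S i) cube_eigval i)%:E.
Proof.
rewrite -(reindex_enum_val S cube_eigval).
have := eigen_projection_error mY (@ae_unit_cube R d) field_sqint (Ksum_bker d cK) field_cov field_path_sqint
  be oe ze ee (fun i => S (enum_val i)).
move=> <-; rewrite /mean_sq_dist; apply: eq_integral => w _; apply: eq_integral => t _.
rewrite -(reindex_enum_val S (fun i => inner (Y ^~ w) (cube_eigfun i) * cube_eigfun i t)).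
by [].
Qed.

Lemma rank_n_error_ge n Z : approximants Y n Z ->
  exists p : idx -> R, [/\ forall i, 0 <= p i <= 1, \sum_i p i <= n%:R &
    ((\sum_i cube_eigval i * (1 - p i))%:E <= mean_sq_dist P Y Z)%E].
Proof.
move=> [ps [Lps ->]].
have lps m : sqint (cube d) (ps m) by apply/Lfun_sqint/Lps.
have [p [p01 pn pe]] := rank_error_ge mY (@ae_unit_cube R d) field_sqint (Ksum_bker d cK) field_cov field_path_sqint
  be oe ze ee lps.
exists (fun i => p (enum_rank i)); split => //.
  by rewrite -(reindex_enum_val xpredT)/=; under eq_bigr do rewrite enum_valK.
rewrite -(reindex_enum_val xpredT)/=; under eq_bigr do rewrite enum_valK.
exact: pe.
Qed.

(** The truncation error is non-negative. This is what makes the series of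
    eigenvalues converge. *)
Lemma sum_cube_eigval_le_trace : \sum_i cube_eigval i <= \int[cube d]_t C t t.
Proof.
rewrite -subr_ge0 -lee_fin.
have <- := eigen_truncation_error xpredT.
by apply: integral_ge0 => w _; apply: integral_ge0 => t _; rewrite lee_fin sqr_ge0.
Qed.

Lemma sum_idx (f : idx -> R) :
  \sum_i f i = f None + \sum_(j < d) \sum_(k < M) f (Some (j, k)).
Proof.
rewrite pair_bigA /= (bigD1 None)//=; congr (_ + _).
rewrite (reindex_omap (fun p : 'I_d * 'I_M => Some p) id)/=; last by case.
by apply: eq_big => [p|[j k]]//; rewrite eqxx.
Qed.

Lemma sum_idx_cond (S : pred idx) (g : idx -> R) :
  \sum_(i | S i) g i = (if S None then g None else 0) +
    \sum_(j < d) \sum_(k < M) (if S (Some (j, k)) then g (Some (j, k)) else 0).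
Proof. by rewrite big_mkcond/= (sum_idx (fun i => if S i then g i else 0)). Qed.
End fixed_M.

Notation bar j k := (lam j (skip (k0 j) k)).
Notation tr := (\int[cube d]_t C t t).
Notation trS := (\sum_(j < d) sum_seq (lam j)).
Notation barS := (\sum_(j < d) sum_seq (fun k => bar j k)).

Let l0 j k : 0 <= lam j k := eigen_ge0 (eK j) k.

Lemma bar_partial_le_trace M :
  \sum_(j < d) lam j (k0 j) + \sum_(j < d) \sum_(k < M) bar j k <= tr.
Proof. by have := sum_cube_eigval_le_trace M; rewrite sum_idx. Qed.

Lemma lam_cvg (j : 'I_d) : cvgn (series (lam j)).
Proof.
apply: (series_bound_cvg (B := tr)) => // n.
apply: le_trans (bar_partial_le_trace n).
apply: (le_trans (sum_le_bar_eig (k0 j) (l0 j) n)).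
rewrite (bigD1 j)//= [X in _ <= _ + X](bigD1 j)//= lerD// lerDl sumr_ge0// => i _.
by apply: sumr_ge0 => k _.
Qed.

Lemma bar_cvg (j : 'I_d) : cvgn (series (fun k => bar j k)).
Proof. by have [] := sum_seq_bar (k0 j) (@lam_cvg j). Qed.

Lemma sum_eigenvalues_split : trS = \sum_(j < d) lam j (k0 j) + barS.
Proof.
rewrite -big_split/=; apply: eq_bigr => j _.
by have [] := sum_seq_bar (k0 j) (@lam_cvg j).
Qed.

Lemma bar_double_cvg (f : nat -> nat -> R) : (forall j : 'I_d, cvgn (series (f j))) ->
  \sum_(j < d) \sum_(k < M) f j k @[M --> \oo] --> \sum_(j < d) sum_seq (f j).
Proof.
move=> cf; apply: cvg_bigsum => j; have := cf j; rewrite /sum_seq.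
by under [X in _ -> X @ _ --> _]eq_fun do rewrite -seriesE.
Qed.

(** One inequality compares traces coordinate by coordinate
    (trace_le_sum_eigenvalues), the other lets the truncation level M grow
    in Bessel's inequality. *)
Lemma trace_eq_sum_eigenvalues : tr = trS.
Proof.
apply/eqP; rewrite eq_le; apply/andP; split.
  rewrite trace_Ksum//; apply: ler_sum => j _; apply/ler_addgt0Pr => e e0.
  have [n Hn] := trace_le_sum_eigenvalues (@cK j) (sK j) (eK j) e0.
  by apply: (le_trans Hn); rewrite lerD2r; apply: sum_le_sum_seq => //; exact: lam_cvg.
rewrite sum_eigenvalues_split.
have c1 : \sum_(j < d) lam j (k0 j) + \sum_(j < d) \sum_(k < M) bar j k
    @[M --> \oo] --> \sum_(j < d) lam j (k0 j) + barS.
  apply: cvgD; first exact: cvg_cst.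
  by apply: (bar_double_cvg (f := fun j k => bar j k)) => j; exact: bar_cvg.
by apply: (cvgr_to_le c1); apply: nearW => M; exact: bar_partial_le_trace.
Qed.

Lemma sum_k0_gt0 : 0 < \sum_(j < d) lam j (k0 j).
Proof.
rewrite (bigD1 (Ordinal d0))//= ltr_wpDr//; first exact: sumr_ge0.
by rewrite lt_neqAle eq_sym (lam_k0_neq0 (eK 0%N) (@basic 0%N)) l0.
Qed.

Lemma bar_ge0 : 0 <= barS.
Proof.
apply: sumr_ge0 => j _; have := sum_le_sum_seq 0 (fun k => l0 j _) (@bar_cvg j).
by rewrite big_ord0.
Qed.

Lemma sum_eigenvalues_gt0 : 0 < trS.
Proof. by rewrite sum_eigenvalues_split ltr_pwDl ?sum_k0_gt0 ?bar_ge0. Qed.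

Lemma poweR_half (r : R) : 0 <= r -> (r%:E `^ 2^-1)%E = (Num.sqrt r)%:E.
Proof. by move=> r0; rewrite poweR_EFin powR12_sqrt. Qed.

(** The only approximant of rank 0 is zero, and the mean squared norm of
    the field is the trace. *)
Lemma approx_error0 : approx_error P Y 0 = (Num.sqrt trS)%:E.
Proof.
rewrite /approx_error.
have -> : [set (mean_sq_dist P Y Z `^ 2^-1)%E | Z in approximants Y 0] =
    [set (Num.sqrt trS)%:E].
  have E Z : approximants Y 0 Z -> (mean_sq_dist P Y Z `^ 2^-1)%E = (Num.sqrt trS)%:E.
    move=> [ps [_ ->]]; rewrite -poweR_half ?ltW ?sum_eigenvalues_gt0//; congr (_ `^ _)%E.
    have := @eigen_truncation_error 0 pred0; rewrite big_pred0 // subr0 trace_eq_sum_eigenvalues => <-.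
    congr (mean_sq_dist P Y _); apply/funext => t; apply/funext => w.
    by rewrite big_ord0 big_pred0.
  apply/seteqP; split => x /=; first by move=> [Z HZ <-]; exact: E.
  move=> ->; pose ps (m : 'I_0) (t : d.-tuple U) : R := 0.
  exists (fun t w => \sum_(m < 0) inner (Y ^~ w) (ps m) * ps m t); last by rewrite E//; exists ps; split => // -[].
  by exists ps; split => // -[].
exact: ereal_inf1.
Qed.

(** Projection onto the eigenfunctions selected by S; the list is padded
    with zero functions to length n. *)
Lemma approx_error_le M (S : pred (option ('I_d * 'I_M))) n : (#|S| <= n)%N ->
  (approx_error P Y n <= (Num.sqrt (trS - \sum_(i | S i) cube_eigval (d := d) lam k0 i))%:E)%E.
Proof.
move=> Sn; have := eigen_truncation_error S; rewrite trace_eq_sum_eigenvalues.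
set Z := (fun t w => _) => HZ.
have ge0 : 0 <= trS - \sum_(i | S i) cube_eigval (d := d) lam k0 i.
  rewrite -lee_fin -HZ.
  by apply: integral_ge0 => w _; apply: integral_ge0 => t _; rewrite lee_fin sqr_ge0.
rewrite -poweR_half// -HZ; apply: ereal_inf_lbound; exists Z => //.
pose ps (m : 'I_n) : d.-tuple U -> R := if (m < size (enum S))%N
  then cube_eigfun K lam psi k0 (nth None (enum S) m) else cst 0.
exists ps; split.
  move=> m; apply/Lfun_sqint/bmeas_sqint; rewrite /ps; case: ifP => _; last exact: bmeas_cst.
  exact: cube_eigfun_bmeas.
apply/funext => t; apply/funext => w; rewrite /Z.
rewrite -big_enum/= (big_nth None) big_mkord.
rewrite (big_ord_widen n (fun m => inner (Y ^~ w) (cube_eigfun K lam psi k0 (nth None (enum S) m))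
  * cube_eigfun K lam psi k0 (nth None (enum S) m) t)); last by rewrite -cardE.
rewrite big_mkcond/=; apply: eq_bigr => m _; rewrite /ps; case: ifP => // _.
by rewrite mulr0.
Qed.

Definition heavy tau := \sum_(j < d) sum_seq (fun k => bar j k * (tau <= bar j k)%R%:R).

Let f tau j k := bar j k * (tau <= bar j k)%R%:R.
Let f0 tau j k : 0 <= f tau j k. Proof. by rewrite mulr_ge0. Qed.
Let fb tau j k : f tau j k <= bar j k.
Proof. by rewrite /f ler_piMr// lern1 leq_b1. Qed.

Lemma heavy_cvg tau (j : 'I_d) : cvgn (series (f tau j)).
Proof.
apply: (series_bound_cvg (B := sum_seq (fun k => bar j k))) => // n'.
apply: le_trans (sum_le_sum_seq n' (fun k => l0 j _) (@bar_cvg j)).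
exact: ler_sum.
Qed.

(** With the weights p of rank_n_error_ge, the error is at least sum v (1
    - p), so the total mass is at most the error plus sum v p. In the
    latter sum each eigenvalue v >= tau contributes at most v, the
    constant contributes at most its eigenvalue, and the other terms
    contribute at most tau p, with sum p <= n. *)
Lemma admissible_ge eps n tau : 0 <= eps -> 0 <= tau ->
  (approx_error P Y n <= eps%:E * approx_error P Y 0)%E ->
  barS <= eps ^+ 2 * trS + heavy tau + n%:R * tau.
Proof.
move=> eps0 tau0; rewrite approx_error0 -EFinM => He.
(* The estimate is proved for the first M eigenvalues of each process; M
   tends to infinity at the end. *)
have key M : \sum_(j < d) \sum_(k < M) bar j k <=
    eps ^+ 2 * trS + heavy tau + n%:R * tau.
  (* The infimum that defines approx_error need not be attained, hence the
     margin dl. *)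
  have est dl : 0 < dl -> \sum_(j < d) \sum_(k < M) bar j k <=
      (eps * Num.sqrt trS + dl) ^+ 2 + heavy tau + n%:R * tau.
    move=> dl0.
    have : (approx_error P Y n < (eps * Num.sqrt trS + dl)%:E)%E.
      by apply: (le_lt_trans He); rewrite lte_fin ltrDl.
    move=> /ereal_inf_lt [_ [Z HZ <-]] Zlt.
    have [p [p01 pn pe]] := rank_n_error_ge M HZ.
    have {pe Zlt}pe : \sum_(i : option ('I_d * 'I_M)) cube_eigval (d := d) lam k0 i * (1 - p i) <=
        (eps * Num.sqrt trS + dl) ^+ 2.
      set X := (\sum_i _) in pe *.
      have X0 : 0 <= X.
        apply: sumr_ge0 => i _; rewrite mulr_ge0 ?cube_eigval_ge0// subr_ge0.
        by case/andP: (p01 i).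
      have c0 : 0 <= eps * Num.sqrt trS + dl.
        by rewrite addr_ge0 ?(ltW dl0)// mulr_ge0// sqrtr_ge0.
      rewrite -[X]sqr_sqrtr// lerXn2r// ?nnegrE ?sqrtr_ge0//.
      rewrite -lee_fin -poweR_half//; apply: le_trans (ltW Zlt).
      apply: gt0_ler_poweR => //; rewrite ?in_itv/= ?lee_fin ?leey ?X0 ?andbT//.
      by rewrite (le_trans _ pe)// lee_fin.
    have split_p : \sum_(i : option ('I_d * 'I_M)) cube_eigval (d := d) lam k0 i * p i <=
        \sum_(j < d) lam j (k0 j) + heavy tau + n%:R * tau.
      apply: (@le_trans _ _ (\sum_(i : option ('I_d * 'I_M)) (cube_eigval (d := d) lam k0 i *
          (if i is Some (j, k) then (tau <= bar j k)%R%:R else 1) + p i * tau))).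
        apply: ler_sum => i _; have /andP[p0 p1] := p01 i.
        have v0 := cube_eigval_ge0 i.
        case: i p0 p1 v0 => [[j k]|] p0 p1 v0 /=.
          case: (leP tau (lam j (skip (k0 j) k))) => h; first by rewrite mulr1 ler_wpDr ?mulr_ge0// ler_piMr.
          by rewrite mulr0 add0r mulrC ler_wpM2l// ltW.
        by rewrite mulr1 ler_wpDr ?mulr_ge0// ler_piMr.
      rewrite big_split/= -mulr_suml; apply: lerD; last by rewrite ler_wpM2r.
      rewrite sum_idx/= mulr1 lerD2l /heavy; apply: ler_sum => j _.
      exact: (sum_le_sum_seq M (f0 tau j) (@heavy_cvg tau j)).
    have h3 : \sum_(i : option ('I_d * 'I_M)) cube_eigval (d := d) lam k0 i =
        \sum_(j < d) lam j (k0 j) + \sum_(j < d) \sum_(k < M) bar j k.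
      exact: sum_idx.
    have h4 : \sum_(i : option ('I_d * 'I_M)) cube_eigval (d := d) lam k0 i =
      \sum_(i : option ('I_d * 'I_M)) cube_eigval (d := d) lam k0 i * (1 - p i) +
      \sum_(i : option ('I_d * 'I_M)) cube_eigval (d := d) lam k0 i * p i.
      by rewrite -big_split/=; apply: eq_bigr => i _; rewrite mulrBr mulr1 subrK.
    have := lerD pe split_p; rewrite -h4 h3.
    by rewrite addrCA -!addrA lerD2l addrCA.
  pose q := Num.sqrt trS; have q2 : q ^+ 2 = trS by rewrite sqr_sqrtr// ltW// sum_eigenvalues_gt0.
  have c1 : (eps * q + n'.+1%:R^-1) ^+ 2 + heavy tau + n%:R * tau
      @[n' --> \oo] --> (eps * q + 0) ^+ 2 + heavy tau + n%:R * tau.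
    apply: cvgD; last exact: cvg_cst.
    apply: cvgD; last exact: cvg_cst.
    apply: (@cvg_comp _ _ _ (fun n' => eps * q + n'.+1%:R^-1) (fun z : R => z ^+ 2)).
      apply: cvgD; [exact: cvg_cst|exact: cvg_harmonic].
    exact: exprn_continuous.
  rewrite addr0 exprMn q2 in c1.
  by apply: (cvgr_to_ge c1); apply: nearW => n'; exact: est.
have c2 := bar_double_cvg (f := fun j k => bar j k) bar_cvg.
by apply: (cvgr_to_le c2); apply: nearW => M; exact: key.
Qed.

Lemma bar_le_barS (j : 'I_d) k : bar j k <= barS.
Proof.
rewrite (bigD1 j)//= ler_wpDr//.
  apply: sumr_ge0 => i _; have := sum_le_sum_seq 0 (fun k => l0 i _) (@bar_cvg i).
  by rewrite big_ord0.
apply: le_trans (sum_le_sum_seq k.+1 (fun k => l0 j _) (@bar_cvg j)).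
by rewrite big_ord_recr/= lerDr sumr_ge0.
Qed.

(** There is some eigenvalue at least tau, and no eigenvalue exceeds the
    total mass. *)
Lemma threshold_le tau : 0 < heavy tau -> tau <= barS.
Proof.
move=> G0; rewrite leNgt; apply/negP => Lt; move: G0; rewrite /heavy big1 ?ltxx// => j _.
have -> : (fun k => bar j k * (tau <= bar j k)%R%:R) = fun=> 0.
  apply/funext => k; rewrite (leNgt tau) (le_lt_trans (bar_le_barS j k) Lt)/= mulr0//.
apply: cvg_lim => //; have -> : series (fun=> 0 : R) = fun=> 0.
  by apply/funext => n; rewrite seriesE big1.
exact: cvg_cst.
Qed.

Lemma rank_admissible M (S : pred (option ('I_d * 'I_M))) n eps : 0 <= eps ->
  (0 < n)%N -> (#|S| <= n)%N ->
  trS - \sum_(i | S i) cube_eigval (d := d) lam k0 i <= eps ^+ 2 * trS ->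
  admissible_rank P Y eps n.
Proof.
move=> eps0 n0 Sn H; split => //; apply: (le_trans (approx_error_le Sn)).
rewrite approx_error0 -EFinM lee_fin -{1}(ger0_norm eps0) -sqrtr_sqr -sqrtrM ?sqr_ge0//.
exact: ler_wsqrtr.
Qed.

(** Some rank is admissible, because finitely many eigenfunctions carry
    all but an arbitrarily small part of the trace. *)
Lemma approx_complexityP eps : 0 < eps ->
  admissible_rank P Y eps (approx_complexity P Y eps) /\
  forall m, admissible_rank P Y eps m -> (approx_complexity P Y eps <= m)%N.
Proof.
move=> eps0; have e0 : 0 < eps ^+ 2 * trS by rewrite mulr_gt0 ?sum_eigenvalues_gt0// exprn_gt0.
have c1 : \sum_(j < d) \sum_(k < M) bar j k @[M --> \oo] --> barS.
  by apply: (bar_double_cvg (f := fun j k => bar j k)) => j; exact: bar_cvg.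
have [M _ /(_ M (leqnn _)) HM] : \forall M \near \oo,
    barS - eps ^+ 2 * trS < \sum_(j < d) \sum_(k < M) bar j k.
  by apply: (cvgr_gt _ c1); rewrite ltrBlDr ltrDl.
have Hex : exists n, `[< admissible_rank P Y eps n >].
  exists #|{: option ('I_d * 'I_M)}|; apply/asboolP.
  apply: (@rank_admissible M predT) => //; first exact: ltW.
    by apply/card_gt0P; exists None.
  have -> : \sum_(i | predT i) cube_eigval (d := d) (M := M) lam k0 i =
      \sum_(j < d) lam j (k0 j) + \sum_(j < d) \sum_(k < M) bar j k by exact: sum_idx.
  move: HM; rewrite ltrBlDr -ltrBlDl => /ltW; apply: le_trans.
  by rewrite {1}sum_eigenvalues_split opprD addrACA subrr add0r.
have [m /asboolP Pm Hm] := ex_minnP Hex.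
have : [set n | admissible_rank P Y eps n /\
    forall m, admissible_rank P Y eps m -> (n <= m)%N] m.
  by split => // i Hi; apply: Hm; exact/asboolP.
by move=> /(xgetI 0%N).
Qed.

Lemma approx_complexity_ge eps tau : 0 < eps -> 0 <= tau ->
  barS <= eps ^+ 2 * trS + heavy tau + (approx_complexity P Y eps)%:R * tau.
Proof.
move=> eps0 tau0; have [[_ H] _] := approx_complexityP eps0.
exact: admissible_ge (ltW eps0) tau0 H.
Qed.

(** Approximate by the constant and the eigenfunctions with eigenvalue at
    least tau; there are at most barS / tau of these. *)
Lemma approx_complexity_le eps tau : 0 < eps -> 0 < tau ->
  barS - heavy tau < eps ^+ 2 * trS ->
  (approx_complexity P Y eps)%:R <= 1 + barS / tau.
Proof.
move=> eps0 tau0 H.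
have c1 : \sum_(j < d) \sum_(k < M) f tau j k @[M --> \oo] --> heavy tau.
  by apply: (bar_double_cvg (f := f tau)) => j; exact: heavy_cvg.
have [M _ /(_ M (leqnn _)) HM] : \forall M \near \oo,
    barS - eps ^+ 2 * trS < \sum_(j < d) \sum_(k < M) f tau j k.
  by apply: (cvgr_gt _ c1); rewrite ltrBlDr addrC -ltrBlDr.
pose S (i : option ('I_d * 'I_M)) := if i is Some (j, k) then tau <= bar j k else true.
have S0 : (0 < #|S|)%N by apply/card_gt0P; exists None.
have [_ /(_ #|S|) Hmin] := approx_complexityP eps0.
have SM : (approx_complexity P Y eps <= #|S|)%N.
  apply: Hmin; apply: (@rank_admissible M S) => //; first exact: ltW.
  rewrite sum_idx_cond/= {1}sum_eigenvalues_split opprD addrACA subrr add0r.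
  rewrite lerBlDr addrC -lerBlDr (le_trans (ltW HM))// le_eqVlt; apply/orP; left.
  apply/eqP; apply: eq_bigr => j _; apply: eq_bigr => k _; rewrite /f.
  by case: (tau <= _); rewrite ?mulr1 ?mulr0.
apply: (@le_trans _ _ #|S|%:R); first by rewrite ler_nat.
have -> : #|S|%:R = 1 + \sum_(j < d) \sum_(k < M) (tau <= bar j k)%R%:R :> R.
  rewrite -sum1_card natr_sum (sum_idx_cond (fun i => i \in S)) unfold_in/=; congr (_ + _).
  by apply: eq_bigr => j _; apply: eq_bigr => k _; rewrite unfold_in/=; case: (tau <= _).
rewrite lerD2l ler_pdivlMr// mulr_suml; apply: ler_sum => j _.
apply: le_trans (sum_le_sum_seq M (fun k => l0 j _) (@bar_cvg j)).
rewrite mulr_suml; apply: ler_sum => k _.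
by case: (leP tau (lam j (skip (k0 j) k))) => h; rewrite ?mul1r ?mul0r.
Qed.
End rank_n_error.

(** * Distribution functions and quantiles *)

Section cumulative_facts.
Variable R : realType.
Variable W : cumulativeBounded (0 : R) (1 : R).

Lemma cdf_ndec (x y : R) : x <= y -> W x <= W y.
Proof. exact: cumulative_is_nondecreasing. Qed.

Lemma cdf_left_cvg (x : R) : cvg (W z @[z --> x^'-]).
Proof.
apply: nondecreasing_at_left_is_cvgr.
  by near=> z => u v _ _; exact: cdf_ndec.
near=> z; exists (W x) => _ /= [u uzx <-]; apply: cdf_ndec.
by move: uzx; rewrite in_itv/= => /andP[_ /ltW].
Unshelve. all: by end_near. Qed.

Lemma left_limit_le (x : R) : left_limit W x <= W x.
Proof.
apply: limr_le; first exact: cdf_left_cvg.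
near=> z; apply: cdf_ndec; near: z; exact: nbhs_left_le.
Unshelve. all: by end_near. Qed.

Lemma le_left_limit (z x : R) : z < x -> W z <= left_limit W x.
Proof.
move=> zx; apply: limr_ge; first exact: cdf_left_cvg.
near=> u; apply: cdf_ndec; apply: ltW; near: u; exact: nbhs_left_gt.
Unshelve. all: by end_near. Qed.

Lemma left_limit_continuous (x : R) : {for x, continuous W} -> left_limit W x = W x.
Proof. by move=> cW; apply: cvg_lim => //; have [] := (left_right_continuousP W x).2 cW. Qed.

(** A monotone function has countably many discontinuities, and an
    interval is not countable. *)
Lemma cdf_continuity_dense (p r : R) : p < r ->
  exists x, p < x < r /\ {for x, continuous W}.
Proof.
move=> pr; apply: contrapT => /forallNP H.
have cD : countable [set x | x \in (`]p, r[) /\ discontinuity W x].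
  by apply: discontinuity_countable => x y _ _; exact: cdf_ndec.
have sub : `]p, r[%classic `<=` [set x | x \in (`]p, r[) /\ discontinuity W x].
  move=> x /= xpr; split => //.
  have rc : W z @[z --> x^'+] --> W x by exact: cumulative_is_right_continuous.
  have lc := @cdf_left_cvg x; split => //; first by apply/cvg_ex; exists (W x).
  rewrite (cvg_lim _ rc)//; apply/eqP => e.
  apply: (H x); split; first by move: xpr; rewrite in_itv.
  by apply/left_right_continuousP; split => //; rewrite -e.
have := countable_lebesgue_measure0 (sub_countable (subset_card_le sub) cD).
rewrite lebesgue_measure_itv/= lte_fin pr -EFinB => -[] /eqP.
by rewrite subr_eq0 => /eqP rp; rewrite rp ltxx in pr.
Qed.

Lemma cdf_lt_near (e : R) : 0 < e -> exists x, W x < e.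
Proof.
move=> e0; have [x [_ Hx]] := cvgr_lt _ (cumulativeNy W) e e0.
by exists (x - 1); apply: Hx; rewrite ltrBlDr ltrDl.
Qed.

Lemma cdf_gt_near (e : R) : e < 1 -> exists x, e < W x.
Proof.
move=> e1; have [x [_ Hx]] := cvgr_gt _ (cumulativey W) e e1.
by exists (x + 1); apply: Hx; rewrite ltrDl.
Qed.
End cumulative_facts.

Section quantile_facts.
Variable R : realType.
Variable F : R -> R.
Hypothesis ndF : forall x y, x <= y -> F x <= F y.
Hypothesis F0 : forall e, 0 < e -> exists x, F x < e.
Hypothesis F1 : forall e, e < 1 -> exists x, e < F x.

Lemma quantile_has_inf y : 0 < y < 1 -> has_inf [set x | y <= F x].
Proof.
move=> /andP[y0 y1]; split.
  by have [x Fx] := F1 y1; exists x; exact: ltW.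
have [x Fx] := F0 y0; exists x => z /= yz; rewrite leNgt; apply/negP => zx.
by have := le_lt_trans (le_trans yz (ndF (ltW zx))) Fx; rewrite ltxx.
Qed.

Lemma lt_quantile y x : 0 < y < 1 -> x < quantile F y -> F x < y.
Proof.
move=> level_in01 xq; rewrite ltNge; apply/negP => yF.
have : quantile F y <= x by apply: ge_inf => //; have [] := quantile_has_inf level_in01.
by rewrite leNgt xq.
Qed.

(** F might equal y on an interval to the right of the quantile; then the
    quantile function would jump at y, which continuity excludes. *)
Lemma gt_quantile y x : 0 < y < 1 -> {for y, continuous (quantile F)} ->
  quantile F y < x -> y < F x.
Proof.
move=> /andP[y0 y1] cq qx.
(* By continuity the quantile stays below x at some level above y. *)
have [y' [yy' y'1 qy']] : exists y', [/\ y < y', y' < 1 & quantile F y' < x].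
  have H : \forall z \near y^'+, quantile F z < x.
    by rewrite near_withinE; apply: filterS (cvgr_lt _ cq x qx) => z qz _.
  near y^'+ => z; exists z; split.
  - by near: z; exact: nbhs_right_gt.
  - by near: z; exact: nbhs_right_lt.
  - by near: z.
have y'01 : 0 < y' < 1 by rewrite (lt_trans y0 yy').
have [z /= Fz zx] : exists2 z, y' <= F z & z < x.
  exact: (inf_lt (quantile_has_inf y'01).1).
by rewrite (lt_le_trans yy')// (le_trans Fz)// ndF// ltW.
Unshelve. all: by end_near. Qed.
End quantile_facts.

(** * Logarithmic asymptotics of the complexity *)

Section asymptotics.
Variable R : realType.
Variables (v : nat -> nat -> R) (l a b : nat -> R).
Hypothesis v0 : forall j k, 0 <= v j k.
Hypothesis vS : forall j, nonincreasing_seq (v j).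
Hypothesis cv : forall j, cvgn (series (v j)).

Notation Lam j := (sum_seq (v j)).
Notation L d := (\sum_(j < d) Lam j).
Notation A j x := (sum_seq (fun k => v j k * (- ln (v j k) - l j <= x)%R%:R)).
Notation G d tau := (\sum_(j < d) sum_seq (fun k => v j k * (tau <= v j k)%R%:R)).
Notation H d x := (\sum_(j < d) Lam j * (l j - a d <= x * b d)%R%:R).

Lemma sum_seq_le (f g : nat -> R) : (forall k, 0 <= f k) -> (forall k, f k <= g k) ->
  cvgn (series g) -> 0 <= sum_seq f <= sum_seq g.
Proof.
move=> f0 fg cg; have g0 k : 0 <= g k by exact: le_trans (fg k).
have cf : cvgn (series f).
  apply: (series_bound_cvg (B := sum_seq g)) => // n.
  by apply: le_trans (sum_le_sum_seq n g0 cg); exact: ler_sum.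
apply/andP; split.
  by apply: limr_ge => //; apply: nearW => n; rewrite seriesE sumr_ge0.
by apply: limr_le => //; apply: nearW => n; rewrite seriesE;
  apply: le_trans (sum_le_sum_seq n g0 cg); exact: ler_sum.
Qed.

Lemma Lam_ge0 j : 0 <= Lam j.
Proof. by have /andP[] := sum_seq_le (v0 j) (fun k => lexx _) (@cv j). Qed.

Lemma centered_mass_le j x : 0 <= A j x <= Lam j.
Proof.
apply: sum_seq_le => // k; first by rewrite mulr_ge0.
by rewrite ler_piMr// lern1 leq_b1.
Qed.

Lemma cvg_cut j (P : pred R) : cvgn (series (fun k => v j k * (P (v j k))%:R)).
Proof.
apply: (series_bound_cvg (B := Lam j)) => [k|n]; first by rewrite mulr_ge0.
apply: le_trans (sum_le_sum_seq n (v0 j) (@cv j)); apply: ler_sum => k _.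
by rewrite ler_piMr// lern1 leq_b1.
Qed.

Lemma centered_mass_ndec j x y : x <= y -> A j x <= A j y.
Proof.
move=> xy; suff /andP[] : 0 <= A j x <= A j y by [].
apply: sum_seq_le => [k|k|]; first by rewrite mulr_ge0.
- rewrite ler_wpM2l// ler_nat.
  by case: (leP _ x) => // h; rewrite (le_trans h xy).
- exact: (@cvg_cut j (fun z : R => (- ln z - l j <= y)%R)).
Qed.

Lemma heavy_mass_expR d c : G d (expR (- c)) = \sum_(j < d) A j (c - l j).
Proof.
apply: eq_bigr => j _; congr sum_seq; apply/funext => k.
have [->|vk] := eqVneq (v j k) 0; first by rewrite !mul0r.
have vp : 0 < v j k by rewrite lt_neqAle eq_sym vk v0.
congr (_ * _%:R); rewrite lerD2r lerNl -(ler_expR (- c)) lnK//.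
Qed.

Lemma Lam_gt0_head j : 0 < Lam j -> 0 < v j 0%N.
Proof.
move=> Lp; rewrite lt_neqAle eq_sym v0 andbT; apply/eqP => vj; move: Lp.
have E : v j = fun=> 0.
  by apply/funext => k; apply/eqP; rewrite eq_le v0 andbT -vj; exact: vS.
rewrite E /sum_seq (_ : series _ = fun=> 0); last first.
  by apply/funext => n; rewrite seriesE big1.
by rewrite (cvg_lim _ (cvg_cst (0 : R)))// ltxx.
Qed.

(** The largest eigenvalue of the first d processes is bounded below once
    it includes one process with positive mass, so whatever dominates it
    in the sense of o tends to infinity. *)
Lemma total_mass_unbounded : (\forall j \near \oo, 0 < Lam j) ->
  (fun d => \big[Num.max/0]_(j < d) v j 0%N) =o_\oo (fun d => L d) ->
  forall B, \forall d \near \oo, B <= L d.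
Proof.
move=> [J _ HJ] /eqoP ho B.
have c0 : 0 < v J 0%N by apply: Lam_gt0_head; apply: HJ => /=.
pose e := v J 0%N / (`|B| + 1).
have e0 : 0 < e by rewrite divr_gt0// ltr_wpDl.
near=> d; have Jd : (J < d)%N by near: d; exact: nbhs_infty_gt.
have Ld0 : 0 <= L d by apply: sumr_ge0 => j _; exact: Lam_ge0.
have vM : v J 0%N <= \big[Num.max/0]_(j < d) v j 0%N.
  exact: (le_bigmax _ (fun j : 'I_d => v j 0%N) (Ordinal Jd)).
have : `|\big[Num.max/0]_(j < d) v j 0%N| <= e * `|L d| by near: d; exact: ho.
rewrite (ger0_norm Ld0) => /(le_trans (ler_norm _)) /(le_trans vM).
rewrite /e mulrAC ler_pdivlMr ?ltr_wpDl// ler_pM2l// => h.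
by rewrite (le_trans (ler_norm B))// (le_trans _ h)// lerDl.
Unshelve. all: by end_near. Qed.

Variable U : cumulativeBounded (0 : R) (1 : R).
Hypothesis Lam_gt0 : \forall j \near \oo, 0 < Lam j.
Hypothesis Linf : forall B, \forall d \near \oo, B <= L d.
Hypothesis tight : forall x, {for x, continuous U} ->
  (Lam j)^-1 * A j x @[j --> \oo] --> U x.
Hypothesis b0 : forall d, (0 < d)%N -> 0 < b d.
Hypothesis binf : b d @[d --> \oo] --> +oo.

(** The limit law U is a probability distribution, so almost all its mass
    lies in a bounded interval. *)
Lemma tail_tight (e : R) : 0 < e -> exists T, 0 <= T /\
  \forall j \near \oo, A j (- T) <= e * Lam j /\ (1 - e) * Lam j <= A j T.
Proof.
move=> e0.
(* The limit in the hypothesis is known at continuity points of U only, so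
   the two cut points are moved to such points. *)
have [x1 Hx1] := cdf_lt_near U e0.
have [y1 [/andP[_ yx1] cy1]] := cdf_continuity_dense U (p := x1 - 1) (r := x1)
  (ltac:(by rewrite ltrBlDr ltrDl)).
have [x2 Hx2] := cdf_gt_near U (e := 1 - e) (ltac:(by rewrite ltrBlDr ltrDl)).
have [y2 [/andP[xy2 _] cy2]] := cdf_continuity_dense U (p := x2) (r := x2 + 1)
  (ltac:(by rewrite ltrDl)).
have U1 : U y1 < e by rewrite (le_lt_trans _ Hx1)// cdf_ndec// ltW.
have U2 : 1 - e < U y2 by rewrite (lt_le_trans Hx2)// cdf_ndec// ltW.
exists (`|y1| + `|y2|); split; first exact: addr_ge0.
near=> j; have Lp : 0 < Lam j by near: j; exact: Lam_gt0.
have h1 : (Lam j)^-1 * A j y1 < e by near: j; exact: (cvgr_lt _ (tight cy1)).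
have h2 : 1 - e < (Lam j)^-1 * A j y2 by near: j; exact: (cvgr_gt _ (tight cy2)).
split.
- move: h1; rewrite mulrC ltr_pdivrMr// => /ltW; apply: le_trans.
  apply: centered_mass_ndec; have := ler_norm (- y1); rewrite normrN; have := normr_ge0 y2; lra.
- move: h2; rewrite mulrC ltr_pdivlMr// => /ltW /le_trans; apply.
  apply: centered_mass_ndec; have := ler_norm y2; have := normr_ge0 y1; lra.
Unshelve. all: by end_near. Qed.

(** In the j-th process nearly all the mass sits at eigenvalues with - ln
    v within T of l j, and T <= eta b d for large d. The finitely many j
    to which tail_tight does not apply carry a bounded mass, negligible
    against L d. *)
Lemma concentration (eta dl : R) : 0 < eta -> 0 < dl ->
  \forall d \near \oo, forall x,
    G d (expR (- (a d + x * b d))) <= H d (x + eta) + dl * L d /\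
    H d x <= G d (expR (- (a d + (x + eta) * b d))) + dl * L d.
Proof.
move=> eta0 dl0; have dl20 : 0 < dl / 2 by rewrite divr_gt0.
have [T [T0 [J _ HJ]]] := tail_tight dl20.
near=> d => x.
have Jd : (J <= d)%N by near: d; exact: nbhs_infty_ge.
have d0 : (0 < d)%N by near: d; exact: nbhs_infty_gt.
have bd := b0 d0.
have Tb : T <= eta * b d.
  rewrite mulrC -ler_pdivrMr//; near: d.
  by move/cvgryPge : binf; apply.
have LJ : L J <= dl / 2 * L d.
  by rewrite mulrC -ler_pdivrMr//; near: d; exact: Linf.
(* The mass of the processes j < J not covered by tail_tight. *)
have early : \sum_(j < d) Lam j * (j < J)%N%:R = L J.
  rewrite (big_ord_widen d (fun j => Lam j) Jd) [RHS]big_mkcond/=; apply: eq_bigr => j _.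
  by case: (j < J)%N; rewrite ?mulr1 ?mulr0.
have LdE : dl * L d = dl / 2 * L d + dl / 2 * L d by rewrite -mulrDl -splitr.
split; rewrite heavy_mass_expR.
- apply: (@le_trans _ _ (\sum_(j < d) (Lam j * (l j - a d <= (x + eta) * b d)%R%:R +
      (dl / 2 * Lam j + Lam j * (j < J)%N%:R)))); last first.
    rewrite !big_split/= lerD2l -mulr_sumr early LdE; exact: lerD.
  apply: ler_sum => j _; have /andP[A0 A1] := centered_mass_le j (a d + x * b d - l j).
  have Lj := Lam_ge0 j; have e0 : 0 <= dl / 2 * Lam j by rewrite mulr_ge0// ltW.
  have [jJ|Jj] := ltnP j J.
    by rewrite mulr1 addrA ler_wpDl// addr_ge0// mulr_ge0.
  rewrite mulr0 addr0; have [h|h] := leP (l j - a d) ((x + eta) * b d).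
    by rewrite mulr1 ler_wpDr.
  rewrite mulr0 add0r; apply: le_trans (HJ j Jj).1; apply: centered_mass_ndec.
  move: h; rewrite mulrDl; lra.
- apply: (@le_trans _ _ (\sum_(j < d) (A j (a d + (x + eta) * b d - l j) +
      (dl / 2 * Lam j + Lam j * (j < J)%N%:R)))); last first.
    rewrite !big_split/= lerD2l -mulr_sumr early LdE; exact: lerD.
  apply: ler_sum => j _; have /andP[A0 A1] := centered_mass_le j (a d + (x + eta) * b d - l j).
  have Lj := Lam_ge0 j; have e0 : 0 <= dl / 2 * Lam j by rewrite mulr_ge0// ltW.
  have [jJ|Jj] := ltnP j J.
    rewrite mulr1 addrA ler_wpDl ?addr_ge0//.
    by rewrite ler_piMr// lern1 leq_b1.
  rewrite mulr0 addr0; have [h|h] := leP (l j - a d) (x * b d); last first.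
    by rewrite mulr0 addr_ge0.
  rewrite mulr1 -lerBlDr.
  have -> : Lam j - dl / 2 * Lam j = (1 - dl / 2) * Lam j by rewrite mulrBl mul1r.
  apply: (le_trans (HJ j Jj).2); apply: centered_mass_ndec.
  rewrite mulrDl; lra.
Unshelve. all: by end_near. Qed.

Variables (W : cumulativeBounded (0 : R) (1 : R)) (s : R).
Hypothesis sE : s = 1 \/ s = -1.
Hypothesis lim4 : forall x, {for x, continuous W} ->
  ((\sum_(j < d) Lam j * (s * (l j - a d) <= x * b d)%R%:R) / L d) @[d --> \oo] --> W x.
Let F := oriented_cdf s W.

Lemma oriented_cdf_ndec x y : x <= y -> F x <= F y.
Proof.
rewrite /F /oriented_cdf; case: ifP => _ xy; first exact: cdf_ndec.
rewrite lerD2l lerN2; move: xy; rewrite le_eqVlt => /predU1P[->//|xy].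
by rewrite (le_trans (left_limit_le W _))// le_left_limit// ltrN2.
Qed.

Lemma oriented_cdf_lt_near e : 0 < e -> exists x, F x < e.
Proof.
move=> e0; rewrite /F /oriented_cdf; case: ifP => _; first exact: cdf_lt_near.
have [x Hx] := cdf_gt_near W (e := 1 - e) (ltac:(by rewrite ltrBlDr ltrDl)).
exists (- (x + 1)); rewrite opprK ltrBlDr addrC -ltrBlDr (lt_le_trans Hx)//.
by rewrite le_left_limit// ltrDl.
Qed.

Lemma oriented_cdf_gt_near e : e < 1 -> exists x, e < F x.
Proof.
move=> e0; rewrite /F /oriented_cdf; case: ifP => _; first exact: cdf_gt_near.
have [x Hx] := cdf_lt_near W (e := 1 - e) (ltac:(by rewrite subr_gt0)).
exists (- x); rewrite opprK ltrBrDr addrC -ltrBrDr (le_lt_trans _ Hx)//.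
exact: left_limit_le.
Qed.

Lemma total_mass_gt0 : \forall d \near \oo, 0 < L d.
Proof. by apply: filterS (Linf 1) => d; exact: lt_le_trans. Qed.

(** The limit law of (l j - a d) / b d in a form that serves both
    orientations. Stating bounds at every z < x and every z > x, rather
    than at x, makes it immaterial whether the atoms at x itself are
    counted, which is where the two orientations differ. *)
Lemma mass_near (p r : R) : p < r -> exists x, p < x < r /\ forall dl, 0 < dl ->
  \forall d \near \oo, (forall z, z < x -> H d z <= (F x + dl) * L d) /\
                       (forall z, x < z -> (F x - dl) * L d <= H d z).
Proof.
move=> pr; rewrite /F /oriented_cdf; case: sE => sv; move: lim4; rewrite sv => lim.
  rewrite eqxx; have [x [xpr cx]] := cdf_continuity_dense W pr.
  exists x; split => // dl dl0; near=> d.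
  have d0 : (0 < d)%N by near: d; exact: nbhs_infty_gt.
  have Lp : 0 < L d by near: d; exact: total_mass_gt0.
  have hx : `|W x - (\sum_(j < d) Lam j * (1 * (l j - a d) <= x * b d)%R%:R) / L d| <= dl.
    by near: d; move/cvgrPdist_le : (lim _ cx); apply.
  move: hx; under eq_bigr do rewrite mul1r; rewrite ler_norml => /andP[h1 h2].
  have mono z z' : z <= z' -> H d z <= H d z'.
    move=> zz; apply: ler_sum => j _; rewrite ler_wpM2l ?Lam_ge0// ler_nat.
    by case: (leP _ (z * b d)) => // h; rewrite (le_trans h)// ler_wpM2r// ltW// b0.
  split=> z zx.
  - by rewrite (le_trans (mono _ _ (ltW zx)))// -ler_pdivrMr//; lra.
  - by rewrite (le_trans _ (mono _ _ (ltW zx)))// -ler_pdivlMr//; lra.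
(* For s = -1 the events (l - a <= z b) and (- (l - a) <= y b) with z < -
   y are disjoint, and with z > - y they cover everything. *)
have -> : ((-1 : R) == 1) = false by apply/eqP; lra.
have [y [/andP[y1 y2] cy]] := cdf_continuity_dense W (p := - r) (r := - p)
  (ltac:(by rewrite ltrN2)).
exists (- y); split; first by rewrite ltrNl ltrNr y1 y2.
move=> dl dl0; rewrite opprK left_limit_continuous//; near=> d.
have d0 : (0 < d)%N by near: d; exact: nbhs_infty_gt.
have Lp : 0 < L d by near: d; exact: total_mass_gt0.
have bd := b0 d0.
have : `|W y - (\sum_(j < d) Lam j * (-1 * (l j - a d) <= y * b d)%R%:R) / L d| <= dl.
  by near: d; move/cvgrPdist_le : (lim _ cy); apply.
set Q := \sum_(j < d) _; rewrite ler_norml => /andP[h1 h2].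
have q1 : (W y - dl) * L d <= Q by rewrite -ler_pdivlMr//; lra.
have q2 : Q <= (W y + dl) * L d by rewrite -ler_pdivrMr//; lra.
split=> z zy.
- suff : H d z + Q <= L d by lra.
  rewrite -big_split/=; apply: ler_sum => j _; rewrite -mulrDr ler_piMr ?Lam_ge0//.
  rewrite -natrD lern1; case: (leP (l j - a d) _) => h1'; case: (leP (-1 * _) _) => h2' //.
  exfalso; have : z * b d < - y * b d by rewrite ltr_pM2r.
  lra.
- suff : L d <= H d z + Q by lra.
  rewrite -big_split/=; apply: ler_sum => j _; rewrite -mulrDr ler_peMr ?Lam_ge0//.
  rewrite -natrD ler1n; case: (leP (l j - a d) _) => h1'; case: (leP (-1 * _) _) => h2' //.
  exfalso; have : - y * b d < z * b d by rewrite ltr_pM2r.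
  lra.
Unshelve. all: by end_near. Qed.

(* n d stands for the complexity, D d for the trace and G d tau for the
   mass of the eigenvalues at least tau; through n0, n_ge, n_le and tau_le
   alone does the complexity enter the asymptotics. *)
Variables (D : nat -> R) (eps0 eps : R) (n : nat -> nat).
Hypothesis D0 : forall d, (0 < d)%N -> 0 < D d.
Hypothesis e0 : 0 < eps0.
Hypothesis eps01 : 0 < eps < eps0.
Hypothesis ratio : L d / D d @[d --> \oo] --> eps0 ^+ 2.
Hypothesis n0 : forall d, (0 < d)%N -> (0 < n d)%N.
Hypothesis n_ge : forall d tau, (0 < d)%N -> 0 <= tau ->
  L d <= eps ^+ 2 * D d + G d tau + (n d)%:R * tau.
Hypothesis n_le : forall d tau, (0 < d)%N -> 0 < tau ->
  L d - G d tau < eps ^+ 2 * D d -> (n d)%:R <= 1 + L d / tau.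
Hypothesis tau_le : forall d tau, (0 < d)%N -> 0 < G d tau -> tau <= L d.
Let y := 1 - (eps / eps0) ^+ 2.
Hypothesis cq : {for y, continuous (quantile F)}.
Let q := quantile F y.

Lemma level_in01 : 0 < y < 1.
Proof.
have /andP[ep el] := eps01; rewrite /y subr_gt0 ltrBlDr ltrDl exprn_gt0 ?divr_gt0// andbT.
by rewrite expr_lt1 ?divr_ge0 ?ltW// ltr_pdivrMr// mul1r.
Qed.

(** The relative error budget eps^2 D / L tends to (eps / eps0)^2 = 1 - y. *)
Lemma ratio_near dl : 0 < dl -> \forall d \near \oo,
  (1 - y - dl) * L d <= eps ^+ 2 * D d <= (1 - y + dl) * L d.
Proof.
move=> dl0; have c1 : eps ^+ 2 / (L d / D d) @[d --> \oo] --> eps ^+ 2 / eps0 ^+ 2.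
  apply: cvgM; first exact: cvg_cst.
  by apply: cvgV; [rewrite gt_eqF// exprn_gt0|exact: ratio].
have -> : 1 - y = eps ^+ 2 / eps0 ^+ 2 by rewrite /y subKr expr_div_n.
near=> d; have Lp : 0 < L d by near: d; exact: total_mass_gt0.
have d0 : (0 < d)%N by near: d; exact: nbhs_infty_gt.
have : `|eps ^+ 2 / eps0 ^+ 2 - eps ^+ 2 / (L d / D d)| <= dl.
  by near: d; move/cvgrPdist_le : c1; apply.
have -> : eps ^+ 2 / (L d / D d) = eps ^+ 2 * D d / L d.
  by field; rewrite !gt_eqF// D0.
set r := eps ^+ 2 / _; rewrite ler_norml => /andP[h1 h2].
by apply/andP; split; [rewrite -ler_pdivlMr//|rewrite -ler_pdivrMr//]; lra.
Unshelve. all: by end_near. Qed.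

(** The threshold is tau = exp(- (a + x b)) with x = q + e/2 for the upper
    bound and x = q - e/2 for the lower one: one quarter of e for the
    distance to a point where the limit law is controlled, another for the
    passage from H to G in concentration. *)
Theorem ln_complexity_asymptotics :
  (fun d => ln (n d)%:R) = (fun d => ln (L d) + a d + q * b d) +o_\oo b.
Proof.
apply/eqaddoP => e ep; have e40 : 0 < e / 4 by rewrite divr_gt0.
have qnd := gt_quantile oriented_cdf_ndec oriented_cdf_lt_near oriented_cdf_gt_near level_in01 cq.
have qld := lt_quantile oriented_cdf_ndec oriented_cdf_lt_near oriented_cdf_gt_near level_in01.
have [xu [/andP[xu1 xu2] Hu]] := mass_near (p := q) (r := q + e / 4) (ltac:(by rewrite ltrDl)).
have [xl [/andP[xl1 xl2] Hl]] := mass_near (p := q - e / 4) (r := q) (ltac:(by rewrite ltrBlDr ltrDl)).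
(* F xu exceeds y and F xl falls short of y by fixed amounts, each split
   in four: for the limit law, for concentration, for the ratio D / L, and
   a remainder that stays positive. *)
have [du [du0 duE]] : exists du, 0 < du /\ F xu = y + 4 * du.
  by exists ((F xu - y) / 4); split; [rewrite divr_gt0// subr_gt0 qnd|field].
have [dv [dv0 dvE]] : exists dv, 0 < dv /\ F xl = y - 4 * dv.
  by exists ((y - F xl) / 4); split; [rewrite divr_gt0// subr_gt0 qld|field].
near=> d.
have d0 : (0 < d)%N by near: d; exact: nbhs_infty_gt.
have bd := b0 d0; have Lp : 0 < L d by near: d; exact: total_mass_gt0.
have np : 0 < (n d)%:R :> R by rewrite ltr0n n0.
(* The multiplicative constants 2 and dv in the two bounds become additive
   constants in the logarithm, absorbed by b d. *)
have bbig : ln 2 + `|ln dv| <= e / 4 * b d.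
  by rewrite mulrC -ler_pdivrMr//; near: d; move/cvgryPge : binf; apply.
have hup : ln (n d)%:R <= ln (L d) + a d + q * b d + e * b d.
  have [Hu1 Hu2] : (forall z, z < xu -> H d z <= (F xu + du) * L d) /\
      (forall z, xu < z -> (F xu - du) * L d <= H d z) by near: d; exact: Hu.
  have /(_ (q + e / 4))[_ C2] : forall x,
    G d (expR (- (a d + x * b d))) <= H d (x + e / 4) + du * L d /\
    H d x <= G d (expR (- (a d + (x + e / 4) * b d))) + du * L d.
    by near: d; exact: concentration.
  have /andP[R1 R2] : (1 - y - du) * L d <= eps ^+ 2 * D d <= (1 - y + du) * L d.
    by near: d; exact: ratio_near.
  pose tau := expR (- (a d + (q + e / 4 + e / 4) * b d)).
  have tau0 : 0 < tau by exact: expR_gt0.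
  have g1 : (y + 2 * du) * L d <= G d tau.
    have := le_trans (Hu2 _ xu2) C2; rewrite -/tau.
    rewrite duE; lra.
  have g2 : L d - G d tau < eps ^+ 2 * D d.
    apply: lt_le_trans R1; have := mulr_gt0 du0 Lp; lra.
  have Gp : 0 < G d tau.
    apply: lt_le_trans (g1); apply: mulr_gt0 => //; have /andP[yp _] := level_in01; lra.
  have nle : (n d)%:R <= 2 * (L d / tau).
    apply: (le_trans (n_le d0 tau0 g2)).
    (* The rank 1 spent on the constant function is at most L d / tau. *)
    have : 1 <= L d / tau by rewrite ler_pdivlMr// mul1r; exact: tau_le d0 Gp.
    lra.
  have Ltau : 0 < L d / tau by rewrite divr_gt0.
  have : ln (n d)%:R <= ln (2 * (L d / tau)) by rewrite ler_ln// posrE mulr_gt0.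
  rewrite lnM ?posrE// ln_div ?posrE// /tau expRK.
  have := normr_ge0 (ln dv); have := mulr_gt0 ep bd; move: bbig; lra.
have hlo : ln (L d) + a d + q * b d - e * b d <= ln (n d)%:R.
  have [Hl1 Hl2] : (forall z, z < xl -> H d z <= (F xl + dv) * L d) /\
      (forall z, xl < z -> (F xl - dv) * L d <= H d z) by near: d; exact: Hl.
  have /(_ (q - e / 4 - e / 4))[C1 _] : forall x,
    G d (expR (- (a d + x * b d))) <= H d (x + e / 4) + dv * L d /\
    H d x <= G d (expR (- (a d + (x + e / 4) * b d))) + dv * L d.
    by near: d; exact: concentration.
  have /andP[R1 R2] : (1 - y - dv) * L d <= eps ^+ 2 * D d <= (1 - y + dv) * L d.
    by near: d; exact: ratio_near.
  pose tau := expR (- (a d + (q - e / 4 - e / 4) * b d)).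
  have tau0 : 0 < tau by exact: expR_gt0.
  have g1 : G d tau <= (y - 2 * dv) * L d.
    move: C1; rewrite -/tau subrK => /le_trans; apply.
    have := Hl1 _ xl1; rewrite dvE; lra.
  have nge : dv * L d <= (n d)%:R * tau.
    have := n_ge d0 (ltW tau0); lra.
  have dL : 0 < dv * L d by rewrite mulr_gt0.
  have : ln (dv * L d) <= ln ((n d)%:R * tau).
    by rewrite ler_ln ?posrE ?mulr_gt0.
  rewrite !lnM ?posrE// /tau expRK.
  have := ler_norm (- ln dv); rewrite normrN; have : 0 <= ln 2 :> R by rewrite ln_ge0// ler1n.
  have := mulr_gt0 ep bd; move: bbig; lra.
rewrite [X in `|X| <= _](_ : _ = ln (n d)%:R - (ln (L d) + a d + q * b d))//.
rewrite (ger0_norm (ltW bd)) ler_norml; apply/andP; split; lra.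
Unshelve. all: by end_near. Qed.
End asymptotics.

(** * Complexity of additive random fields *)

(* X j, lam j, l j are indexed from j = 0, so that the first d processes are
   those with j < d; lam j k is the (k + 1)-st eigenvalue. *)
Theorem theorem3 (R : realType)
  (dX : nat -> measure_display) (OX : forall j, measurableType (dX j))
  (PX : forall j, probability (OX j) R) (X : forall j, R -> OX j -> R)
  (dY : nat -> measure_display) (OY : forall d, measurableType (dY d))
  (PY : forall d, probability (OY d) R)
  (Y : forall d, d.-tuple (measurableTypeR R) -> OY d -> R)
  (lam : nat -> nat -> R) (psi : nat -> nat -> measurableTypeR R -> R)
  (k0 : nat -> nat)
  (eps0 : R) (U W : cumulativeBounded (0 : R) (1 : R)) (l : nat -> R) (s : R)
  (a b : nat -> R)
  (barlam := fun j => bar_eig (lam j) (k0 j))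
  (barLam := fun j => bar_trace (lam j) (k0 j))
  (F := oriented_cdf s W) :
  (* the processes X_j and their eigenvalues *)
  (forall j, zero_mean_process (PX j) [set` `[0%R, 1%R]] (X j)) ->
  (forall j, {within [set` `[0%R, 1%R]] `*` [set` `[0%R, 1%R]],
     continuous (fun ts : R * R => cov_fun (PX j) (X j) ts.1 ts.2)}) ->
  (forall j, eigen_system (cov_fun (PX j) (X j)) (lam j) (psi j)) ->
  (* the basic assumption *)
  (forall j, {ae unit_leb, forall t, psi j (k0 j) t = 1}) ->
  (* the additive random fields Y_d *)
  (forall d, (0 < d)%N ->
     [/\ L2_random_field (PY d) (Y d),
         zero_mean_process (PY d) (@unit_cube R d) (Y d)
       & forall t u, unit_cube t -> unit_cube u ->
           cov_fun (PY d) (Y d) t u =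
           \sum_(j < d) cov_fun (PX j) (X j) (tnth t j) (tnth u j)]) ->
  (* (1) *)
  0 < eps0 <= 1 ->
  ((\sum_(j < d) barlam j 0%N) / (\sum_(j < d) sum_seq (lam j)))
    @[d --> \oo] --> 1 - eps0 ^+ 2 ->
  (* (2) *)
  (fun d => \big[Num.max/0]_(j < d) barlam j 1%N) =o_\oo
    (fun d => \sum_(j < d) barLam j) ->
  (* (3) *)
  (\forall j \near \oo, 0 < barLam j) ->
  (forall x, {for x, continuous U} ->
     ((barLam j)^-1 * sum_seq (fun k => barlam j k.+1 *
        (- ln (barlam j k.+1) - l j <= x)%R%:R)) @[j --> \oo] --> U x) ->
  (s = 1 /\ nondecreasing_seq l) \/ (s = -1 /\ nonincreasing_seq l) ->
  (* (4) *)
  (forall d, (0 < d)%N -> 0 < b d) ->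
  b d @[d --> \oo] --> +oo ->
  (forall x, {for x, continuous W} ->
     ((\sum_(j < d) barLam j * (s * (l j - a d) <= x * b d)%R%:R) /
        (\sum_(m < d) barLam m)) @[d --> \oo] --> W x) ->
  forall eps, 0 < eps < eps0 ->
  {for 1 - (eps / eps0) ^+ 2, continuous (quantile F)} ->
  (fun d => ln (approx_complexity (PY d) (Y d) eps)%:R) =
    (fun d => ln (\sum_(j < d) barLam j) + a d
              + quantile F (1 - (eps / eps0) ^+ 2) * b d) +o_\oo b.
Proof.
move=> zX cX eX basic fY /andP[eps0_gt0 eps0_le1] lim1 lim2 lim3a lim3b sE b0 binf lim4
  eps /andP[eps_gt0 eps_lt] cq.
pose K j := cov_fun (PX j) (X j).
have sK j t u : K j t u = K j u t by rewrite /K /cov_fun covarianceC.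
pose v j k := lam j (skip (k0 j) k).
have vE j : (fun k => bar_eig (lam j) (k0 j) k.+1) = v j.
  by apply/funext => k; exact: bar_eig_skip.
have LamE j : barLam j = sum_seq (v j) by rewrite -vE.
have v0 j k : 0 <= v j k by exact: eigen_ge0 (eX j) _.
have vS j : nonincreasing_seq (v j).
  move=> k k' kk; apply: (eigen_noninc (eX j)); rewrite /skip.
  by case: (ltnP k (k0 j)) => h1; case: (ltnP k' (k0 j)) => h2; lia.
have cv j : cvgn (series (v j)).
  have [f1 f2 f3] := fY j.+1 isT.
  have := (bar_cvg cX eX basic (ltn0Sn j) f1 f2 f3). by move=> H; exact: (H ord_max).
pose D d := \sum_(j < d) sum_seq (lam j).
pose L d := \sum_(j < d) sum_seq (v j).
have DE d : (0 < d)%N -> D d = \sum_(j < d) lam j (k0 j) + L d.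
  by move=> d0; have [f1 f2 f3] := fY d d0; exact: (sum_eigenvalues_split cX eX basic d0 f1 f2 f3).
have D0 d : (0 < d)%N -> 0 < D d.
  by move=> d0; have [f1 f2 f3] := fY d d0; exact: (sum_eigenvalues_gt0 cX eX basic d0 f1 f2 f3).
have ratio : L d / D d @[d --> \oo] --> eps0 ^+ 2.
  have -> : eps0 ^+ 2 = 1 - (1 - eps0 ^+ 2) by rewrite subKr.
  have c1 : 1 - (\sum_(j < d) barlam j 0%N) / D d @[d --> \oo] --> 1 - (1 - eps0 ^+ 2).
    by apply: cvgB; [exact: cvg_cst|exact: lim1].
  apply: cvg_trans c1; apply: near_eq_cvg; exists 1%N => // d /= d0.
  by rewrite DE// /L; field; rewrite -/(L d) -DE// gt_eqF// D0.
have sE' : s = 1 \/ s = -1 by case: sE => -[->]; [left|right].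
have -> : (fun d => ln (\sum_(j < d) barLam j) + a d +
    quantile F (1 - (eps / eps0) ^+ 2) * b d) =
  (fun d => ln (L d) + a d + quantile F (1 - (eps / eps0) ^+ 2) * b d).
  by apply/funext => d; rewrite /L; under eq_bigr do rewrite LamE.
have lim2' : (fun d => \big[Num.max/0]_(j < d) v j 0%N) =o_\oo (fun d => L d).
  have -> : (fun d => \big[Num.max/0]_(j < d) v j 0%N) =
      (fun d => \big[Num.max/0]_(j < d) barlam j 1%N).
    by apply/funext => d; apply: eq_bigr => j _; rewrite -vE.
  have -> : (fun d => L d) = (fun d => \sum_(j < d) barLam j).
    by apply/funext => d; apply: eq_bigr => j _; rewrite LamE.
  exact: lim2.
have Lam_gt0 : \forall j \near \oo, 0 < sum_seq (v j).
  by apply: filterS lim3a => j; rewrite LamE.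
have Linf := total_mass_unbounded v0 vS cv Lam_gt0 lim2'.
have tight x : {for x, continuous U} -> (sum_seq (v j))^-1 *
    sum_seq (fun k => v j k * (- ln (v j k) - l j <= x)%R%:R) @[j --> \oo] --> U x.
  move=> cx; have := lim3b x cx.
  suff -> : (fun j => (barLam j)^-1 * sum_seq (fun k => barlam j k.+1 *
        (- ln (barlam j k.+1) - l j <= x)%R%:R)) =
      (fun j => (sum_seq (v j))^-1 *
        sum_seq (fun k => v j k * (- ln (v j k) - l j <= x)%R%:R)) by [].
  apply/funext => j; rewrite LamE; congr (_ * sum_seq _); apply/funext => k.
  by rewrite /barlam bar_eig_skip.
have lim4' x : {for x, continuous W} ->
    (\sum_(j < d) sum_seq (v j) * (s * (l j - a d) <= x * b d)%R%:R) / L d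
      @[d --> \oo] --> W x.
  move=> cx; have := lim4 x cx.
  suff -> : (fun d => (\sum_(j < d) barLam j * (s * (l j - a d) <= x * b d)%R%:R) /
        (\sum_(m < d) barLam m)) =
      (fun d => (\sum_(j < d) sum_seq (v j) * (s * (l j - a d) <= x * b d)%R%:R) / L d).
    by [].
  apply/funext => d; rewrite /L; congr (_ / _); apply: eq_bigr => j _; by rewrite LamE.
have n0 d : (0 < d)%N -> (0 < approx_complexity (PY d) (Y d) eps)%N.
  move=> d0; have [f1 f2 f3] := fY d d0.
  by have [[]] := approx_complexityP cX sK eX basic d0 f1 f2 f3 eps_gt0.
have n_ge d tau : (0 < d)%N -> 0 <= tau -> L d <= eps ^+ 2 * D d +
    \sum_(j < d) sum_seq (fun k => v j k * (tau <= v j k)%R%:R) +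
    (approx_complexity (PY d) (Y d) eps)%:R * tau.
  move=> d0 tau0; have [f1 f2 f3] := fY d d0.
  exact: (approx_complexity_ge cX sK eX basic d0 f1 f2 f3 eps_gt0 tau0).
have n_le d tau : (0 < d)%N -> 0 < tau ->
    L d - \sum_(j < d) sum_seq (fun k => v j k * (tau <= v j k)%R%:R) < eps ^+ 2 * D d ->
    (approx_complexity (PY d) (Y d) eps)%:R <= 1 + L d / tau.
  move=> d0 tau0 h; have [f1 f2 f3] := fY d d0.
  exact: (approx_complexity_le cX sK eX basic d0 f1 f2 f3 eps_gt0 tau0 h).
have tau_le d tau : (0 < d)%N ->
    0 < \sum_(j < d) sum_seq (fun k => v j k * (tau <= v j k)%R%:R) -> tau <= L d.
  move=> d0 h; have [f1 f2 f3] := fY d d0.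
  exact: (threshold_le cX eX basic d0 f1 f2 f3 h).
have eps01 : 0 < eps < eps0 by rewrite eps_gt0.
exact: (ln_complexity_asymptotics v0 cv Lam_gt0 Linf tight b0 binf sE' lim4'
  D0 eps0_gt0 eps01 ratio n0 n_ge n_le tau_le cq).
Qed.
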